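(* Let $\omega$ be a solution of the Sinh-Gordon equation $\Delta\omega=-8\sinh\omega$ on an open, connected, simply connected domain $U$ in $\mathbb{C}$, and let $p:U\to\mathbb{S}^3$ be the associated minimal surface with complex coordinate $z=u+Iv$ such that $\sigma(\partial z,\partial z)=-1$. Then there exists a Lagrangian immersion $f:U\times\mathbb{R}\to\mathbb{S}^3\times\mathbb{S}^3$, $x=(z,t)\mapsto(p(x),q(x))$ with $p(z,t)=p(z)$, into the nearly Kähler $\mathbb{S}^3\times\mathbb{S}^3$, where $q$ is determined by $$\frac{\partial q}{\partial t}=-\frac{\sqrt3\,e^{-\omega}}{4}\,q\,(\alpha_2\times\alpha_3),$$ $$\frac{\partial q}{\partial u}=\frac{e^{-\omega}}{8}\left(4e^{\omega}q\,\alpha_2-4\,q\,\alpha_3+\omega_v\,q\,(\alpha_2\times\alpha_3)\right),$$ $$\frac{\partial q}{\partial v}=-\frac{e^{-\omega}}{8}\left(4\,q\,\alpha_2-4e^{\omega}q\,\alpha_3+\omega_u\,q\,(\alpha_2\times\alpha_3)\right),$$ with $\alpha_2=\bar p\,p_u$ and $\alpha_3=\bar p\,p_v$.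
   Context: $\mathbb{S}^3$ is the set of unit quaternions in $\mathbb{H}$. Products are quaternionic products, $\bar p$ is the quaternionic conjugate, and for imaginary quaternions $\alpha,\beta$ the cross product $\alpha\times\beta$ is the imaginary part of $\alpha\beta$ (the usual vector product on $\mathrm{Im}\,\mathbb{H}\cong\mathbb{R}^3$). $\Delta=\partial_u^2+\partial_v^2$ is the Euclidean Laplacian on $\mathbb{C}=\mathbb{R}^2$ with $z=u+Iv$, where $I$ is the complex unit (distinct from the quaternion units). Put $\partial z=\tfrac12(\partial u-I\partial v)$, and extend everything $I$-linearly. The minimal surface associated to a solution $\omega$ of the Sinh-Gordon equation is the (unique up to congruence) minimal immersion $p:U\to\mathbb{S}^3$ such that: - $\langle p_u,p_u\rangle=\langle p_v,p_v\rangle=2e^{\omega}$ and $\langle p_u,p_v\rangle=0$; - $\sigma(\partial z,\partial z)=-1$, where $\sigma$ is the component of the second fundamental form in the direction of the unit normal $N=p\,\dfrac{\alpha_2\times\alpha_3}{2e^{\omega}}$, with $\alpha_2=\bar p\,p_u$, $\alpha_3=\bar p\,p_v$. Equivalently, $p_{zz}=\omega_zp_z-N$ and $p_{z\bar z}=-e^{\omega}p$. Tangent vectors of $\mathbb{S}^3\times\mathbb{S}^3$ at $(p,q)$ are pairs $(U',V')$. The nearly Kähler structure is $J(U',V')_{(p,q)}=\tfrac{1}{\sqrt3}(2pq^{-1}V'-U',\,-2qp^{-1}U'+V')$ with metric $g(Z,Z')=\tfrac12(\langle Z,Z'\rangle+\langle JZ,JZ'\rangle)$, where $\langle\cdot,\cdot\rangle$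 is the Euclidean product metric. An immersion of a $3$-manifold is Lagrangian if $J$ maps tangent vectors to normal vectors (with respect to $g$). *)

(* Defs.v *)
From HB Require Import structures.
From mathcomp Require Import all_boot all_order all_algebra.
From mathcomp Require Import all_classical all_reals all_analysis.
From mathcomp Require Import complex.

Set Implicit Arguments.
Unset Strict Implicit.
Unset Printing Implicit Defensive.

Import Order.TTheory GRing.Theory Num.Theory.
Import numFieldNormedType.Exports.
Local Open Scope classical_set_scope.
Local Open Scope ring_scope.

(* The quaternion a + b i + c j + d k is the row (a, b, c, d), so that the
   vector space, topology and differential calculus are those of R^4. *)
Notation quat R := 'rV[R]_4.

Section Quaternions.
Context {R : realType}.
Implicit Types x y : quat R.

Definition qre x : R := x 0 (@Ordinal 4 0 isT).
Definition qi x : R := x 0 (@Ordinal 4 1 isT).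
Definition qj x : R := x 0 (@Ordinal 4 2 isT).
Definition qk x : R := x 0 (@Ordinal 4 3 isT).

Definition mkquat (a b c d : R) : quat R := \row_(i < 4) [:: a; b; c; d]`_i.

Definition qmul x y : quat R :=
  let: (a, b, c, d) := (qre x, qi x, qj x, qk x) in
  let: (a', b', c', d') := (qre y, qi y, qj y, qk y) in
  mkquat (a * a' - b * b' - c * c' - d * d')
         (a * b' + b * a' + c * d' - d * c')
         (a * c' - b * d' + c * a' + d * b')
         (a * d' + b * c' - c * b' + d * a').

Definition qconj x : quat R := mkquat (qre x) (- qi x) (- qj x) (- qk x).

Definition qim x : quat R := mkquat 0 (qi x) (qj x) (qk x).

Definition qdot x y : R := \sum_(i < 4) x 0 i * y 0 i.

Definition qinv x : quat R := (qdot x x)^-1 *: qconj x.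

(* The vector product of imaginary quaternions. *)
Definition qcross x y : quat R := qim (qmul x y).

Definition sphere3 : set (quat R) := [set x | qdot x x = 1].

End Quaternions.

Section Calculus.
Context {R : realType}.

(* f is of class C^k on the open set A (values of f outside A are irrelevant). *)
Fixpoint class_C {V W : normedModType R} (k : nat) (A : set V) (f : V -> W) :
    Prop :=
  if k is k'.+1 then
    (forall x, A x -> differentiable f x) /\
    (forall v : V, class_C k' A ('D_v f))
  else forall x, A x -> {for x, continuous f}.

Definition smooth_on {V W : normedModType R} (A : set V) (f : V -> W) : Prop :=
  forall k, class_C k A f.

Definition immersion_on {V W : normedModType R} (A : set V) (f : V -> W) :
    Prop :=
  smooth_on A f /\ (forall x, A x -> injective ('d f x)).

(* Every loop in A is homotopic in A, with fixed base point, to a constant;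
   connectedness is a separate condition. *)
Definition simply_connected {T : topologicalType} (A : set T) : Prop :=
  forall gamma : R -> T,
    {within `[0, 1], continuous gamma} ->
    (forall s, s \in `[0, 1] -> A (gamma s)) ->
    gamma 0 = gamma 1 ->
    exists H : R * R -> T,
      [/\ {within `[0, 1] `*` `[0, 1], continuous H},
          forall s r, s \in `[0, 1] -> r \in `[0, 1] -> A (H (s, r)),
          forall s, s \in `[0, 1] -> H (s, 0) = gamma s,
          forall s, s \in `[0, 1] -> H (s, 1) = gamma 0 &
          forall r, r \in `[0, 1] -> H (0, r) = gamma 0 /\ H (1, r) = gamma 0].

(* The complex plane is R * R, with z = u + I v represented by (u, v). *)
Definition e_u : R * R := (1, 0).
Definition e_v : R * R := (0, 1).

Definition laplacian (w : R * R -> R) (z : R * R) : R :=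
  'D_e_u ('D_e_u w) z + 'D_e_v ('D_e_v w) z.

Definition sinh (x : R) : R := (expR x - expR (- x)) / 2.

Definition sinh_gordon (U : set (R * R)) (w : R * R -> R) : Prop :=
  smooth_on U w /\ (forall z, U z -> laplacian w z = - 8 * sinh (w z)).

End Calculus.

Section Surface.
Context {R : realType}.
Implicit Types (w : R * R -> R) (p : R * R -> quat R) (z : R * R).

Definition alpha2 p z : quat R := qmul (qconj (p z)) ('D_e_u p z).
Definition alpha3 p z : quat R := qmul (qconj (p z)) ('D_e_v p z).
Definition alpha23 p z : quat R := qcross (alpha2 p z) (alpha3 p z).

Definition unit_normal w p z : quat R :=
  qmul (p z) ((2 * expR (w z))^-1 *: alpha23 p z).

(* The N-component of the second fundamental form in the 3-sphere; as N is
   orthogonal to p, it is computed by the flat derivative of quaternions. *)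
Definition sff w p z (X Y : R * R) : R :=
  qdot ('D_X ('D_Y p) z) (unit_normal w p z).

Definition mean_curvature w p z : R :=
  let E := qdot ('D_e_u p z) ('D_e_u p z) in
  let F := qdot ('D_e_u p z) ('D_e_v p z) in
  let G := qdot ('D_e_v p z) ('D_e_v p z) in
  (G * sff w p z e_u e_u - 2 * F * sff w p z e_u e_v + E * sff w p z e_v e_v)
    / (2 * (E * G - F ^+ 2)).

(* The complex bilinear extension of sff; a complexified tangent vector
   a d/du + b d/dv is the pair (a, b). *)
Definition sffC w p z (X Y : R[i] * R[i]) : R[i] :=
  X.1 * Y.1 * (sff w p z e_u e_u)%:C%C + X.1 * Y.2 * (sff w p z e_u e_v)%:C%C
  + X.2 * Y.1 * (sff w p z e_v e_u)%:C%C + X.2 * Y.2 * (sff w p z e_v e_v)%:C%C.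

Definition dz : R[i] * R[i] := (2^-1, - (2^-1 * 'i%C)).

Record associated_minimal_surface (U : set (R * R)) w p : Prop := {
  ams_sphere : forall z, U z -> sphere3 (p z);
  ams_immersion : immersion_on U p;
  ams_minimal : forall z, U z -> mean_curvature w p z = 0;
  ams_uu : forall z, U z -> qdot ('D_e_u p z) ('D_e_u p z) = 2 * expR (w z);
  ams_vv : forall z, U z -> qdot ('D_e_v p z) ('D_e_v p z) = 2 * expR (w z);
  ams_uv : forall z, U z -> qdot ('D_e_u p z) ('D_e_v p z) = 0;
  ams_sff : forall z, U z -> sffC w p z dz dz = -1
}.

End Surface.

Section NearlyKahler.
Context {R : realType}.

(* Tensors at the point x = (p, q) of the product of two 3-spheres. *)
Definition nk_J (x Z : quat R * quat R) : quat R * quat R :=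
  let: (p, q) := x in
  let: (U', V') := Z in
  ((Num.sqrt 3)^-1 *: (2 *: qmul (qmul p (qinv q)) V' - U'),
   (Num.sqrt 3)^-1 *: (- (2 *: qmul (qmul q (qinv p)) U') + V')).

Definition prod_dot (Z Z' : quat R * quat R) : R :=
  qdot Z.1 Z'.1 + qdot Z.2 Z'.2.

Definition nk_g (x Z Z' : quat R * quat R) : R :=
  2^-1 * (prod_dot Z Z' + prod_dot (nk_J x Z) (nk_J x Z')).

Record lagrangian_immersion (A : set (R * R * R))
    (f : R * R * R -> quat R * quat R) : Prop := {
  lag_sphere : forall x, A x -> sphere3 (f x).1 /\ sphere3 (f x).2;
  lag_immersion : immersion_on A f;
  lag_normal : forall x, A x -> forall X Y : R * R * R,
    nk_g (f x) (nk_J (f x) ('d f x X)) ('d f x Y) = 0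
}.

(* Points of the domain are ((u, v), t). *)
Record q_system (U : set (R * R)) (w : R * R -> R) (p : R * R -> quat R)
    (q : R * R * R -> quat R) : Prop := {
  q_system_t : forall z t, U z ->
    'D_(0, 1) q (z, t) =
      - (Num.sqrt 3 * expR (- w z) / 4) *: qmul (q (z, t)) (alpha23 p z);
  q_system_u : forall z t, U z ->
    'D_(e_u, 0) q (z, t) =
      (expR (- w z) / 8) *:
        ((4 * expR (w z)) *: qmul (q (z, t)) (alpha2 p z)
         - 4 *: qmul (q (z, t)) (alpha3 p z)
         + 'D_e_v w z *: qmul (q (z, t)) (alpha23 p z));
  q_system_v : forall z t, U z ->
    'D_(e_v, 0) q (z, t) =
      - (expR (- w z) / 8) *:
        (4 *: qmul (q (z, t)) (alpha2 p z)
         - (4 * expR (w z)) *: qmul (q (z, t)) (alpha3 p z)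
         + 'D_e_u w z *: qmul (q (z, t)) (alpha23 p z))
}.

End NearlyKahler.

(* Main.v *)
Require Import Defs.
From HB Require Import structures.
From mathcomp Require Import all_boot all_order all_algebra.
From mathcomp Require Import all_classical all_reals all_analysis.
From mathcomp Require Import complex ring lra.

(** The system for q prescribes the form q^-1 dq: on U x R it is
      A du + B dv - (sqrt 3 / 2) n dt,
    where n = p^-1 N, and A and B are combinations of alpha2, alpha3 and n whose
    coefficients depend on w alone. All of these take imaginary values, so every
    solution keeps its norm, and the left translates of a solution are
    solutions. On a simply connected U such a system is solvable as soon as it is
    flat.

    The frame alpha2, alpha3, n. It is orthogonal, with |alpha2|^2 = |alpha3|^2
    = 2 e^w and |n| = 1. The symmetry of second derivatives of p, the conformality
    of p, minimality and sigma(dz, dz) = -1 determine all scalar products of the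
    derivatives of the frame with the frame, hence those derivatives themselves
    (alpha2_u, ..., frame_normal_v). Substituted in A_v - B_u - [A, B], they leave
    only a multiple of n, with coefficient a quarter of the Laplacian of w plus
    2 sinh w: this is connection_flat, the only use of the Sinh-Gordon equation.

    Removing t. The structure equations also say dn = [n, A du + B dv]. Therefore,
    if Q solves dQ = Q (A du + B dv) on U, then
      q(z, t) = Q(z) exp(- (sqrt 3 / 2) t n(z))
    solves the whole system, the exponential being a cosine and a sine because
    n^2 = -1. It remains to integrate a flat system in the plane.

    Local solutions (local_flat_solution). Solve a linear ordinary equation along
    a horizontal segment, then along every vertical segment. The result satisfies
    the v-equation by construction. For the u-equation the derivative of the
    vertical transport with respect to the starting column is needed; flatness
    identifies it (transport_variation).

    Global solutions (global_flat_solution). Two local solutions differ by a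
    constant left factor, so a solution can be continued along every path, and over
    every square mapped to U. Applied to a homotopy that contracts a loop, this
    shows that continuation along a loop returns to its initial value, so the value
    at the end of a path depends only on the end point.

    Lagrangian condition. Write two tangent vectors of the immersion as (p X, q Y)
    and (p X', q Y'). Then g(J(p X, q Y), (p X', q Y')) is a multiple of
    Y . X' - X . Y'. It vanishes because the coefficients of A on alpha3 and of B on
    alpha2 agree, while n is orthogonal to alpha2 and alpha3 (form_dot_algebra).

    Uniqueness. The ratio of two solutions, q' times the conjugate of q, has zero
    derivative, hence is constant on the connected set U x R. *)

Set Implicit Arguments.
Unset Strict Implicit.
Unset Printing Implicit Defensive.

Import Order.TTheory GRing.Theory Num.Theory.
Import numFieldNormedType.Exports.
Local Open Scope classical_set_scope.
Local Open Scope ring_scope.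

(** * Quaternion algebra *)

Section QuaternionAlgebra.
Context {R : realType}.
Implicit Types (x y z : quat R) (a b c d : R).

Definition quat1 : quat R := mkquat 1 0 0 0.

Lemma qre_mk a b c d : qre (mkquat a b c d) = a. Proof. by rewrite /qre mxE. Qed.
Lemma qi_mk a b c d : qi (mkquat a b c d) = b. Proof. by rewrite /qi mxE. Qed.
Lemma qj_mk a b c d : qj (mkquat a b c d) = c. Proof. by rewrite /qj mxE. Qed.
Lemma qk_mk a b c d : qk (mkquat a b c d) = d. Proof. by rewrite /qk mxE. Qed.

Lemma qcoordD x y : ((qre (x + y) = qre x + qre y)%R * (qi (x + y) = qi x + qi y)%R *
  (qj (x + y) = qj x + qj y)%R * (qk (x + y) = qk x + qk y)%R)%type.
Proof. by rewrite /qre /qi /qj /qk !mxE. Qed.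

Lemma qcoordN x : ((qre (- x) = - qre x)%R * (qi (- x) = - qi x)%R *
  (qj (- x) = - qj x)%R * (qk (- x) = - qk x)%R)%type.
Proof. by rewrite /qre /qi /qj /qk !mxE. Qed.

Lemma qcoordZ a x : ((qre (a *: x) = a * qre x)%R * (qi (a *: x) = a * qi x)%R *
  (qj (a *: x) = a * qj x)%R * (qk (a *: x) = a * qk x)%R)%type.
Proof. by rewrite /qre /qi /qj /qk !mxE. Qed.

Lemma qcoord0 : ((qre (0 : quat R) = 0)%R * (qi (0 : quat R) = 0)%R *
  (qj (0 : quat R) = 0)%R * (qk (0 : quat R) = 0)%R)%type.
Proof. by rewrite /qre /qi /qj /qk !mxE. Qed.

Definition qcoordE := (qre_mk, qi_mk, qj_mk, qk_mk, qcoordD, qcoordN, qcoordZ, qcoord0).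

Lemma ord4P (P : 'I_4 -> Prop) : P (@Ordinal 4 0 isT) -> P (@Ordinal 4 1 isT) ->
  P (@Ordinal 4 2 isT) -> P (@Ordinal 4 3 isT) -> forall i, P i.
Proof.
move=> P0 P1 P2 P3 [[|[|[|[|//]]]] i4];
  by rewrite (bool_irrelevance i4 isT).
Qed.

Lemma quatP x y : qre x = qre y -> qi x = qi y -> qj x = qj y -> qk x = qk y -> x = y.
Proof. by move=> ????; apply/rowP; apply: ord4P. Qed.

Lemma qdotE x y : qdot x y = qre x * qre y + qi x * qi y + qj x * qj y + qk x * qk y.
Proof.
rewrite /qdot !big_ord_recl big_ord0 addr0 !addrA /qre /qi /qj /qk.
by congr (_ + _ + _ + _); congr (x 0 _ * y 0 _); exact: val_inj.
Qed.

End QuaternionAlgebra.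

Ltac quat_simp := rewrite /qcross /qinv ?qdotE /qmul /qconj /qim /quat1 ?qcoordE.
Ltac quat_ring := apply: quatP; quat_simp; ring.

Section QuaternionProducts.
Context {R : realType}.
Implicit Types (x y z : quat R) (a b c d : R).

Lemma qmulA x y z : qmul x (qmul y z) = qmul (qmul x y) z.
Proof. by quat_ring. Qed.
Lemma qmulDl x y z : qmul (x + y) z = qmul x z + qmul y z.
Proof. by quat_ring. Qed.
Lemma qmulDr x y z : qmul x (y + z) = qmul x y + qmul x z.
Proof. by quat_ring. Qed.
Lemma qmulNl x y : qmul (- x) y = - qmul x y.
Proof. by quat_ring. Qed.
Lemma qmulNr x y : qmul x (- y) = - qmul x y.
Proof. by quat_ring. Qed.
Lemma qmulBl x y z : qmul (x - y) z = qmul x z - qmul y z.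
Proof. by quat_ring. Qed.
Lemma qmulBr x y z : qmul x (y - z) = qmul x y - qmul x z.
Proof. by quat_ring. Qed.
Lemma qmulZl a x y : qmul (a *: x) y = a *: qmul x y.
Proof. by quat_ring. Qed.
Lemma qmulZr a x y : qmul x (a *: y) = a *: qmul x y.
Proof. by quat_ring. Qed.
Lemma qmul1l x : qmul quat1 x = x.
Proof. by quat_ring. Qed.
Lemma qmul1r x : qmul x quat1 = x.
Proof. by quat_ring. Qed.
Lemma qmul0l x : qmul 0 x = 0.
Proof. by quat_ring. Qed.
Lemma qmul0r x : qmul x 0 = 0.
Proof. by quat_ring. Qed.
Lemma qconjM x y : qconj (qmul x y) = qmul (qconj y) (qconj x).
Proof. by quat_ring. Qed.
Lemma qconjK : involutive (@qconj R).
Proof. by move=> x; quat_ring. Qed.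
Lemma qmulVq x : qmul (qconj x) x = qdot x x *: quat1.
Proof. by quat_ring. Qed.
Lemma qmulqV x : qmul x (qconj x) = qdot x x *: quat1.
Proof. by quat_ring. Qed.
Lemma qdotM x y : qdot (qmul x y) (qmul x y) = qdot x x * qdot y y.
Proof. by rewrite !qdotE; quat_simp; ring. Qed.
Lemma qdot_mull x y z : qdot (qmul x y) (qmul x z) = qdot x x * qdot y z.
Proof. by rewrite !qdotE; quat_simp; ring. Qed.
Lemma qdot_conj x : qdot (qconj x) (qconj x) = qdot x x.
Proof. by rewrite !qdotE; quat_simp; ring. Qed.
Lemma qdotC x y : qdot x y = qdot y x.
Proof. by rewrite !qdotE; ring. Qed.
Lemma qdotDl x y z : qdot (x + y) z = qdot x z + qdot y z.
Proof. by rewrite !qdotE; quat_simp; ring. Qed.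
Lemma qdotZl a x z : qdot (a *: x) z = a * qdot x z.
Proof. by rewrite !qdotE; quat_simp; ring. Qed.
Lemma qdotNl x z : qdot (- x) z = - qdot x z.
Proof. by rewrite !qdotE; quat_simp; ring. Qed.
Lemma qdotDr x y z : qdot z (x + y) = qdot z x + qdot z y.
Proof. by rewrite !qdotE; quat_simp; ring. Qed.
Lemma qdotZr a x z : qdot z (a *: x) = a * qdot z x.
Proof. by rewrite !qdotE; quat_simp; ring. Qed.
Lemma qdotNr x z : qdot z (- x) = - qdot z x.
Proof. by rewrite !qdotE; quat_simp; ring. Qed.
Lemma qdot11 : qdot quat1 quat1 = 1 :> R.
Proof. by rewrite !qdotE; quat_simp; ring. Qed.

Lemma qmul_qdot0 x y : qre x = 0 -> qdot (qmul y x) y = 0.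
Proof. by move=> x0; rewrite !qdotE; quat_simp; rewrite x0; ring. Qed.

Lemma unit_conjK x y : qdot x x = 1 -> qmul (qconj x) (qmul x y) = y.
Proof. by move=> x1; rewrite qmulA qmulVq x1 scale1r qmul1l. Qed.
Lemma unit_mulK x y : qdot x x = 1 -> qmul x (qmul (qconj x) y) = y.
Proof. by move=> x1; rewrite qmulA qmulqV x1 scale1r qmul1l. Qed.

Lemma qcoord_norm x i : `|x 0 i| <= `|x|.
Proof.
rewrite [leRHS]/Num.Def.normr/= mx_normrE.
by apply: le_trans; last exact: (le_bigmax _ _ (0, i)).
Qed.

(** The topology of quaternions is that of the sup norm on rows. It differs from
    the Euclidean norm, but all that the estimates need is norm_qmul and the bound
    qdot_norm_le1 on unit quaternions. *)
Lemma norm_quat_le x b : 0 <= b -> (forall i, `|x 0 i| <= b) -> `|x| <= b.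
Proof.
move=> b0 xb; rewrite [leLHS]/Num.Def.normr/= mx_normrE bigmax_le// => -[i j] _ /=.
by rewrite (ord1 i).
Qed.

Lemma qdot_norm_le1 x : qdot x x = 1 -> `|x| <= 1.
Proof.
rewrite qdotE => x1.
have h a s : a * a + s = 1 -> 0 <= s -> `|a| <= 1.
  by move=> e s0; rewrite ler_norml; apply/andP; split; nra.
have sq a : 0 <= a * a by rewrite -expr2 sqr_ge0.
apply: norm_quat_le => //; apply: ord4P.
- by apply: (h (qre x) (qi x * qi x + qj x * qj x + qk x * qk x)); [rewrite -x1; ring|rewrite !addr_ge0].
- by apply: (h (qi x) (qre x * qre x + qj x * qj x + qk x * qk x)); [rewrite -x1; ring|rewrite !addr_ge0].
- by apply: (h (qj x) (qre x * qre x + qi x * qi x + qk x * qk x)); [rewrite -x1; ring|rewrite !addr_ge0].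
- by apply: (h (qk x) (qre x * qre x + qi x * qi x + qj x * qj x)); [rewrite -x1; ring|rewrite !addr_ge0].
Qed.

Lemma norm_conj x : `|qconj x| = `|x|.
Proof.
have h y : `|qconj y| <= `|y|.
  apply: norm_quat_le => //; apply: ord4P; rewrite mxE /= ?normrN; exact: qcoord_norm.
by apply/le_anti; rewrite h -{1}(qconjK x) h.
Qed.

Lemma norm_qmul x y : `|qmul x y| <= 4 * `|x| * `|y|.
Proof.
have h (a b c d a' b' c' d' N M : R) : `|a| <= N -> `|b| <= N -> `|c| <= N ->
    `|d| <= N -> `|a'| <= M -> `|b'| <= M -> `|c'| <= M -> `|d'| <= M ->
    `|a * a' + b * b' + c * c' + d * d'| <= 4 * N * M.
  move=> ha hb hc hd ha' hb' hc' hd'.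
  have p e f : `|e| <= N -> `|f| <= M -> `|e * f| <= N * M.
    by move=> he hf; rewrite normrM ler_pM.
  rewrite -mulrA (_ : 4 * (N * M) = N * M + N * M + N * M + N * M); last by ring.
  by do 3!(apply: le_trans (ler_normD _ _) _; apply: lerD; last exact: p);
    exact: p.
apply: norm_quat_le; first by rewrite !mulr_ge0.
have X := qcoord_norm x; have Y := qcoord_norm y.
apply: ord4P; rewrite mxE /= -?mulrN; apply: h; rewrite ?normrN; (exact: X || exact: Y).
Qed.

End QuaternionProducts.

(** * Directional derivatives of quaternion-valued functions *)

Section DirectionalDerivatives.
Context {R : realType} {V : normedModType R}.
Implicit Types (f g : V -> R) (F G : V -> quat R) (dF dG : quat R) (x v : V).

Lemma is_derive_add (W : normedModType R) (f g : V -> W) x v df dg :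
  is_derive x v f df -> is_derive x v g dg ->
  is_derive x v (fun y => f y + g y) (df + dg).
Proof. by move=> hf hg; exact: (is_deriveD hf hg). Qed.

Lemma is_derive_opp (W : normedModType R) (f : V -> W) x v df :
  is_derive x v f df -> is_derive x v (fun y => - f y) (- df).
Proof. by move=> hf; exact: (is_deriveN hf). Qed.

Lemma is_derive_mul f g x v (df dg : R) :
  is_derive x v f df -> is_derive x v g dg ->
  is_derive x v (fun y => f y * g y) (df * g x + f x * dg).
Proof.
move=> hf hg; have -> : df * g x + f x * dg = f x *: dg + g x *: df.
  by rewrite addrC [df * _]mulrC.
have -> : (fun y => f y * g y) = f * g by apply/funext.
exact: is_deriveM.
Qed.

Lemma is_derive_coord F x v dF i :
  is_derive x v F dF -> is_derive x v (fun y => F y 0 i) (dF 0 i).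
Proof.
move=> [h <-]; split; first by move/derivable_mxP: h.
by rewrite derive_mx // mxE.
Qed.

Lemma is_derive_quat F x v dF :
  (forall i, is_derive x v (fun y => F y 0 i) (dF 0 i)) -> is_derive x v F dF.
Proof.
move=> h; have hF : derivable F x v.
  by apply/derivable_mxP => j i; rewrite (ord1 j); case: (h i).
split => //; rewrite derive_mx //; apply/matrixP => j i.
by rewrite mxE (ord1 j); case: (h i).
Qed.

Lemma is_derive_qmul F G x v dF dG :
  is_derive x v F dF -> is_derive x v G dG ->
  is_derive x v (fun y => qmul (F y) (G y)) (qmul dF (G x) + qmul (F x) dG).
Proof.
move=> hF hG; have f i := is_derive_coord i hF; have g i := is_derive_coord i hG.
pose o0 := @Ordinal 4 0 isT; pose o1 := @Ordinal 4 1 isT.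
pose o2 := @Ordinal 4 2 isT; pose o3 := @Ordinal 4 3 isT.
have fg i j := is_derive_mul (f i) (g j); have nfg i j := is_derive_opp (fg i j).
have add4 (a b c d : V -> R) da db dc dd df : is_derive x v a da -> is_derive x v b db ->
    is_derive x v c dc -> is_derive x v d dd -> da + db + dc + dd = df ->
    is_derive x v (fun y => a y + b y + c y + d y) df.
  move=> ha hb hc hd <-.
  exact: (is_derive_add (is_derive_add (is_derive_add ha hb) hc) hd).
apply: is_derive_quat; apply: ord4P;
  rewrite /qmul /mkquat; under eq_fun do rewrite mxE /=.
- apply: (add4 _ _ _ _ _ _ _ _ _ (fg o0 o0) (nfg o1 o1) (nfg o2 o2) (nfg o3 o3)).
  by rewrite !mxE /= /qre /qi /qj /qk; ring.
- apply: (add4 _ _ _ _ _ _ _ _ _ (fg o0 o1) (fg o1 o0) (fg o2 o3) (nfg o3 o2)).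
  by rewrite !mxE /= /qre /qi /qj /qk; ring.
- apply: (add4 _ _ _ _ _ _ _ _ _ (fg o0 o2) (nfg o1 o3) (fg o2 o0) (fg o3 o1)).
  by rewrite !mxE /= /qre /qi /qj /qk; ring.
- apply: (add4 _ _ _ _ _ _ _ _ _ (fg o0 o3) (fg o1 o2) (nfg o2 o1) (fg o3 o0)).
  by rewrite !mxE /= /qre /qi /qj /qk; ring.
Qed.

Lemma is_derive_qconj F x v dF :
  is_derive x v F dF -> is_derive x v (fun y => qconj (F y)) (qconj dF).
Proof.
move=> hF; have f i := is_derive_coord i hF.
apply: is_derive_quat; apply: ord4P; rewrite /qconj /mkquat;
  under eq_fun do rewrite mxE /=; rewrite mxE /=; first exact: f.
all: by apply: is_derive_opp; exact: f.
Qed.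

Lemma is_derive_qdot F G x v dF dG :
  is_derive x v F dF -> is_derive x v G dG ->
  is_derive x v (fun y => qdot (F y) (G y)) (qdot dF (G x) + qdot (F x) dG).
Proof.
move=> hF hG; have f i := is_derive_coord i hF; have g i := is_derive_coord i hG.
have fg i := is_derive_mul (f i) (g i).
under eq_fun do rewrite qdotE.
apply: (is_derive_eq (is_derive_add (is_derive_add (is_derive_add
  (fg (@Ordinal 4 0 isT)) (fg (@Ordinal 4 1 isT)))
  (fg (@Ordinal 4 2 isT))) (fg (@Ordinal 4 3 isT)))).
by rewrite /= !qdotE /qre /qi /qj /qk; ring.
Qed.

Lemma is_derive_scaleq f F x v df dF :
  is_derive x v f df -> is_derive x v F dF ->
  is_derive x v (fun y => f y *: F y) (df *: F x + f x *: dF).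
Proof.
move=> hf hF; apply: is_derive_quat => i.
under eq_fun do rewrite mxE.
by rewrite !mxE; apply: is_derive_mul => //; exact: is_derive_coord.
Qed.

Lemma differentiable_quat F x :
  (forall i, differentiable (fun y => F y 0 i) x) -> differentiable F x.
Proof.
move=> h.
have -> : F = \sum_(i < 4) (fun y => F y 0 i *: (delta_mx 0 i : quat R)).
  by apply/funext => y; rewrite fct_sumE; exact: row_sum_delta.
by apply: differentiable_sum => i; exact: differentiableZl.
Qed.

Lemma differentiable_comp_coord F x i :
  differentiable F x -> differentiable (fun y => F y 0 i) x.
Proof.
move=> h; apply: (@differentiable_comp _ _ _ _ F (fun M : quat R => M 0 i)) => //.
exact: differentiable_coord.
Qed.

End DirectionalDerivatives.

Section MeanValue.
Context {R : realType}.

(** The end points are in arbitrary order, so that one statement serves for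
    increments of both signs. *)
Lemma mean_value_le (f df : R -> R) (a b M : R) :
  (forall x, Num.min a b <= x <= Num.max a b -> is_derive x 1 f (df x)) ->
  (forall x, Num.min a b <= x <= Num.max a b -> `|df x| <= M) ->
  `|f b - f a| <= M * `|b - a|.
Proof.
wlog ab : a b / a <= b.
  move=> H; case/orP: (le_total a b) => [|ba]; first exact: H.
  by rewrite minC maxC distrC (distrC b); exact: H.
rewrite min_l // max_r // => hd hM.
have [||c cab ->] := @MVT_segment R f df a b ab.
- by move=> x /itvP h; apply: hd; rewrite !h.
- apply: derivable_within_continuous => x xab.
  by case: (hd x) => //; move: xab; rewrite in_itv.
- rewrite normrM ler_wpM2r //; apply: hM; move: cab; by rewrite in_itv.
Qed.

Lemma mean_value_quat_le (f df : R -> quat R) (a b M : R) :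
  (forall x, Num.min a b <= x <= Num.max a b -> is_derive x 1 f (df x)) ->
  (forall x, Num.min a b <= x <= Num.max a b -> `|df x| <= M) ->
  `|f b - f a| <= M * `|b - a|.
Proof.
move=> hd hM; have M0 : 0 <= M.
  apply: le_trans (hM a _); rewrite ?normr_ge0 //.
  by rewrite ge_min le_max lexx.
apply: norm_quat_le => [|i]; first by rewrite mulr_ge0.
rewrite !mxE; apply: (@mean_value_le (fun x => f x 0 i) (fun x => df x 0 i)).
- by move=> x xab; apply: is_derive_coord; exact: hd.
- move=> x xab; exact: le_trans (qcoord_norm _ _) (hM _ xab).
Qed.

End MeanValue.

(** * Functions of class C^k *)

Section Differentiability.
Context {R : realType} {V W : normedModType R}.
Implicit Types (f g : V -> W).

(** The little-o in the definition of the differential is awkward to produce by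
    hand; this is the same condition in terms of an explicit bound. *)
Lemma differentiable_eps f (x : V) (df : {linear V -> W}) : continuous df ->
  (forall e, 0 < e -> \forall h \near 0, `|f (h + x) - f x - df h| <= e * `|h|) ->
  differentiable f x /\ 'd f x = df :> (V -> W).
Proof.
move=> dfc fe.
have E : f \o shift x = cst (f x) + df +o_ 0 id.
  apply/eqaddoP => e e0; near=> h.
  have -> : (f \o shift x - (cst (f x) + df)) h = f (h + x) - f x - df h.
    by rewrite !fctE /= opprD addrA.
  by near: h; exact: fe.
have D := diff_unique dfc E.
by split => //; apply/diff_locallyP; rewrite D.
Unshelve. all: by end_near. Qed.

Lemma differentiable_is_derive f (x v : V) : differentiable f x -> is_derive x v f ('D_v f x).
Proof. by move=> df; apply/derivableP/diff_derivable. Qed.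

Lemma near_eq_differentiable f g (x : V) :
  (\forall y \near x, f y = g y) -> differentiable f x -> differentiable g x.
Proof.
move=> fg df; have fgx := nbhs_singleton fg.
have /diff_locallyP[dfc /eqaddoP E] := df.
apply: (proj1 (@differentiable_eps g x ('d f x) dfc _)) => e e0.
near=> h.
rewrite -fgx.
have <- : f (h + x) = g (h + x).
  near: h; move: fg => /nbhs_ballP[r r0 fg]; apply/nbhs_ballP; exists r => //= h.
  rewrite -ball_normE /= sub0r normrN => hr; apply: fg.
  by rewrite -ball_normE /= opprD addrCA subrr addr0 normrN.
have -> : f (h + x) - f x - 'd f x h = (f \o shift x - (cst (f x) + 'd f x)) h.
  by rewrite !fctE /= opprD addrA.
by near: h; exact: E.
Unshelve. all: by end_near. Qed.

End Differentiability.

Section ClassC.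
Context {R : realType} {V : normedModType R}.
Implicit Types (W : normedModType R) (A : set V).

Lemma class_CS W k A (f : V -> W) : class_C k.+1 A f -> class_C k A f.
Proof.
elim: k f => [f [df _] x Ax|k IH f [df Df]].
  by apply: differentiable_continuous; exact: df.
by split => // v; apply: IH; exact: Df.
Qed.

(** Derivatives of a function outside an open set are uncontrolled, so closure
    properties of the class C^k must be proved up to equality on that set. *)
Lemma eq_class_C W k A (f g : V -> W) : open A -> (forall x, A x -> f x = g x) ->
  class_C k A f -> class_C k A g.
Proof.
move=> oA; elim: k f g => [f g fg cf x Ax|k IH f g fg [df Df]].
  have nfg : \forall y \near x, f y = g y.
    by apply: filterS (open_nbhs_nbhs (conj oA Ax)) => y; exact: fg.
  rewrite /prop_for /continuous_at -(fg x Ax).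
  by apply: cvg_trans (cf x Ax); apply: near_eq_cvg; exact: nfg.
have nfg x : A x -> \forall y \near x, f y = g y.
  by move=> Ax; apply: filterS (open_nbhs_nbhs (conj oA Ax)) => y; exact: fg.
split=> [x Ax|v]; first by apply: near_eq_differentiable (nfg x Ax) (df x Ax).
by apply: IH (Df v) => x Ax; exact: near_eq_derive (nfg x Ax).
Qed.

Lemma class_C_cst W k A (c : W) : class_C k A (fun=> c).
Proof.
elim: k c => [c x _|k IH c]; first exact: cvg_cst.
split=> [x _|v]; first exact: differentiable_cst.
have -> : 'D_v (fun=> c) = (fun=> 0) :> (V -> W) by apply/funext => x; exact: derive_cst.
exact: IH.
Qed.

Lemma class_C_add W k A (f g : V -> W) : open A ->
  class_C k A f -> class_C k A g -> class_C k A (fun x => f x + g x).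
Proof.
move=> oA; elim: k f g => [f g cf cg x Ax|k IH f g [df Df] [dg Dg]].
  by apply: cvgD; [exact: cf|exact: cg].
have -> : (fun x => f x + g x) = f + g by apply/funext.
split=> [x Ax|v]; first by apply: differentiableD; [exact: df|exact: dg].
apply: eq_class_C (IH _ _ (Df v) (Dg v)) => // x Ax.
by rewrite deriveD //; apply: diff_derivable; [exact: df|exact: dg].
Qed.

Lemma class_C_mul k A (f g : V -> R) : open A ->
  class_C k A f -> class_C k A g -> class_C k A (fun x => f x * g x).
Proof.
move=> oA; elim: k f g => [f g cf cg x Ax|k IH f g cf cg].
  by apply: cvgM; [exact: cf|exact: cg].
have [[df Df] [dg Dg]] := (cf, cg).
split=> [x Ax|v].
  have -> : (fun x => f x * g x) = f * g by apply/funext.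
  by apply: differentiableM; [exact: df|exact: dg].
have cf' := class_CS cf; have cg' := class_CS cg.
apply: (@eq_class_C _ _ _ (fun x => 'D_v f x * g x + f x * 'D_v g x)) => //.
  move=> x Ax; apply/esym.
  exact: (@derive_val _ _ _ _ _ _ _ (is_derive_mul (differentiable_is_derive v (df x Ax))
    (differentiable_is_derive v (dg x Ax)))).
by apply: class_C_add => //; [exact: (IH _ _ (Df v) cg')|exact: (IH _ _ cf' (Dg v))].
Qed.

Lemma class_C_opp k A (f : V -> R) : open A -> class_C k A f -> class_C k A (fun x => - f x).
Proof.
move=> oA cf; apply: (@eq_class_C _ _ _ (fun x => -1 * f x)) => // [x _|].
  by rewrite mulN1r.
by apply: class_C_mul => //; exact: class_C_cst.
Qed.

Lemma class_C_coord k A (F : V -> quat R) i : open A ->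
  class_C k A F -> class_C k A (fun x => F x 0 i).
Proof.
move=> oA; elim: k F => [F cF x Ax|k IH F [dF DF]].
  by apply: (@continuous_comp _ _ _ F (fun M : quat R => M 0 i)); [exact: cF|exact: coord_continuous].
split=> [x Ax|v]; first by apply: differentiable_comp_coord; exact: dF.
apply: eq_class_C (IH _ (DF v)) => // x Ax.
apply/esym.
exact: (@derive_val _ _ _ _ _ _ _ (is_derive_coord i (differentiable_is_derive v (dF x Ax)))).
Qed.

Lemma continuous_quat (T : topologicalType) (F : T -> quat R) x :
  (forall i, {for x, continuous (fun y => F y 0 i)}) -> {for x, continuous F}.
Proof.
move=> h.
have -> : F = \sum_(i < 4) (fun y => F y 0 i *: (delta_mx 0 i : quat R)).
  by apply/funext => y; rewrite fct_sumE; exact: row_sum_delta.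
elim/big_ind: _ => [|f g cf cg|i _]; first exact: cvg_cst.
  exact: cvgD.
by apply: cvgZr_tmp; exact: h.
Qed.

Lemma class_C_quat k A (F : V -> quat R) : open A ->
  (forall i, class_C k A (fun x => F x 0 i)) -> class_C k A F.
Proof.
move=> oA; elim: k F => [F cF x Ax|k IH F cF].
  by apply: continuous_quat => i; exact: cF.
have dF x : A x -> differentiable F x.
  by move=> Ax; apply: differentiable_quat => i; case: (cF i) => h _; exact: h.
split=> [//|v]; apply: IH => i.
have [_ h] := cF i; apply: eq_class_C (h v) => // x Ax.
exact: (@derive_val _ _ _ _ _ _ _ (is_derive_coord i (differentiable_is_derive v (dF x Ax)))).
Qed.

Lemma class_C_qmul k A (F G : V -> quat R) : open A ->
  class_C k A F -> class_C k A G -> class_C k A (fun x => qmul (F x) (G x)).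
Proof.
move=> oA cF cG; have f i := class_C_coord i oA cF; have g i := class_C_coord i oA cG.
have fg i j := class_C_mul oA (f i) (g j); have nfg i j := class_C_opp oA (fg i j).
have add4 (a b c d : V -> R) : class_C k A a -> class_C k A b -> class_C k A c ->
    class_C k A d -> class_C k A (fun y => a y + b y + c y + d y).
  by move=> ha hb hc hd; do 3!apply: class_C_add => //.
by apply: class_C_quat => //; apply: ord4P;
  rewrite /qmul /mkquat; under eq_fun do rewrite mxE /=; apply: add4; (exact: fg || exact: nfg).
Qed.

Lemma class_C_qconj k A (F : V -> quat R) : open A ->
  class_C k A F -> class_C k A (fun x => qconj (F x)).
Proof.
move=> oA cF; have f i := class_C_coord i oA cF.
apply: class_C_quat => //; apply: ord4P; rewrite /qconj /mkquat;
  under eq_fun do rewrite mxE /=; [exact: f| | |];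
  by apply: class_C_opp => //; exact: f.
Qed.

Lemma class_C_qim k A (F : V -> quat R) : open A ->
  class_C k A F -> class_C k A (fun x => qim (F x)).
Proof.
move=> oA cF; have f i := class_C_coord i oA cF.
apply: class_C_quat => //; apply: ord4P; rewrite /qim /mkquat;
  under eq_fun do rewrite mxE /=; [exact: class_C_cst| | |]; exact: f.
Qed.

Lemma class_C_scale k A (f : V -> R) (F : V -> quat R) : open A ->
  class_C k A f -> class_C k A F -> class_C k A (fun x => f x *: F x).
Proof.
move=> oA cf cF; apply: class_C_quat => // i.
by under eq_fun do rewrite mxE; apply: class_C_mul => //; exact: class_C_coord.
Qed.

(** By induction on k for all outer functions at once, since the chain rule
    replaces the outer function by its derivative. *)
Lemma class_C_comp k A (g : R -> R) (f : V -> R) : open A ->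
  class_C k setT g -> class_C k A f -> class_C k A (g \o f).
Proof.
move=> oA; elim: k g f => [g f cg cf x Ax|k IH g f cg cf].
  by apply: continuous_comp; [exact: cf|exact: cg].
have [[dg Dg] [df Df]] := (cg, cf).
split=> [x Ax|v]; first by apply: differentiable_comp; [exact: df|exact: dg].
apply: (@eq_class_C _ _ _ (fun x => 'D_1 g (f x) * 'D_v f x)) => //.
  move=> x Ax; have dfx := df x Ax; have dgx := dg (f x) I.
  rewrite [in RHS]deriveE; last exact: differentiable_comp.
  rewrite diff_comp //= -(deriveE v dfx) deriveE //.
  by rewrite -[in RHS](mulr1 ('D_v f x)) linearZ /= mulrC.
apply: class_C_mul => //; last exact: Df.
by apply: (IH ('D_1 g) f); [exact: Dg|exact: class_CS].
Qed.

Lemma class_C_pair k A (W1 W2 : normedModType R) (f : V -> W1) (g : V -> W2) : open A ->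
  class_C k A f -> class_C k A g -> class_C k A (fun x => (f x, g x)).
Proof.
move=> oA; elim: k f g => [f g cf cg x Ax|k IH f g [df Df] [dg Dg]].
  by apply: cvg_pair; [exact: cf|exact: cg].
split=> [x Ax|v]; first by apply: differentiable_pair; [exact: df|exact: dg].
apply: eq_class_C (IH _ _ (Df v) (Dg v)) => // x Ax.
have [hf hg] := (df x Ax, dg x Ax).
by rewrite !deriveE ?diff_pair //; exact: differentiable_pair.
Qed.

End ClassC.

(** * Differential calculus in the plane *)

Section LinesAndSlices.
Context {R : realType}.

Lemma is_derive_line (V W : normedModType R) (F : V -> W) (x v : V) (s : R) dF :
  is_derive (x + s *: v) v F dF -> is_derive s 1 (fun t : R => F (x + t *: v)) dF.
Proof.
have E : (fun h : R => h^-1 *: (((fun t : R => F (x + t *: v)) \o shift s) (h *: 1) -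
    F (x + s *: v))) = (fun h => h^-1 *: ((F \o shift (x + s *: v)) (h *: v) - F (x + s *: v))).
  apply/funext => h /=; congr (_ *: (F _ - _)).
  by rewrite [h *: 1]mulr1 scalerDl addrCA.
by move=> [h1 h2]; split; [rewrite /derivable E|rewrite /derive E].
Qed.

Lemma slice_uE (W : normedModType R) (f : R * R -> W) (u v : R) :
  (fun h : R => h^-1 *: ((f \o shift (u, v)) (h *: e_u) - f (u, v))) =
  (fun h : R => h^-1 *: (((fun s => f (s, v)) \o shift u) (h *: 1) - f (u, v))).
Proof.
apply/funext => h /=; congr (_ *: (f _ - _)).
by rewrite /e_u; congr pair => /=; rewrite [h *: 0]mulr0 add0r.
Qed.

Lemma slice_vE (W : normedModType R) (f : R * R -> W) (u v : R) :
  (fun h : R => h^-1 *: ((f \o shift (u, v)) (h *: e_v) - f (u, v))) =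
  (fun h : R => h^-1 *: (((fun s => f (u, s)) \o shift v) (h *: 1) - f (u, v))).
Proof.
apply/funext => h /=; congr (_ *: (f _ - _)).
by rewrite /e_v; congr pair => /=; rewrite [h *: 0]mulr0 add0r.
Qed.

Lemma is_derive_slice_u (W : normedModType R) (f : R * R -> W) (u v : R) df :
  is_derive (u, v) e_u f df <-> is_derive u 1 (fun s => f (s, v)) df.
Proof.
by split=> -[h1 h2]; split; move: h1 h2; rewrite /derivable /derive slice_uE.
Qed.

Lemma is_derive_slice_v (W : normedModType R) (f : R * R -> W) (u v : R) df :
  is_derive (u, v) e_v f df <-> is_derive v 1 (fun s => f (u, s)) df.
Proof.
by split=> -[h1 h2]; split; move: h1 h2; rewrite /derivable /derive slice_vE.
Qed.

Lemma derive_plane (W : normedModType R) (f : R * R -> W) (z v : R * R) :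
  differentiable f z -> 'D_v f z = v.1 *: 'D_e_u f z + v.2 *: 'D_e_v f z.
Proof.
move=> df; have E : v = v.1 *: e_u + v.2 *: e_v :> R * R.
  by case: v => a b; congr pair => /=; rewrite /GRing.scale /= ?mulr1 ?mulr0 ?addr0 ?add0r.
by rewrite {1}E !deriveE // linearD !linearZ.
Qed.

Lemma near_planeP (P : R * R -> Prop) (z : R * R) :
  (\forall x \near z, P x) <->
  exists2 r, 0 < r & forall a b, `|a - z.1| < r -> `|b - z.2| < r -> P (a, b).
Proof.
split=> [/nbhs_ballP[r r0 h]|[r r0 h]].
  exists r => // a b ha hb; apply: h; split => /=; rewrite -ball_normE /= distrC //.
apply/nbhs_ballP; exists r => //= -[a b] [] /=; rewrite -!ball_normE /= => ha hb.
by apply: h; rewrite distrC.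
Qed.

End LinesAndSlices.

Section LocallyConstant.
Context {R : realType}.

(** A ball is convex, so the mean value inequality applies on segments issued
    from the centre. *)
Lemma derive0_locally_constant (V : normedModType R) (F : V -> quat R) (x : V) :
  (\forall y \near x, forall v, is_derive y v F 0) -> \forall y \near x, F y = F x.
Proof.
move=> /nbhs_ballP[r r0 h]; apply/nbhs_ballP; exists r => //= y.
rewrite -ball_normE /= => xyr.
have -> : F y = F (x + 1 *: (y - x)) by rewrite scale1r addrC subrK.
have -> : F x = F (x + 0 *: (y - x)) by rewrite scale0r addr0.
apply/eqP; rewrite -subr_eq0 -normr_le0.
rewrite -[leRHS](mul0r `|1 - 0 : R|).
apply: (@mean_value_quat_le _ (fun t => F (x + t *: (y - x))) (fun=> 0)); last first.
  by move=> t _; rewrite normr0.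
move=> t; rewrite min_l ?ler01 // max_r ?ler01 // => /andP[t0 t1].
apply: is_derive_line; apply: h; rewrite -ball_normE /= opprD addrA subrr add0r normrN.
rewrite normrZ ger0_norm // distrC; apply: le_lt_trans xyr.
by rewrite ler_piMl.
Qed.

End LocallyConstant.

Section Schwarz.
Context {R : realType}.

Lemma continuous_near_dist (T : topologicalType) (W : normedModType R) (f : T -> W) z e :
  {for z, continuous f} -> 0 < e -> \forall y \near z, `|f z - f y| < e.
Proof. by move=> /cvgrPdist_lt h e0; exact: h. Qed.

(** The second difference of f over a square equals a mixed derivative at some
    point of the square, by the mean value theorem in one variable and then in the
    other. Exchanging the variables leaves the difference unchanged. *)
Lemma double_difference (f fu fuv : R -> R -> R) (a b h : R) : 0 < h ->
  (forall x y, a <= x <= a + h -> b <= y <= b + h ->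
     is_derive x 1 (fun s => f s y) (fu x y)) ->
  (forall x y, a <= x <= a + h -> b <= y <= b + h ->
     is_derive y 1 (fun s => fu x s) (fuv x y)) ->
  exists x y, [/\ a <= x <= a + h, b <= y <= b + h &
    f (a + h) (b + h) - f (a + h) b - f a (b + h) + f a b = fuv x y * h * h].
Proof.
move=> h0 hu huv.
have ah : a <= a + h by rewrite lerDl ltW.
have bh : b <= b + h by rewrite lerDl ltW.
have D x : a <= x <= a + h ->
    is_derive x 1 (fun s => f s (b + h) + - f s b) (fu x (b + h) + - fu x b).
  move=> xa; refine (is_derive_add (hu _ _ xa _) (is_derive_opp (hu _ _ xa _))).
    by rewrite bh lexx.
  by rewrite lexx.
have [||x xa] := @MVT_segment R (fun s => f s (b + h) - f s b)
    (fun s => fu s (b + h) - fu s b) a (a + h) ah.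
- by move=> x /itvP xa; apply: D; rewrite !xa.
- apply: derivable_within_continuous => x; rewrite in_itv /= => /D xa.
  by case: xa.
rewrite in_itv /= in xa.
have [||y yb] := @MVT_segment R (fun s => fu x s) (fun s => fuv x s) b (b + h) bh.
- by move=> y /itvP yb; apply: huv => //; rewrite !yb.
- apply: derivable_within_continuous => y; rewrite in_itv /= => yb.
  by case: (huv x y xa yb).
rewrite in_itv /= in yb.
rewrite !(addrAC _ h) !subrr !add0r => -> E.
by exists x, y; split => //; rewrite -E; ring.
Qed.

(** Both mixed derivatives are values, at points of the same small square, of one
    second difference divided by the area; continuity lets the square shrink. *)
Lemma schwarz (U : set (R * R)) (f : R * R -> R) (z : R * R) :
  open U -> class_C 2 U f -> U z -> 'D_e_u ('D_e_v f) z = 'D_e_v ('D_e_u f) z.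
Proof.
move=> oU [df Df] Uz.
have [[dfu cfu] [dfv cfv]] := (Df e_u, Df e_v).
apply/eqP; rewrite -subr_eq0 -normr_le0; apply/ler_addgt0Pl => e e0.
have e20 : 0 < e / 2 by rewrite divr_gt0.
have tri (X Y Z : R) : `|X - Z| < e / 2 -> `|Y - Z| < e / 2 -> `|X - Y| <= e + 0.
  by rewrite !ltr_norml ler_norml => /andP[? ?] /andP[? ?]; apply/andP; split; lra.
have c1 := cfv e_u z Uz; have c2 := cfu e_v z Uz.
have /near_planeP[r r0 hr] : \forall y \near z, [/\ U y,
    `|'D_e_u ('D_e_v f) z - 'D_e_u ('D_e_v f) y| < e / 2 &
    `|'D_e_v ('D_e_u f) z - 'D_e_v ('D_e_u f) y| < e / 2].
  have n1 : \forall y \near z, U y by exact: open_nbhs_nbhs.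
  have n2 := continuous_near_dist c1 e20; have n3 := continuous_near_dist c2 e20.
  by apply: filterS3 n1 n2 n3 => y h1 h2 h3; split; [exact: h1|exact: h2|exact: h3].
move: z Uz c1 c2 hr => [a b] Uz c1 c2 /= hr.
(* With h < r the closed square of side h at (a, b) stays in the open one of radius r. *)
pose h := r / 2.
have h0 : 0 < h by rewrite divr_gt0.
have hin x c : c <= x <= c + h -> `|x - c| < r.
  by rewrite /h => /andP[? ?]; rewrite ger0_norm; lra.
have [||x [y [xa yb E1]]] := @double_difference (fun s t => f (s, t))
  (fun s t => 'D_e_u f (s, t)) (fun s t => 'D_e_v ('D_e_u f) (s, t)) a b h h0.
- move=> x y /hin xa /hin yb; apply/is_derive_slice_u; apply: differentiable_is_derive.
  by apply: df; case: (hr x y xa yb).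
- move=> x y /hin xa /hin yb; have [Uxy _ _] := hr x y xa yb.
  exact: (proj1 (@is_derive_slice_v _ _ ('D_e_u f) x y _) (differentiable_is_derive e_v (dfu _ Uxy))).
have [||y' [x' [yb' xa' E2]]] := @double_difference (fun t s => f (s, t))
  (fun t s => 'D_e_v f (s, t)) (fun t s => 'D_e_u ('D_e_v f) (s, t)) b a h h0.
- move=> y' x' /hin yb' /hin xa'; apply/is_derive_slice_v; apply: differentiable_is_derive.
  by apply: df; case: (hr x' y' xa' yb').
- move=> y' x' /hin yb' /hin xa'; have [Uxy _ _] := hr x' y' xa' yb'.
  exact: (proj1 (@is_derive_slice_u _ _ ('D_e_v f) x' y' _) (differentiable_is_derive e_u (dfv _ Uxy))).
have E : 'D_e_u ('D_e_v f) (x', y') = 'D_e_v ('D_e_u f) (x, y).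
  have cancel (X Y : R) : X * h * h = Y * h * h -> X = Y.
    by have hn0 := lt0r_neq0 h0; move=> /(mulIf hn0) /(mulIf hn0).
  apply: cancel; apply: etrans (esym E2) (etrans _ E1).
  by rewrite /=; congr (_ + _); rewrite addrAC.
have [_ H1 _] := hr x' y' (hin _ _ xa') (hin _ _ yb').
have [_ _ H2] := hr x y (hin _ _ xa) (hin _ _ yb).
by rewrite E in H1; exact: tri H1 H2.
Qed.

Lemma schwarz_quat (U : set (R * R)) (F : R * R -> quat R) (z : R * R) :
  open U -> class_C 2 U F -> U z -> 'D_e_u ('D_e_v F) z = 'D_e_v ('D_e_u F) z.
Proof.
move=> oU cF Uz; have [dF DF] := cF.
have D v w i : 'D_v ('D_w F) z 0 i = 'D_v ('D_w (fun y => F y 0 i)) z.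
  have [dwF _] := DF w.
  rewrite -(@derive_val _ _ _ _ _ _ _ (is_derive_coord i (differentiable_is_derive v (dwF z Uz)))).
  apply: near_eq_derive; apply: filterS (open_nbhs_nbhs (conj oU Uz)) => y Uy.
  by rewrite (@derive_val _ _ _ _ _ _ _ (is_derive_coord i (differentiable_is_derive w (dF y Uy)))).
apply/rowP => i; apply: etrans (D e_u e_v i) (etrans _ (esym (D e_v e_u i))).
exact: schwarz oU (class_C_coord i oU cF) Uz.
Qed.

End Schwarz.

Section PartialDerivatives.
Context {R : realType}.
Implicit Types (F Fu Fv : R * R -> quat R) (z : R * R).

Lemma between_dist (a b x r : R) : Num.min a b <= x <= Num.max a b -> `|b - a| < r -> `|x - a| < r.
Proof.
rewrite ge_min le_max => /andP[] /orP[] ? /orP[] ?; rewrite !ltr_norml => /andP[? ?];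
  apply/andP; split; lra.
Qed.

(** Go from the centre to a point of the square by a horizontal and then a
    vertical segment. With A = B = 0 this bounds the increment of F, and with the
    partial derivatives at the centre it bounds the remainder of order one. *)
Lemma partial_increment F Fu Fv z (r M : R) (A B : quat R) :
  (forall a b, `|a - z.1| < r -> `|b - z.2| < r ->
     [/\ is_derive (a, b) e_u F (Fu (a, b)), is_derive (a, b) e_v F (Fv (a, b)),
         `|Fu (a, b) - A| <= M & `|Fv (a, b) - B| <= M]) ->
  forall a b, `|a - z.1| < r -> `|b - z.2| < r ->
    `|F (a, b) - F z - ((a - z.1) *: A + (b - z.2) *: B)|
      <= M * `|a - z.1| + M * `|b - z.2|.
Proof.
case: z => u v /= h a b ha hb.
have r0 : 0 < r by exact: le_lt_trans ha.
have -> : F (a, b) - F (u, v) - ((a - u) *: A + (b - v) *: B) =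
    ((F (a, v) - a *: A) - (F (u, v) - u *: A)) +
    ((F (a, b) - b *: B) - (F (a, v) - v *: B)).
  by rewrite !scalerBl; apply/rowP => i; rewrite !mxE; ring.
have dlin (C : quat R) (x : R) : is_derive x 1 (fun s : R => - (s *: C)) (- C).
  apply: is_derive_opp; apply: (is_derive_eq (is_derive_scaleq (is_derive_id x 1) (is_derive_cst C x 1))).
  by rewrite scaler0 addr0 scale1r.
apply: le_trans (ler_normD _ _) _; apply: lerD.
  apply: (@mean_value_quat_le _ (fun s => F (s, v) - s *: A) (fun s => Fu (s, v) - A)).
    move=> x xab; apply: is_derive_add (dlin _ _); apply/is_derive_slice_u.
    by case: (h x v (between_dist xab ha)); rewrite ?subrr ?normr0.
  by move=> x xab; case: (h x v (between_dist xab ha)); rewrite ?subrr ?normr0.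
apply: (@mean_value_quat_le _ (fun s => F (a, s) - s *: B) (fun s => Fv (a, s) - B)).
  move=> x xab; apply: is_derive_add (dlin _ _); apply/is_derive_slice_v.
  by case: (h a x ha (between_dist xab hb)).
by move=> x xab; case: (h a x ha (between_dist xab hb)).
Qed.

Lemma partials_bounded_continuous F Fu Fv z (M : R) :
  (\forall y \near z, is_derive y e_u F (Fu y) /\ is_derive y e_v F (Fv y)) ->
  (\forall y \near z, `|Fu y| <= M /\ `|Fv y| <= M) -> {for z, continuous F}.
Proof.
move=> hd hM.
have /near_planeP[r r0 h] : \forall y \near z, [/\ is_derive y e_u F (Fu y),
    is_derive y e_v F (Fv y), `|Fu y - 0| <= M & `|Fv y - 0| <= M].
  by apply: filterS2 hd hM => y [? ?] [? ?]; rewrite !subr0.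
have M0 : 0 <= M.
  have [||_ _ Mz _] := h z.1 z.2; rewrite ?subrr ?normr0 //.
  exact: le_trans Mz.
apply/cvgrPdist_lt => e e0; apply/near_planeP.
exists (Num.min r (e / (2 * (M + 1)))).
  by rewrite lt_min r0 divr_gt0 // mulr_gt0 // ltr_wpDl.
move=> a b; rewrite !lt_min => /andP[ar ae] /andP[br be].
have := partial_increment h ar br; rewrite !scaler0 addr0 subr0 distrC => H.
apply: le_lt_trans H _; rewrite -mulrDr.
have M1 : 0 < M + 1 by rewrite ltr_wpDl.
have K : `|a - z.1| + `|b - z.2| < e / (M + 1).
  have -> : e / (M + 1) = e / (2 * (M + 1)) + e / (2 * (M + 1)).
    by field; rewrite gt_eqF.
  exact: ltrD.
apply: (@le_lt_trans _ _ ((M + 1) * (`|a - z.1| + `|b - z.2|))).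
  by rewrite ler_wpM2r ?addr_ge0 // lerDl.
by rewrite mulrC -ltr_pdivlMr.
Qed.

Lemma partials_continuous_differentiable F Fu Fv z :
  (\forall y \near z, is_derive y e_u F (Fu y) /\ is_derive y e_v F (Fv y)) ->
  {for z, continuous Fu} -> {for z, continuous Fv} -> differentiable F z.
Proof.
move=> hd cu cv.
pose df (h : R * R) : quat R := h.1 *: Fu z + h.2 *: Fv z.
have df_lin : linear df.
  move=> k x y; rewrite /df /= !scalerDl !scalerDr !scalerA /GRing.scale /=.
  by rewrite addrACA.
pose dfM := GRing.isLinear.Build _ _ _ _ _ df_lin.
pose dfL : {linear _ -> _} := HB.pack df dfM.
have dfc : continuous dfL.
  move=> x; apply: cvgD.
    by apply: cvgZr_tmp; exact: cvg_fst.
  by apply: cvgZr_tmp; exact: cvg_snd.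
apply: (proj1 (@differentiable_eps _ _ _ F z dfL dfc _)) => e e0.
have e20 : 0 < e / 2 by rewrite divr_gt0.
have n1 := continuous_near_dist cu e20; have n2 := continuous_near_dist cv e20.
have /near_planeP[r r0 h] : \forall y \near z, [/\ is_derive y e_u F (Fu y),
    is_derive y e_v F (Fv y), `|Fu y - Fu z| <= e / 2 & `|Fv y - Fv z| <= e / 2].
  by apply: filterS3 hd n1 n2 => y [? ?] ? ?; split => //; rewrite distrC ltW.
apply/near_planeP; exists r => // a b; rewrite /= !subr0 => ar br.
rewrite [X in `|_ - X|](_ : _ = (a + z.1 - z.1) *: Fu z + (b + z.2 - z.2) *: Fv z); last first.
  by rewrite !addrK.
apply: le_trans (partial_increment h _ _) _; rewrite ?addrK //.
rewrite [leRHS](_ : _ = e / 2 * `|(a, b)| + e / 2 * `|(a, b)|); last by rewrite -mulrDl -splitr.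
by apply: lerD; rewrite ler_pM2l // num_le_max /= lexx ?orbT.
Qed.

End PartialDerivatives.

(** * Linear differential equations on an interval *)

Section Clamp.
Context {R : realType}.
Implicit Types (c r x : R).

(** Clamping the variable turns functions known on an interval into functions that
    are continuous and bounded on the whole line. *)
Definition clamp c r x : R := Num.max (c - r) (Num.min (c + r) x).

Lemma clamp_id c r x : `|x - c| <= r -> clamp c r x = x.
Proof.
rewrite ler_norml => /andP[h1 h2].
by rewrite /clamp min_r ?max_r //; lra.
Qed.

Lemma clamp_dist c r x : 0 <= r -> `|clamp c r x - c| <= r.
Proof.
move=> r0; rewrite /clamp; case: (leP (c + r) x) => h1;
  [case: (leP (c - r) (c + r)) => h2|case: (leP (c - r) x) => h2];
  rewrite ler_norml; apply/andP; split; lra.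
Qed.

Lemma clamp_continuous c r : continuous (clamp c r).
Proof.
have cid : continuous (fun x : R => x) by move=> x; exact: cvg_id.
have ccst (a : R) : continuous (fun _ : R => a) by move=> x; exact: cvg_cst.
exact: max_fun_continuous (ccst (c - r)) (min_fun_continuous (ccst (c + r)) cid).
Qed.

Lemma near_lt_dist c r x : `|x - c| < r -> \forall y \near x, `|y - c| < r.
Proof.
move=> xr; apply/nbhs_ballP; exists (r - `|x - c|); first by rewrite /= subr_gt0.
move=> y; rewrite -ball_normE /= ltrBrDl => h.
have -> : y - c = (x - c) - (x - y) by ring.
exact: le_lt_trans (ler_normB _ _) _.
Qed.

End Clamp.

Section PrimitiveOperator.
Context {R : realType}.

(** The base point of the integral must lie strictly to the left of the points
    where the derivative is computed. *)
Lemma primitive (f : R -> R) (a : R) : continuous f ->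
  exists F : R -> R, forall x, a < x -> is_derive x 1 F (f x).
Proof.
move=> cf; exists (fun x => \int[lebesgue_measure]_(t in `[a, x]) f t) => x ax.
have xu : x < x + 1 by rewrite ltrDl.
have fi : lebesgue_measure.-integrable `[a, x + 1] (EFin \o f).
  apply: continuous_compact_integrable; first exact: segment_compact.
  exact: continuous_subspaceT.
have [d1 d2] := continuous_FTC1_closed xu fi ax (cf x).
by split; [exact: d1|rewrite -derive1E].
Qed.

(** Freezing the primitive outside the interval makes its size controlled by the
    length of the interval on the whole line. *)
Lemma bounded_primitive (f : R -> R) (c r : R) : 0 < r -> continuous f ->
  exists F : R -> R, [/\ F c = 0, continuous F &
    (forall x, `|x - c| < r -> is_derive x 1 F (f x)) /\
    (forall x, F x = F (clamp c r x))].
Proof.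
move=> r0 cf; have [G dG] := primitive (c - r - 1) cf.
have cK : clamp c r c = c by rewrite clamp_id // subrr normr0 ltW.
have aC x : c - r - 1 < clamp c r x.
  by have := clamp_dist c x (ltW r0); rewrite ler_norml => /andP[? ?]; lra.
exists (fun x => G (clamp c r x) - G c); split.
- by rewrite cK subrr.
- move=> x; apply: cvgB; last exact: cvg_cst.
  apply: (@continuous_comp _ _ _ (clamp c r) G); first exact: clamp_continuous.
  by apply/differentiable_continuous/derivable1_diffP; case: (dG _ (aC x)).
- split=> x; last by rewrite (clamp_id (clamp_dist c x (ltW r0))).
  move=> xr; apply: (@near_eq_is_derive _ _ _ (fun y => G y - G c)).
    apply: filterS (near_lt_dist xr) => y /ltW yr; by rewrite clamp_id.
  have ax : c - r - 1 < x by move: xr; rewrite ltr_norml => /andP[? ?]; lra.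
  rewrite -[f x]addr0; exact: is_derive_add (dG _ ax) (is_derive_cst _ _ _).
Qed.

Lemma quat_primitive_operator (c r : R) : 0 < r ->
  exists I : (R -> quat R) -> R -> quat R,
    (forall f, continuous f -> [/\ I f c = 0, continuous (I f) &
       forall x, `|x - c| < r -> is_derive x 1 (I f) (f x)]) /\
    (forall f g M, continuous f -> continuous g -> (forall x, `|f x - g x| <= M) ->
       forall x, `|I f x - I g x| <= M * r).
Proof.
move=> r0.
have H (f : R -> R) : exists F : R -> R, continuous f -> [/\ F c = 0, continuous F &
    (forall x, `|x - c| < r -> is_derive x 1 F (f x)) /\
    (forall x, F x = F (clamp c r x))].
  have [cf|ncf] := pselect (continuous f); last by exists f.
  by have [F h] := bounded_primitive c r0 cf; exists F.
have [P hP] := choice H.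
have cfi (f : R -> quat R) i : continuous f -> continuous (fun x => f x 0 i).
  move=> cf x; apply: (@continuous_comp _ _ _ f (fun M : quat R => M 0 i)).
    exact: cf.
  exact: coord_continuous.
exists (fun f x => \row_i P (fun y => f y 0 i) x); split.
  move=> f cf; split.
  - by apply/rowP => i; rewrite !mxE; case: (hP _ (cfi f i cf)).
  - move=> x; apply: continuous_quat => i.
    have -> : (fun y => (\row_j P (fun z => f z 0 j) y) 0 i) = P (fun z => f z 0 i).
      by apply/funext => y; rewrite mxE.
    by case: (hP _ (cfi f i cf)) => _ h _; exact: h.
  - move=> x xr; apply: is_derive_quat => i.
    under eq_fun do rewrite mxE.
    by case: (hP _ (cfi f i cf)) => _ _ [h _]; exact: h.
move=> f g M cf cg fg x.
have M0 : 0 <= M by exact: le_trans (fg c).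
apply: norm_quat_le => [|i]; first by rewrite mulr_ge0 // ltW.
rewrite !mxE; have [f0 cF [dF ->]] := hP _ (cfi f i cf); have [g0 cG [dG ->]] := hP _ (cfi g i cg).
set F := P _ in f0 cF dF *; set G := P _ in g0 cG dG *.
set y := clamp c r x.
have yr : `|y - c| <= r by exact: clamp_dist (ltW r0).
apply: (@le_trans _ _ (M * `|y - c|)); last by rewrite ler_wpM2l.
have -> : F y - G y = (F y - G y) - (F c - G c) by rewrite f0 g0 !subr0.
have bnd z : `|f z 0 i - g z 0 i| <= M.
  by apply: le_trans (fg z); have := qcoord_norm (f z - g z) i; rewrite !mxE.
wlog : / y != c.
  have [->|yc] := eqVneq y c; last by apply.
  by rewrite !subrr normr0 mulr0.
move=> yc.
have cFG : continuous (fun z => F z - G z).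
  by move=> z; apply: cvgB; [exact: cF|exact: cG].
have dFG z : `|z - c| < r -> is_derive z 1 (fun z => F z - G z) (f z 0 i - g z 0 i).
  by move=> zr; apply: is_derive_add (dF _ zr) (is_derive_opp (dG _ zr)).
case: (ltP c y) => cy.
  have [||z zcy ->] := @MVT R (fun z => F z - G z) (fun z => f z 0 i - g z 0 i) c y cy.
  - move=> z; rewrite in_itv /= => /andP[z1 z2]; apply: dFG.
    move: yr; rewrite ler_norml ltr_norml => /andP[? ?]; apply/andP; split; lra.
  - exact: continuous_subspaceT.
  - by rewrite normrM ler_wpM2r.
have yc' : y < c by rewrite lt_neqAle yc cy.
have [||z zcy] := @MVT R (fun z => F z - G z) (fun z => f z 0 i - g z 0 i) y c yc'.
- move=> z; rewrite in_itv /= => /andP[z1 z2]; apply: dFG.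
  move: yr; rewrite ler_norml ltr_norml => /andP[? ?]; apply/andP; split; lra.
- exact: continuous_subspaceT.
- by rewrite distrC => ->; rewrite normrM (distrC c y) ler_wpM2r.
Qed.

(** Subtracting the primitive of 0 makes the size bound a case of the
    Lipschitz bound. *)
Lemma quat_primitive (c r : R) : 0 < r ->
  exists I : (R -> quat R) -> R -> quat R,
    [/\ forall f, continuous f -> [/\ I f c = 0, continuous (I f) &
          forall x, `|x - c| < r -> is_derive x 1 (I f) (f x)],
       forall f g M, continuous f -> continuous g -> (forall x, `|f x - g x| <= M) ->
          forall x, `|I f x - I g x| <= M * r &
       forall f M, continuous f -> (forall x, `|f x| <= M) -> forall x, `|I f x| <= M * r].
Proof.
move=> r0; have [I [hI lipI]] := quat_primitive_operator c r0.
have c0 : continuous (fun _ : R => 0 : quat R) by move=> x; exact: cvg_cst.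
have [I0 cI0 dI0] := hI _ c0.
exists (fun f x => I f x - I (fun=> 0) x); split.
- move=> f cf; have [If cIf dIf] := hI _ cf; split.
  + by rewrite If I0 subrr.
  + by move=> x; apply: cvgB; [exact: cIf|exact: cI0].
  + move=> x xr; rewrite -[f x]subr0.
    exact: is_derive_add (dIf _ xr) (is_derive_opp (dI0 _ xr)).
- move=> f g M cf cg fg x; rewrite opprB addrA subrK; exact: lipI.
- move=> f M cf fM x; apply: lipI => // t; by rewrite subr0.
Qed.

End PrimitiveOperator.

Section GeometricLimit.
Context {R : realType}.

(** The sequence u n - 2 / 2^n increases and u n + 2 / 2^n decreases; the limit is
    the supremum of the former. *)
Lemma geometric_limit (u : nat -> R) : (forall n, `|u n.+1 - u n| <= 2^-1 ^+ n) ->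
  exists l, forall n, `|u n - l| <= 2 * 2^-1 ^+ n.
Proof.
move=> hu; pose c n : R := 2 * 2^-1 ^+ n.
have c0 n : 0 <= c n by rewrite mulr_ge0 // exprn_ge0 // invr_ge0.
have cS n : c n = 2^-1 ^+ n + c n.+1.
  by rewrite /c exprS; set x := _ ^+ n; field.
have h m k : `|u (m + k)%N - u m| <= c m - c (m + k)%N.
  elim: k => [|k IH]; first by rewrite addn0 !subrr normr0.
  rewrite addnS -(subrKA (u (m + k)%N)) (le_trans (ler_normD _ _)) //.
  have -> : c m - c (m + k).+1 = 2^-1 ^+ (m + k) + (c m - c (m + k)%N).
    by rewrite (cS (m + k)%N); move: (c m) (c (m + k).+1) (_ ^+ _) => x1 x2 x3; ring.
  exact: lerD.
have ub n m : u n - c n <= u m + c m.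
  case: (leqP n m) => [nm|/ltnW mn].
    have := h n (m - n)%N; rewrite subnKC // ler_norml => /andP[H _].
    by have := c0 m; lra.
  have := h m (n - m)%N; rewrite subnKC // ler_norml => /andP[_ H].
  by have := c0 n; lra.
pose E := range (fun n => u n - c n).
have E0 : E !=set0 by exists (u 0%N - c 0%N); exists 0%N.
have Eub m : ubound E (u m + c m) by move=> _ [n _ <-].
exists (sup E) => n; rewrite ler_norml.
have h1 : u n - c n <= sup E.
  by apply: ub_le_sup; [exists (u 0%N + c 0%N); exact: Eub|exists n].
have h2 : sup E <= u n + c n by exact: ge_sup.
by apply/andP; split; rewrite -/(c n); lra.
Qed.

Lemma half_pow_small (e : R) : 0 < e -> exists n, 2^-1 ^+ n < e.
Proof.
move=> e0.
have c : (2^-1 : R) ^+ n @[n --> \oo] --> (0 : R).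
  by apply: cvg_expr; rewrite ger0_norm // invf_lt1 // ltr1n.
move/cvgrPdist_lt : c => /(_ _ e0)[n _ h].
exists n; have := h n (leqnn n).
by rewrite sub0r normrN ger0_norm // exprn_ge0.
Qed.

End GeometricLimit.

Section LinearODE.
Context {R : realType}.

Lemma continuous_qmul_at (T : topologicalType) (F G : T -> quat R) x :
  {for x, continuous F} -> {for x, continuous G} ->
  {for x, continuous (fun y => qmul (F y) (G y))}.
Proof.
move=> cF cG.
have ci H i : {for x, continuous H} -> {for x, continuous (fun y : T => (H y : quat R) 0 i)}.
  move=> cH; apply: (@continuous_comp _ _ _ H (fun M : quat R => M 0 i)).
    exact: cH.
  exact: coord_continuous.
have f i := ci F i cF; have g i := ci G i cG.
have fg i j : {for x, continuous (fun y => F y 0 i * G y 0 j)}.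
  by apply: cvgM; [exact: f|exact: g].
have nfg i j : {for x, continuous (fun y => - (F y 0 i * G y 0 j))}.
  by apply: cvgN; exact: fg.
have add4 (a b c d : T -> R) : {for x, continuous a} -> {for x, continuous b} ->
    {for x, continuous c} -> {for x, continuous d} ->
    {for x, continuous (fun y => a y + b y + c y + d y)}.
  by move=> ha hb hc hd; apply: cvgD hd; apply: cvgD hc; apply: cvgD hb.
have E i g' : (forall y, qmul (F y) (G y) 0 i = g' y) -> {for x, continuous g'} ->
    {for x, continuous (fun y => qmul (F y) (G y) 0 i)} by move=> /funext ->.
by apply: continuous_quat; apply: ord4P;
  (eapply E; [by move=> y; rewrite /qmul /mkquat mxE /=; reflexivity|
   apply: add4; (exact: fg || exact: nfg)]).
Qed.

Lemma qmul_continuous (T : topologicalType) (F G : T -> quat R) :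
  continuous F -> continuous G -> continuous (fun x => qmul (F x) (G x)).
Proof.
by move=> cF cG x; apply: continuous_qmul_at; [exact: cF|exact: cG].
Qed.

(** Picard iteration. The hypothesis 8 M r <= 1 makes the integral operator a
    contraction of ratio 1/2, the product of quaternions having norm at most 4 in
    the sup norm. *)
Lemma linear_ode (B : R -> quat R) (c r M : R) : 0 < r -> continuous B ->
  (forall x, `|B x| <= M) -> 8 * M * r <= 1 ->
  exists y : R -> quat R, y c = quat1 /\
    forall x, `|x - c| < r -> is_derive x 1 y (qmul (y x) (B x)).
Proof.
move=> r0 cB BM Mr.
have M0 : 0 <= M by exact: le_trans (BM 0).
have [I [hI lipI bndI]] := quat_primitive c r0.
pose Phi y := fun x => quat1 + I (fun t => qmul (y t) (B t)) x.
pose y := fix y n := if n is n'.+1 then Phi (y n') else fun=> quat1.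
have cPhi z : continuous z -> continuous (Phi z).
  move=> cz; have [_ h _] := hI _ (qmul_continuous cz cB).
  by move=> x; apply: cvgD; [exact: cvg_cst|exact: h].
have cy n : continuous (y n).
  elim: n => [|n IH] /=; first by move=> x; exact: cvg_cst.
  exact: cPhi.
have lip z1 z2 D : continuous z1 -> continuous z2 -> (forall x, `|z1 x - z2 x| <= D) ->
    forall x, `|Phi z1 x - Phi z2 x| <= D / 2.
  move=> c1 c2 h x; rewrite /Phi opprD addrACA subrr add0r.
  have D0 : 0 <= D by exact: le_trans (h 0).
  apply: (@le_trans _ _ (4 * D * M * r)); last first.
    rewrite (_ : 4 * D * M * r = D / 2 * (8 * M * r)); last by field.
    by rewrite -[leRHS]mulr1 ler_wpM2l // divr_ge0.
  apply: lipI; [exact: qmul_continuous|exact: qmul_continuous|] => t.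
  rewrite -qmulBl; apply: le_trans (norm_qmul _ _) _.
  by rewrite ler_pM // ?mulr_ge0 // ler_wpM2l.
have step n x : `|y n.+1 x - y n x| <= 2^-1 ^+ n.
  elim: n x => [|n IH] x.
    rewrite expr0 /= /Phi addrAC subrr add0r.
    apply: le_trans (bndI _ M (qmul_continuous (cy 0%N) cB) _ x) _.
      by move=> t; rewrite /= qmul1l.
    have := mulr_ge0 M0 (ltW r0); lra.
  rewrite exprSr; exact: (lip (y n.+1) (y n) (2^-1 ^+ n) (cy n.+1) (cy n) IH x).
have lim_ex x : exists l : quat R, forall n, `|y n x - l| <= 2 * 2^-1 ^+ n.
  have h i : exists l, forall n, `|y n x 0 i - l| <= 2 * 2^-1 ^+ n.
    apply: geometric_limit => n; apply: le_trans (step n x).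
    by have := qcoord_norm (y n.+1 x - y n x) i; rewrite !mxE.
  have [l hl] := choice h; exists (\row_i l i) => n.
  apply: norm_quat_le => [|i]; last by rewrite !mxE.
  by rewrite mulr_ge0 // exprn_ge0 // invr_ge0.
have [Y hY] := choice lim_ex.
have cY : continuous Y.
  move=> x; apply/cvgrPdist_lt => e e0.
  have [n hn] := half_pow_small (divr_gt0 e0 (ltr0n R 8 : 0 < 8)).
  have e2 : 0 < e / 2 by rewrite divr_gt0.
  apply: filterS (continuous_near_dist (cy n x) e2) => t ht.
  rewrite (_ : Y x - Y t = (Y x - y n x) + (y n x - y n t) + (y n t - Y t)); last first.
    by rewrite !addrA !subrK.
  apply: le_lt_trans (ler_normD _ _) _; apply: le_lt_trans (lerD (ler_normD _ _) (lexx _)) _.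
  by have := hY x n; have := hY t n; rewrite (distrC (Y x)); lra.
have fixY x : Phi Y x = Y x.
  apply/eqP; rewrite -subr_eq0 -normr_le0; apply/ler_addgt0Pl => e e0; rewrite addr0.
  have [n hn] := half_pow_small (divr_gt0 e0 (ltr0n R 8 : 0 < 8)).
  have h1 : `|Phi Y x - y n.+1 x| <= 2 * 2^-1 ^+ n / 2.
    by apply: lip => // t; rewrite distrC.
  have h2 := hY x n.+1.
  rewrite -(subrKA (y n.+1 x)); apply: le_trans (ler_normD _ _) _.
  rewrite exprS in h2; lra.
exists Y; have [I0 _ dI] := hI _ (qmul_continuous cY cB).
split; first by rewrite -fixY /Phi I0 addr0.
have E : Y = Phi Y by apply/funext => x; rewrite fixY.
move=> x xr; rewrite {1}E /Phi -[qmul _ _]add0r.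
exact: is_derive_add (is_derive_cst _ _ _) (dI x xr).
Qed.

End LinearODE.

(** * Local solutions of flat systems *)

Section UnitSolutions.
Context {R : realType}.

Lemma between_radius (a c x r : R) : `|a - c| < r -> Num.min c a <= x <= Num.max c a -> `|x - c| < r.
Proof. by move=> ac xac; exact: between_dist xac ac. Qed.

Lemma between_radius2 (a b c x r : R) : `|a - c| < r -> `|b - c| < r ->
  Num.min a b <= x <= Num.max a b -> `|x - c| < r.
Proof.
rewrite !ltr_norml ge_min le_max => /andP[? ?] /andP[? ?] /andP[/orP[]? /orP[]?];
  apply/andP; split; lra.
Qed.

Lemma between_increment (x h y : R) :
  Num.min x (x + h) <= y <= Num.max x (x + h) -> `|y - x| <= `|h|.
Proof.
have h1 := ler_norm h; have h2 := ler_norm (- h); rewrite normrN in h2.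
rewrite ge_min le_max ler_norml => /andP[/orP[]? /orP[]?]; apply/andP; split; lra.
Qed.

(** Right multiplication by an imaginary quaternion is skew-symmetric. *)
Lemma unit_ode (B y : R -> quat R) (c r : R) :
  (forall x, `|x - c| < r -> is_derive x 1 y (qmul (y x) (B x))) ->
  (forall x, `|x - c| < r -> qre (B x) = 0) -> qdot (y c) (y c) = 1 ->
  forall x, `|x - c| < r -> qdot (y x) (y x) = 1.
Proof.
move=> dy reB y1 x xr; apply/eqP; rewrite -y1 -subr_eq0 -normr_le0.
rewrite -[leRHS](mul0r `|x - c|).
apply: (@mean_value_le _ (fun t => qdot (y t) (y t)) (fun=> 0)); last by move=> *; rewrite normr0.
move=> t /(between_radius xr) tr; apply: (is_derive_eq (is_derive_qdot (dy t tr) (dy t tr))).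
by rewrite [X in _ + X]qdotC qmul_qdot0 ?addr0 // reB.
Qed.

(** A quadratic bound on the remainder is what comparing two neighbouring
    transports gives. *)
Lemma is_derive_quadratic (f : R -> quat R) (x r C : R) (L : quat R) : 0 < r ->
  (forall h, `|h| < r -> `|f (x + h) - f x - h *: L| <= C * (`|h| * `|h|)) ->
  is_derive x 1 f L.
Proof.
move=> r0 hf.
have : h^-1 *: ((f \o shift x) (h *: 1) - f x) @[h --> 0^'] --> L.
  apply/cvgrPdist_le => e e0.
  have C0 : 0 < `|C| + 1 by rewrite ltr_wpDl.
  have d0 : 0 < Num.min r (e / (`|C| + 1)) by rewrite lt_min r0 divr_gt0.
  apply/nbhs_ballP; exists (Num.min r (e / (`|C| + 1))) => // h.
  rewrite -ball_normE /= sub0r normrN lt_min => /andP[hr he] h0.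
  have -> : L - h^-1 *: (f (h *: 1 + x) - f x) = - (h^-1 *: (f (x + h) - f x - h *: L)).
    by rewrite [in RHS]scalerBr scalerA mulVf // scale1r opprB [h *: 1]mulr1 (addrC h).
  rewrite normrN normrZ normfV mulrC ler_pdivrMr ?normr_gt0 //.
  apply: le_trans (hf h hr) _; rewrite mulrA ler_wpM2r //.
  apply: (@le_trans _ _ ((`|C| + 1) * `|h|)).
    rewrite ler_wpM2r //; apply: le_trans (ler_norm C) _; by rewrite lerDl.
  by rewrite mulrC -ler_pdivlMr // ltW.
by move=> H; split; [apply/cvg_ex; exists L|exact: cvg_lim H].
Qed.

End UnitSolutions.

Section LocalSolutions.
Context {R : realType}.
Implicit Types (A B Q : R * R -> quat R) (z : R * R).

(** A point at which Q satisfies dQ = Q (A du + B dv). Differentiability is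
    kept apart since it does not follow from the existence of partial derivatives. *)
Record flat_solution A B Q z : Prop := FlatSolution {
  fsol_u : is_derive z e_u Q (qmul (Q z) (A z));
  fsol_v : is_derive z e_v Q (qmul (Q z) (B z));
  fsol_diff : differentiable Q z;
  fsol_unit : qdot (Q z) (Q z) = 1
}.

Lemma qmul3_le (x y z : quat R) a : `|x| <= 1 -> `|z| <= 1 -> `|y| <= a ->
  `|qmul (qmul x y) z| <= 16 * a.
Proof.
move=> x1 z1 ya; apply: le_trans (norm_qmul _ _) _.
apply: (@le_trans _ _ (4 * (4 * 1 * a) * 1)); last by lra.
rewrite ler_pM // ?mulr_ge0 // ler_wpM2l // (le_trans (norm_qmul _ _)) //.
by rewrite ler_pM // ?mulr_ge0 // ler_wpM2l.
Qed.

(** With Z = Y(u, t), Zc its conjugate, Y' = Y(u + h, t), B' and C the values of B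
    at u + h and u, F the value of A and G the u-derivative of B: the left-hand side
    is the t-derivative of the quantity D in transport_variation after the
    v-derivative of A is replaced according to flatness. *)
Lemma variation_identity (Y' Z Zc B' C F G : quat R) (h : R) :
  qmul (qmul Y' (B' - C)) Zc -
    h *: (qmul (qmul (qmul Z C) F + qmul Z (G + (qmul F C - qmul C F))) Zc +
          qmul (qmul Z F) (- qmul C Zc)) =
  qmul (qmul (Y' - Z) (B' - C)) Zc + qmul (qmul Z (B' - C - h *: G)) Zc.
Proof.
have -> : qmul (qmul (qmul Z C) F + qmul Z (G + (qmul F C - qmul C F))) Zc +
    qmul (qmul Z F) (- qmul C Zc) = qmul (qmul Z G) Zc.
  rewrite qmulNr qmulA -qmulBl; congr (qmul _ Zc).
  rewrite -!qmulA -qmulDr -qmulBr; congr (qmul Z _).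
  by move: (qmul C F) (qmul F C) => a b; apply/rowP => i; rewrite !mxE; ring.
move: (B' - C) => W.
by rewrite [qmul Z (_ - _)]qmulBr !qmulBl qmulZr qmulZl addrA subrK.
Qed.

(** Y u is the transport along the vertical segment of abscissa u. Flatness says
    that Y A Y^-1 has t-derivative Y B_u Y^-1, while that of Y(u + h) Y(u)^-1 is
    h Y B_u Y^-1 up to order h^2. So
      D t = Y(u + h, t) Y(u, t)^-1 - h Y A Y^-1
    has a t-derivative of order h^2, and D v - D v0 gives the claim after
    multiplication by Y(u, v). *)
Lemma transport_variation A B (Y : R -> R -> quat R) (u0 v0 r M : R) :
  0 < r -> 0 <= M -> 8 * M * r <= 1 ->
  (forall u v, `|u - u0| < r -> `|v - v0| < r ->
     [/\ qre (B (u, v)) = 0, is_derive (u, v) e_v A ('D_e_v A (u, v)),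
         is_derive (u, v) e_u B ('D_e_u B (u, v)) &
         is_derive (u, v) e_u ('D_e_u B) ('D_e_u ('D_e_u B) (u, v))]) ->
  (forall u v, `|u - u0| < r -> `|v - v0| < r ->
     'D_e_v A (u, v) - 'D_e_u B (u, v) =
       qmul (A (u, v)) (B (u, v)) - qmul (B (u, v)) (A (u, v))) ->
  (forall u v, `|u - u0| < r -> `|v - v0| < r ->
     `|'D_e_u B (u, v)| <= M /\ `|'D_e_u ('D_e_u B) (u, v)| <= M) ->
  (forall u, `|u - u0| < r -> Y u v0 = quat1) ->
  (forall u v, `|u - u0| < r -> `|v - v0| < r ->
     is_derive v 1 (Y u) (qmul (Y u v) (B (u, v)))) ->
  forall u v, `|u - u0| < r -> `|v - v0| < r ->
    is_derive u 1 (fun s => Y s v) (qmul (Y u v) (A (u, v)) - qmul (A (u, v0)) (Y u v)).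
Proof.
move=> r0 M0 Mr hd flat hM Y0 dY u v ur vr.
have Y1 s t : `|s - u0| < r -> `|t - v0| < r -> qdot (Y s t) (Y s t) = 1.
  move=> sr; apply: (@unit_ode _ (fun t => B (s, t)) (Y s) v0 r) => [t' tr|t' tr|].
  - exact: dY.
  - by case: (hd s t' sr tr).
  - by rewrite Y0 // qdot11.
have Yn s t : `|s - u0| < r -> `|t - v0| < r -> `|Y s t| <= 1.
  by move=> sr tr; apply/qdot_norm_le1/Y1.
have Ycn s t : `|s - u0| < r -> `|t - v0| < r -> `|qconj (Y s t)| <= 1.
  by move=> sr tr; rewrite norm_conj; exact: Yn.
have cv0 : `|v0 - v0| < r by rewrite subrr normr0.
apply: (@is_derive_quadratic _ _ _ (r - `|u - u0|) 72); first by rewrite subr_gt0.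
move=> h hr.
have uhr : `|u + h - u0| < r.
  rewrite addrAC; apply: le_lt_trans (ler_normD _ _) _; lra.
have dBuniform s t : `|s - u0| < r -> `|t - v0| < r ->
    `|'D_e_u B (s, t) - 'D_e_u B (u, t)| <= M * `|s - u|.
  move=> sr tr; apply: (@mean_value_quat_le _ (fun x => 'D_e_u B (x, t))
    (fun x => 'D_e_u ('D_e_u B) (x, t))) => x xus.
    have xr := between_radius2 ur sr xus.
    by have [_ _ _ H] := hd x t xr tr; exact: (proj1 (is_derive_slice_u _ _ _ _) H).
  by have [_ H] := hM x t (between_radius2 ur sr xus) tr.
have B1 t : `|t - v0| < r -> `|B (u + h, t) - B (u, t)| <= M * `|h|.
  move=> tr; rewrite -[h in leRHS](addKr u) [- u + _]addrC.
  apply: (@mean_value_quat_le _ (fun x => B (x, t)) (fun x => 'D_e_u B (x, t))) => x xus.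
    have xr := between_radius2 ur uhr xus.
    by have [_ _ H _] := hd x t xr tr; exact: (proj1 (is_derive_slice_u _ _ _ _) H).
  by have [H _] := hM x t (between_radius2 ur uhr xus) tr.
have B2 t : `|t - v0| < r ->
    `|B (u + h, t) - B (u, t) - h *: 'D_e_u B (u, t)| <= M * `|h| * `|h|.
  move=> tr.
  have -> : B (u + h, t) - B (u, t) - h *: 'D_e_u B (u, t) =
      (B (u + h, t) - (u + h) *: 'D_e_u B (u, t)) - (B (u, t) - u *: 'D_e_u B (u, t)).
    by rewrite scalerDl; apply/rowP => i; rewrite !mxE; ring.
  have hh : u + h - u = h by rewrite addrC addKr.
  rewrite -[X in _ * `|X|]hh.
  apply: (@mean_value_quat_le _ (fun x => B (x, t) - x *: 'D_e_u B (u, t))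
    (fun x => 'D_e_u B (x, t) - 'D_e_u B (u, t))) => x xus; have xr := between_radius2 ur uhr xus.
    have [_ _ H _] := hd x t xr tr.
    apply: is_derive_add; first exact: (proj1 (is_derive_slice_u _ _ _ _) H).
    apply: is_derive_opp.
    apply: (is_derive_eq (is_derive_scaleq (is_derive_id x 1) (is_derive_cst _ x 1))).
    by rewrite scaler0 addr0 scale1r.
  apply: le_trans (dBuniform _ _ xr tr) _; rewrite ler_wpM2l //.
  exact: between_increment xus.
have dYc s t : `|s - u0| < r -> `|t - v0| < r ->
    is_derive t 1 (fun t => qconj (Y s t)) (- qmul (B (s, t)) (qconj (Y s t))).
  move=> sr tr; apply: (is_derive_eq (is_derive_qconj (dY s t sr tr))).
  rewrite qconjM -qmulNl; congr qmul; have [H _ _ _] := hd s t sr tr.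
  by apply: quatP; quat_simp; rewrite ?H ?oppr0.
have dE t : `|t - v0| < r ->
    is_derive t 1 (fun t => qmul (Y (u + h) t) (qconj (Y u t)))
      (qmul (qmul (Y (u + h) t) (B (u + h, t) - B (u, t))) (qconj (Y u t))).
  move=> tr; apply: (is_derive_eq (is_derive_qmul (dY _ _ uhr tr) (dYc _ _ ur tr))).
  by rewrite qmulNr qmulBr qmulBl !qmulA.
(* The transports themselves vary by O(h); 16 M r <= 2 and norm_qmul costs 4. *)
have E1 t : `|t - v0| < r -> `|Y (u + h) t - Y u t| <= 8 * `|h|.
  move=> tr.
  have -> : Y (u + h) t - Y u t = qmul (qmul (Y (u + h) t) (qconj (Y u t)) -
      qmul (Y (u + h) v0) (qconj (Y u v0))) (Y u t).
    rewrite !Y0 // qmulBl -qmulA qmulVq Y1 // scale1r qmul1r qmulqV qdot11 scale1r.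
    by rewrite qmul1l.
  have : `|qmul (Y (u + h) t) (qconj (Y u t)) - qmul (Y (u + h) v0) (qconj (Y u v0))|
      <= 16 * (M * `|h|) * `|t - v0|.
    apply: (@mean_value_quat_le _ (fun t => qmul (Y (u + h) t) (qconj (Y u t)))) => [x|x].
      by move=> /(between_radius tr) xr; exact: dE.
    move=> /(between_radius tr) xr; apply: qmul3_le; [exact: Yn|exact: Ycn|exact: B1].
  move=> H; apply: le_trans (norm_qmul _ _) _.
  apply: (@le_trans _ _ (4 * (16 * (M * `|h|) * `|t - v0|) * 1)).
    by rewrite ler_pM // ?mulr_ge0 ?Yn // ler_wpM2l.
  have : M * `|t - v0| * `|h| <= M * r * `|h| by rewrite ler_wpM2r // ler_wpM2l // ltW.
  have : 8 * M * r * `|h| <= 1 * `|h| by rewrite ler_wpM2r.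
  move: (M) (`|t - v0|) (`|h|) (r) => m d k s; nra.
pose D t := qmul (Y (u + h) t) (qconj (Y u t)) -
  h *: qmul (qmul (Y u t) (A (u, t))) (qconj (Y u t)).
have dD t : `|t - v0| < r -> is_derive t 1 D
    (qmul (qmul (Y (u + h) t - Y u t) (B (u + h, t) - B (u, t))) (qconj (Y u t)) +
     qmul (qmul (Y u t) (B (u + h, t) - B (u, t) - h *: 'D_e_u B (u, t))) (qconj (Y u t))).
  move=> tr.
  have [_ dA _ _] := hd u t ur tr.
  have dA' := proj1 (is_derive_slice_v _ _ _ _) dA.
  have dYA := is_derive_qmul (is_derive_qmul (dY _ _ ur tr) dA') (dYc _ _ ur tr).
  have dhYA := is_derive_scaleq (is_derive_cst h t 1) dYA.
  apply: (is_derive_eq (is_derive_add (dE t tr) (is_derive_opp dhYA))).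
  have fl : 'D_e_v A (u, t) = 'D_e_u B (u, t) + (qmul (A (u, t)) (B (u, t)) - qmul (B (u, t)) (A (u, t))).
    by rewrite -(flat u t ur tr) addrC subrK.
  rewrite fl scale0r add0r /cst.
  exact: variation_identity.
(* 144 = 4 * 4 * 8 + 16: the two terms of dD. *)
have Dbound : `|D v - D v0| <= 144 * M * (`|h| * `|h|) * `|v - v0|.
  apply: (mean_value_quat_le (f := D)) => [x|x].
    by move=> /(between_radius vr) xr; exact: dD.
  move=> /(between_radius vr) xr; apply: le_trans (ler_normD _ _) _.
  have h2 := qmul3_le (Yn _ _ ur xr) (Ycn _ _ ur xr) (B2 x xr).
  have h1 : `|qmul (qmul (Y (u + h) x - Y u x) (B (u + h, x) - B (u, x))) (qconj (Y u x))|
      <= 4 * (4 * (8 * `|h|) * (M * `|h|)) * 1.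
    apply: le_trans (norm_qmul _ _) _.
    rewrite ler_pM ?Ycn // ?mulr_ge0 // ler_wpM2l // (le_trans (norm_qmul _ _)) //.
    by rewrite ler_pM ?B1 // ?mulr_ge0 // ler_wpM2l // E1.
  apply: le_trans (lerD h1 h2) _.
  by move: (M) (`|h|) => m k; rewrite le_eqVlt; apply/orP; left; apply/eqP; ring.
have Dv0 : D v0 = quat1 - h *: A (u, v0).
  by rewrite /D !Y0 // qmul1l; congr (_ - _ *: _); quat_ring.
have -> : Y (u + h) v - Y u v - h *: (qmul (Y u v) (A (u, v)) - qmul (A (u, v0)) (Y u v)) =
    qmul (D v - D v0) (Y u v).
  rewrite Dv0 /D !qmulBl !qmulZl -!qmulA qmulVq Y1 // scale1r !qmul1r qmul1l scalerBr.
  by apply/rowP => i; rewrite !mxE; ring.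
apply: le_trans (norm_qmul _ _) _.
apply: (@le_trans _ _ (4 * (144 * M * (`|h| * `|h|) * `|v - v0|) * 1)).
  by rewrite ler_pM ?Yn // ?mulr_ge0 // ler_wpM2l.
have H0 : 0 <= `|h| * `|h| by rewrite mulr_ge0.
have : M * `|v - v0| * (`|h| * `|h|) <= M * r * (`|h| * `|h|).
  by rewrite ler_wpM2r // ler_wpM2l // ltW.
have : 8 * M * r * (`|h| * `|h|) <= 1 * (`|h| * `|h|) by rewrite ler_wpM2r.
move: H0; move: (M) (`|v - v0|) (`|h| * `|h|) (r) => m d k s; clear; nra.
Qed.

Lemma continuous_locally_bounded (T : topologicalType) (F : T -> quat R) (z : T) (M : R) :
  {for z, continuous F} -> `|F z| + 1 <= M -> \forall y \near z, `|F y| <= M.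
Proof.
move=> cF FM; apply: filterS (continuous_near_dist cF ltr01) => y h.
have -> : F y = F z - (F z - F y) by rewrite opprB addrC subrK.
apply: le_trans (ler_normB _ _) _; apply: le_trans FM; by rewrite lerD2l ltW.
Qed.

Lemma near_square (u0 v0 r u v : R) : `|u - u0| < r -> `|v - v0| < r ->
  \forall z \near (u, v), `|z.1 - u0| < r /\ `|z.2 - v0| < r.
Proof.
move=> ur vr; apply/near_planeP; exists (Num.min (r - `|u - u0|) (r - `|v - v0|)).
  by rewrite lt_min !subr_gt0 ur.
move=> a b; rewrite !lt_min /= !ltrBrDr => /andP[au _] /andP[_ bv].
split; [have -> : a - u0 = (a - u) + (u - u0) by rewrite addrA subrK|
        have -> : b - v0 = (b - v) + (v - v0) by rewrite addrA subrK];
  by apply: le_lt_trans (ler_normD _ _) _.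
Qed.

(** X solves the equation along the horizontal line through z0 and Y u along the
    vertical line of abscissa u, starting from 1; the solution is X u * Y u v. The
    u-derivative of Y u v, Y A - A(u, v0) Y, has a term that cancels the derivative
    of X. *)
Lemma local_flat_solution (U : set (R * R)) A B z0 : open U ->
  class_C 2 U A -> class_C 2 U B ->
  (forall z, U z -> qre (A z) = 0 /\ qre (B z) = 0) ->
  (forall z, U z -> 'D_e_v A z - 'D_e_u B z =
     qmul (A z) (B z) - qmul (B z) (A z)) ->
  U z0 -> exists2 Q, Q z0 = quat1 & \forall z \near z0, flat_solution A B Q z.
Proof.
move=> oU cA cB im flat Uz0.
have [[dA DA] [dB DB]] := (cA, cB).
have [dBu DBu] := DB e_u.
have cont F z : class_C 2 U F -> U z -> {for z, continuous F}.
  by move=> /class_CS /class_CS h Uz; exact: h.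
have cBu z : U z -> {for z, continuous ('D_e_u B)}.
  by move=> Uz; apply: differentiable_continuous; exact: dBu.
pose M := `|A z0| + `|B z0| + `|'D_e_u B z0| + `|'D_e_u ('D_e_u B) z0| + 1.
have [a0 b0 c0 d0] : [/\ 0 <= `|A z0|, 0 <= `|B z0|, 0 <= `|'D_e_u B z0| &
  0 <= `|'D_e_u ('D_e_u B) z0|] by [].
have bnd4 (a b c d : R) : 0 <= a -> 0 <= b -> 0 <= c -> 0 <= d ->
    [/\ a + 1 <= a + b + c + d + 1, b + 1 <= a + b + c + d + 1,
        c + 1 <= a + b + c + d + 1, d + 1 <= a + b + c + d + 1 & 0 <= a + b + c + d + 1].
  by clear; move=> ????; split; lra.
have [Ma Mb Mc Md M0] := bnd4 _ _ _ _ a0 b0 c0 d0; rewrite -/M in Ma Mb Mc Md M0.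
have nU : \forall z \near z0, U z by exact: open_nbhs_nbhs.
have nAB : \forall z \near z0, `|A z| <= M /\ `|B z| <= M.
  have n1 := continuous_locally_bounded (cont _ _ _ cA Uz0) Ma.
  have n2 := continuous_locally_bounded (cont _ _ _ cB Uz0) Mb.
  apply: filterS2 n1 n2 => z h1 h2; split; [exact: h1|exact: h2].
have nB : \forall z \near z0, `|'D_e_u B z| <= M /\ `|'D_e_u ('D_e_u B) z| <= M.
  have n1 := continuous_locally_bounded (cBu z0 Uz0) Mc.
  have n2 := continuous_locally_bounded (DBu e_u z0 Uz0) Md.
  apply: filterS2 n1 n2 => z h1 h2; split; [exact: h1|exact: h2].
have /near_planeP[r1 r10 h1] : \forall z \near z0, [/\ U z, `|A z| <= M /\ `|B z| <= M &
    `|'D_e_u B z| <= M /\ `|'D_e_u ('D_e_u B) z| <= M].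
  by apply: filterS3 nU nAB nB => z g1 g2 g3; split; [exact: g1|exact: g2|exact: g3].
clear nU nAB nB.
case: z0 Uz0 @M a0 b0 c0 d0 Ma Mb Mc Md M0 h1 => u0 v0 Uz0 M _ _ _ _ _ _ _ _ M0 /= h1.
clear bnd4.
(* The coefficients are clamped to the closed square of radius rho, inside U. *)
pose rho := r1 / 2.
have rho0 : 0 < rho by rewrite divr_gt0.
have rho1 x c : `|x - c| <= rho -> `|x - c| < r1.
  by move=> h; apply: le_lt_trans h _; rewrite /rho ltr_pdivrMr // ltr_pMr // ltr1n.
pose r := Num.min rho (8 * M + 1)^-1.
have M1 : 0 < 8 * M + 1 by rewrite ltr_wpDl // mulr_ge0.
have r0 : 0 < r by rewrite lt_min rho0 invr_gt0.
have rrho x c : `|x - c| < r -> `|x - c| <= rho.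
  by move=> /ltW h; apply: le_trans h _; rewrite ge_min lexx.
have Mr : 8 * M * r <= 1.
  apply: (@le_trans _ _ ((8 * M + 1) * (8 * M + 1)^-1)); last by rewrite divff // gt_eqF.
  by rewrite ler_pM ?mulr_ge0 ?lerDl ?(ltW r0) // ge_min lexx orbT.
have cin x c : `|clamp c rho x - c| < r1 by apply/rho1/clamp_dist/ltW.
have pt u v : U (clamp u0 rho u, clamp v0 rho v) by case: (h1 _ _ (cin u u0) (cin v v0)).
have cslice (F : R * R -> quat R) (g1 g2 : R -> R) : class_C 2 U F -> continuous g1 -> continuous g2 ->
    (forall t, U (g1 t, g2 t)) -> continuous (fun t => F (g1 t, g2 t)).
  move=> cF k1 k2 Ug t; apply: (@continuous_comp _ _ _ (fun t => (g1 t, g2 t)) F).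
    exact: (cvg_pair (k1 t) (k2 t)).
  exact: (cont _ F _ cF (Ug t)).
have cc (x : R) : continuous (fun _ : R => x) by move=> y; exact: cvg_cst.
have cv0 : `|v0 - v0| < r by rewrite subrr normr0.
have cu0 : `|u0 - u0| < r by rewrite subrr normr0.
have v0K : clamp v0 rho v0 = v0 by rewrite clamp_id ?rrho.
have [X [X0 dX]] : exists X : R -> quat R, X u0 = quat1 /\
    forall u, `|u - u0| < r -> is_derive u 1 X (qmul (X u) (A (clamp u0 rho u, v0))).
  apply: (@linear_ode _ _ _ _ M) => //.
    by apply: cslice => //; [exact: clamp_continuous|move=> t; rewrite -v0K].
  by move=> x; case: (h1 _ _ (cin x u0) (cin v0 v0)); rewrite v0K => _ [].
have Y_ex u : exists y : R -> quat R, y v0 = quat1 /\ forall v, `|v - v0| < r ->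
    is_derive v 1 y (qmul (y v) (B (clamp u0 rho u, clamp v0 rho v))).
  apply: (@linear_ode _ _ _ _ M) => //.
    by apply: cslice => //; exact: clamp_continuous.
  by move=> x; case: (h1 _ _ (cin u u0) (cin x v0)) => _ [].
have [Y hY] := choice Y_ex.
have H u v : `|u - u0| < r -> `|v - v0| < r -> [/\ U (u, v), `|A (u, v)| <= M /\ `|B (u, v)| <= M &
    `|'D_e_u B (u, v)| <= M /\ `|'D_e_u ('D_e_u B) (u, v)| <= M].
  by move=> /rrho /rho1 ur /rrho /rho1 vr; exact: h1.
have dX' u : `|u - u0| < r -> is_derive u 1 X (qmul (X u) (A (u, v0))).
  by move=> ur; have := dX u ur; rewrite clamp_id // rrho.
have dY u v : `|u - u0| < r -> `|v - v0| < r -> is_derive v 1 (Y u) (qmul (Y u v) (B (u, v))).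
  by move=> ur vr; have := (hY u).2 v vr; rewrite !clamp_id // rrho.
have dYu u v : `|u - u0| < r -> `|v - v0| < r ->
    is_derive u 1 (fun s => Y s v) (qmul (Y u v) (A (u, v)) - qmul (A (u, v0)) (Y u v)).
  apply: (@transport_variation A B Y u0 v0 r M) => //.
  - move=> s t sr tr; have [Ust _ _] := H s t sr tr; split.
    + by case: (im _ Ust).
    + exact: differentiable_is_derive (dA _ Ust).
    + exact: differentiable_is_derive (dB _ Ust).
    + exact: differentiable_is_derive (dBu _ Ust).
  - by move=> s t sr tr; have [Ust _ _] := H s t sr tr; exact: flat.
  - by move=> s t sr tr; have [_ _ h] := H s t sr tr.
  - by move=> s sr; case: (hY s).
have Y0 u : Y u v0 = quat1 by case: (hY u).
clear dX hY.
pose Q (z : R * R) := qmul (X z.1) (Y z.1 z.2).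
have X1 u : `|u - u0| < r -> qdot (X u) (X u) = 1.
  apply: (@unit_ode _ (fun u => A (u, v0)) X u0 r) => //; last by rewrite X0 qdot11.
  by move=> s sr; have [Us _ _] := H s v0 sr cv0; case: (im _ Us).
have Y1 u v : `|u - u0| < r -> `|v - v0| < r -> qdot (Y u v) (Y u v) = 1.
  move=> ur; apply: (@unit_ode _ (fun v => B (u, v)) (Y u) v0 r) => [t tr|t tr|].
  - exact: dY.
  - by have [Us _ _] := H u t ur tr; case: (im _ Us).
  - by rewrite Y0 // qdot11.
have Q1 u v : `|u - u0| < r -> `|v - v0| < r -> qdot (Q (u, v)) (Q (u, v)) = 1.
  by move=> ur vr; rewrite qdotM X1 // Y1 // mulr1.
have dQ u v : `|u - u0| < r -> `|v - v0| < r ->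
    is_derive (u, v) e_u Q (qmul (Q (u, v)) (A (u, v))) /\
    is_derive (u, v) e_v Q (qmul (Q (u, v)) (B (u, v))).
  move=> ur vr; split.
    apply: (proj2 (@is_derive_slice_u _ _ Q u v _)).
    apply: (is_derive_eq (is_derive_qmul (dX' u ur) (dYu u v ur vr))).
    by rewrite qmulBr !qmulA addrC subrK.
  apply: (proj2 (@is_derive_slice_v _ _ Q u v _)).
  apply: (is_derive_eq (is_derive_qmul (is_derive_cst (X u) v 1) (dY u v ur vr))).
  by rewrite qmul0l add0r qmulA.
have QM u v (F : R * R -> quat R) : `|u - u0| < r -> `|v - v0| < r -> `|F (u, v)| <= M ->
    `|qmul (Q (u, v)) (F (u, v))| <= 4 * 1 * M.
  move=> ur vr FM; apply: le_trans (norm_qmul _ _) _.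
  by rewrite ler_pM ?mulr_ge0 // ler_wpM2l // qdot_norm_le1 // Q1.
exists Q; first by rewrite /Q X0 Y0 // qmul1l.
apply/near_planeP; exists r => // u v /= ur vr.
have nr : \forall z \near (u, v), `|z.1 - u0| < r /\ `|z.2 - v0| < r.
  exact: near_square.
have nQ : \forall y \near (u, v), is_derive y e_u Q (qmul (Q y) (A y)) /\
    is_derive y e_v Q (qmul (Q y) (B y)).
  by apply: filterS nr => -[a b] [ar br]; exact: dQ.
have cQ : {for (u, v), continuous Q}.
  apply: (partials_bounded_continuous (M := 4 * 1 * M) nQ).
  apply: filterS nr => -[a b] [ar br]; have [_ [hA hB] _] := H a b ar br.
  by split; exact: QM.
have [Uuv _ _] := H u v ur vr.
split.
- by case: (dQ u v ur vr).
- by case: (dQ u v ur vr).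
- apply: (partials_continuous_differentiable nQ);
    apply: continuous_qmul_at => //; exact: cont.
- exact: Q1.
Qed.

End LocalSolutions.

(** * Germs of solutions *)

Section Cousin.
Context {R : realType}.

(** Consider the supremum of the x such that P a x. This replaces compactness of
    segments, and of squares when it is used twice. *)
Lemma cousin (P : R -> R -> Prop) (a b : R) : a <= b ->
  (forall x y z, a <= x -> x <= y -> y <= z -> z <= b -> P x y -> P y z -> P x z) ->
  (forall x, a <= x <= b -> exists2 d, 0 < d &
     forall y z, a <= y -> y <= z -> z <= b -> `|y - x| < d -> `|z - x| < d -> P y z) ->
  P a b.
Proof.
move=> ab add loc.
pose E := [set x | a <= x <= b /\ P a x].
have Ea : E a.
  split; first by rewrite lexx.
  by have [|d d0 h] := loc a; rewrite ?lexx //; apply: h; rewrite ?subrr ?normr0.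
have Eub : has_ubound E by exists b => x [/andP[]].
have as_ : a <= sup E by exact: ub_le_sup.
have sb : sup E <= b by apply: ge_sup; [exists a|move=> x [/andP[]]].
have [|d d0 h] := loc (sup E); first by rewrite as_.
have [x [xab Px] sx] : exists2 x, E x & sup E - d < x.
  by apply: sup_adherent => //; split => //; exists a.
have xs : x <= sup E by apply: ub_le_sup.
move/andP: xab => [ax xb].
pose z := Num.min b (sup E + d / 2).
have d20 : 0 < d / 2 by rewrite divr_gt0.
have sz : sup E <= z by rewrite /z le_min sb lerDl ltW.
have zb : z <= b by rewrite /z ge_min lexx.
have zs : z <= sup E + d / 2 by rewrite /z ge_min lexx orbT.
have xz : x <= z by exact: le_trans sz.
have Pz : P a z.
  apply: (add a x z) => //; apply: h => //.
    by rewrite ler0_norm ?subr_le0 // opprB ltrBlDr addrC -ltrBlDr.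
  rewrite ger0_norm ?subr_ge0 // ltrBlDl; apply: le_lt_trans zs _.
  by rewrite ltrD2l ltr_pdivrMr // ltr_pMr // ltr1n.
have Ez : E z by split => //; rewrite (le_trans ax xz).
have zs' : z <= sup E by exact: ub_le_sup.
move: Pz zs'; rewrite /z; case: (leP b (sup E + d / 2)) => // _ _.
by rewrite gerDl leNgt d20.
Qed.

Lemma locally_constant_segment (T : Type) (f : R -> T) (a b : R) : a <= b ->
  (forall x, a <= x <= b -> \forall y \near x, a <= y <= b -> f y = f x) ->
  f a = f b.
Proof.
move=> ab loc; apply: (@cousin (fun x y => f x = f y) a b ab).
  by move=> x y z _ _ _ _ -> ->.
move=> x xab; have /nbhs_ballP[d d0 h] := loc x xab; exists d => // y z ay yz zb yd zd.
rewrite (h y) ?(h z) //= -?ball_normE /= 1?distrC ?zb ?ay ?andbT //.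
  exact: le_trans yz.
exact: le_trans zb.
Qed.

End Cousin.

Lemma differentiable_qmul (R : realType) (V : normedModType R) (F G : V -> quat R) x :
  differentiable F x -> differentiable G x -> differentiable (fun y => qmul (F y) (G y)) x.
Proof.
move=> dF dG; have f i := differentiable_comp_coord i dF; have g i := differentiable_comp_coord i dG.
have fg i j : differentiable (fun y => F y 0 i * G y 0 j) x by exact: (differentiableM (f i) (g j)).
have nfg i j : differentiable (fun y => - (F y 0 i * G y 0 j)) x by exact: (differentiableN (fg i j)).
have add4 (a b c d : V -> R) : differentiable a x -> differentiable b x -> differentiable c x ->
    differentiable d x -> differentiable (fun y => a y + b y + c y + d y) x.
  by move=> ha hb hc hd; exact: (differentiableD (differentiableD (differentiableD ha hb) hc) hd).
have E i g' : (forall y, qmul (F y) (G y) 0 i = g' y) -> differentiable g' x ->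
    differentiable (fun y => qmul (F y) (G y) 0 i) x by move=> /funext ->.
by apply: differentiable_quat; apply: ord4P;
  (eapply E; [by move=> y; rewrite /qmul /mkquat mxE /=; reflexivity|
   apply: add4; (exact: fg || exact: nfg)]).
Qed.

Lemma ratio_derivative_algebra (R : realType) (x y W : quat R) : qre W = 0 ->
  qmul (qmul x W) (qconj y) + qmul x (qconj (qmul y W)) = 0.
Proof.
move=> W0; have Wc : qconj W = - W by apply: quatP; quat_simp; rewrite ?W0 ?oppr0.
by rewrite qconjM Wc qmulNl qmulNr qmulA subrr.
Qed.

Section Germs.
Context {R : realType} (U : set (R * R)) (A B : R * R -> quat R).
Context (im : forall z, U z -> qre (A z) = 0 /\ qre (B z) = 0).
Implicit Types (Q : R * R -> quat R) (z : R * R).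

(** Membership in U is part of the germ, so that what is assumed of A and B on U is
    available near z. *)
Definition flat_germ Q z := \forall y \near z, U y /\ flat_solution A B Q y.

Lemma flat_solution_derive Q z v : flat_solution A B Q z ->
  is_derive z v Q (qmul (Q z) (v.1 *: A z + v.2 *: B z)).
Proof.
move=> [[_ du] [_ dv] dQ _].
split; first exact: diff_derivable.
by rewrite derive_plane // du dv qmulDr !qmulZr.
Qed.

(** The product of Q' and the conjugate of Q has zero derivative, A and B being
    imaginary. *)
Lemma flat_germ_ratio Q Q' z : flat_germ Q z -> flat_germ Q' z ->
  \forall y \near z, Q' y = qmul (qmul (Q' z) (qconj (Q z))) (Q y).
Proof.
move=> gQ gQ'.
have : \forall y \near z, qmul (Q' y) (qconj (Q y)) = qmul (Q' z) (qconj (Q z)).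
  apply: derive0_locally_constant.
  apply: filterS2 gQ gQ' => y [Uy sQ] [_ sQ'] v.
  have dQ := flat_solution_derive v sQ; have dQ' := flat_solution_derive v sQ'.
  apply: (is_derive_eq (is_derive_qmul dQ' (is_derive_qconj dQ))).
  have [a0 b0] := im Uy.
  apply: ratio_derivative_algebra.
  by rewrite !qcoordE a0 b0 !mulr0 addr0.
apply: filterS2 gQ => y [_ [_ _ _ y1]] <-.
by rewrite -qmulA qmulVq y1 scale1r qmul1r.
Qed.

Lemma flat_germ_eq Q Q' z : flat_germ Q z -> flat_germ Q' z -> Q z = Q' z ->
  \forall y \near z, Q' y = Q y.
Proof.
move=> gQ gQ' e; apply: filterS (flat_germ_ratio gQ gQ') => y ->.
have [_ [_ _ _ z1]] := nbhs_singleton gQ.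
by rewrite -e qmulqV z1 scale1r qmul1l.
Qed.

Lemma flat_solution_mull c Q z : qdot c c = 1 -> flat_solution A B Q z ->
  flat_solution A B (fun y => qmul c (Q y)) z.
Proof.
move=> c1 [du dv dQ Q1]; split.
- apply: (is_derive_eq (is_derive_qmul (is_derive_cst c z e_u) du)).
  by rewrite qmul0l add0r qmulA.
- apply: (is_derive_eq (is_derive_qmul (is_derive_cst c z e_v) dv)).
  by rewrite qmul0l add0r qmulA.
- by apply: differentiable_qmul; [exact: differentiable_cst|exact: dQ].
- by rewrite qdotM c1 Q1 mulr1.
Qed.

Lemma flat_germ_mull c Q z : qdot c c = 1 -> flat_germ Q z ->
  flat_germ (fun y => qmul c (Q y)) z.
Proof.
by move=> c1; apply: filterS => y [Uy sQ]; split => //; exact: flat_solution_mull.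
Qed.

Lemma flat_germ_near Q z : flat_germ Q z -> \forall y \near z, flat_germ Q y.
Proof. by move=> gQ; rewrite /flat_germ; apply: near_join; exact: gQ. Qed.

End Germs.

(** * Lifting maps to a flat system *)

Section Lifts.
Context {R : realType} (U : set (R * R)) (A B : R * R -> quat R).
Context (im : forall z, U z -> qre (A z) = 0 /\ qre (B z) = 0).
Implicit Types (Q : R * R -> quat R) (z : R * R).
Local Notation germ := (flat_germ U A B).

(** Continuity of the restriction of H to K, in the pointwise form that combines
    with flat_lift. *)
Definition continuous_on (X Y : topologicalType) (K : set X) (H : X -> Y) :=
  forall x, K x -> forall N, nbhs (H x) N -> \forall y \near x, K y -> N (H y).

(** G is a lift of H if it is locally the composition of H with a local solution.
    This makes sense for maps H that are merely continuous, which is all that a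
    homotopy provides. *)
Definition flat_lift (X : topologicalType) (K : set X) (H : X -> R * R) (G : X -> quat R) :=
  forall x, K x -> exists2 Q, germ Q (H x) & \forall y \near x, K y -> G y = Q (H y).

Lemma within_continuous_on (X Y : topologicalType) (K : set X) (H : X -> Y) :
  {within K, continuous H} -> continuous_on K H.
Proof. by move=> /subspace_continuousP h x Kx N; exact: h. Qed.

Lemma continuous_on_sub (X Y : topologicalType) (K K' : set X) (H : X -> Y) :
  K `<=` K' -> continuous_on K' H -> continuous_on K H.
Proof.
move=> KK' h x Kx N nN; apply: filterS (h x (KK' _ Kx) N nN) => y hy Ky.
exact: hy (KK' _ Ky).
Qed.

Lemma continuous_on_comp (X X' Y : topologicalType) (K : set X) (K' : set X')
    (H : X -> Y) (f : X' -> X) :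
  continuous f -> (forall x, K' x -> K (f x)) -> continuous_on K H -> continuous_on K' (H \o f).
Proof.
move=> cf fK h x K'x N nN; have n : \forall y \near x, K (f y) -> N (H (f y)) := cf x _ (h _ (fK _ K'x) N nN).
by apply: filterS n => y hy K'y; exact: hy (fK _ K'y).
Qed.

Lemma flat_lift_comp (X X' : topologicalType) (K : set X) (K' : set X') H G (f : X' -> X) :
  continuous f -> (forall x, K' x -> K (f x)) -> flat_lift K H G ->
  flat_lift K' (H \o f) (G \o f).
Proof.
move=> cf fK h x K'x; have [Q gQ hQ] := h _ (fK _ K'x); exists Q => //.
have n : \forall y \near x, K (f y) -> G (f y) = Q (H (f y)) := cf x _ hQ.
by apply: filterS n => y hy K'y; exact: hy (fK _ K'y).
Qed.

Lemma flat_lift_unit (X : topologicalType) (K : set X) H G x :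
  flat_lift K H G -> K x -> qdot (G x) (G x) = 1.
Proof.
move=> h Kx; have [Q gQ /nbhs_singleton hQ] := h x Kx.
rewrite hQ //.
by have [_ []] := nbhs_singleton gQ.
Qed.

Lemma flat_lift_mull (X : topologicalType) (K : set X) H G c :
  qdot c c = 1 -> flat_lift K H G -> flat_lift K H (fun x => qmul c (G x)).
Proof.
move=> c1 h x Kx; have [Q gQ hQ] := h x Kx; exists (fun z => qmul c (Q z)).
  exact: flat_germ_mull.
by apply: filterS hQ => y hy Ky; rewrite hy.
Qed.

(** Constancy of the ratio of two local solutions pulls back along H. *)
Lemma flat_lift_ratio (X : topologicalType) (K : set X) H G G' x :
  continuous_on K H -> flat_lift K H G -> flat_lift K H G' -> K x ->
  \forall y \near x, K y -> qmul (G' y) (qconj (G y)) = qmul (G' x) (qconj (G x)).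
Proof.
move=> cH hG hG' Kx; have [Q gQ hQ] := hG x Kx; have [Q' gQ' hQ'] := hG' x Kx.
have eQ := nbhs_singleton hQ Kx; have eQ' := nbhs_singleton hQ' Kx.
have nH := cH x Kx _ (flat_germ_ratio im gQ gQ').
have n1 := cH x Kx _ gQ.
apply: filterS2 (filterI hQ hQ') (filterI nH n1) => y [h1 h2] [h3 h4] Ky.
have [_ [_ _ _ y1]] := h4 Ky.
by rewrite h1 // h2 // h3 // eQ eQ' -[LHS]qmulA qmulqV y1 scale1r qmul1r.
Qed.

(** At a point of both pieces, the two local solutions agree at the image of the
    point, hence near it, so either of them represents the glued lift. *)
Lemma flat_lift_glue (X : topologicalType) (K1 K2 : set X) H G1 G2 :
  closed K1 -> closed K2 -> continuous_on (K1 `|` K2) H ->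
  flat_lift K1 H G1 -> flat_lift K2 H G2 ->
  (forall x, K1 x -> K2 x -> G1 x = G2 x) ->
  exists G, [/\ flat_lift (K1 `|` K2) H G, (forall x, K1 x -> G x = G1 x) &
    (forall x, K2 x -> G x = G2 x)].
Proof.
move=> cl1 cl2 cH h1 h2 e12.
pose G x := if x \in K1 then G1 x else G2 x.
have GE1 x : K1 x -> G x = G1 x by move=> K1x; rewrite /G mem_set.
have GE2 x : K2 x -> G x = G2 x.
  rewrite /G; case: ifPn => //; rewrite inE => K1x K2x; exact: e12.
exists G; split => // x K12x.
have out (K : set X) : closed K -> ~ K x -> \forall y \near x, ~ K y.
  by move=> cK nK; apply: open_nbhs_nbhs; split => //; exact: closed_openC.
have [K1x|nK1] := pselect (K1 x); have [K2x|nK2] := pselect (K2 x).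
- have [Q1 gQ1 hQ1] := h1 x K1x; have [Q2 gQ2 hQ2] := h2 x K2x.
  have eQ : Q1 (H x) = Q2 (H x).
    by rewrite -(nbhs_singleton hQ1) // -(nbhs_singleton hQ2) // e12.
  exists Q1 => //.
  have nH := cH x K12x _ (flat_germ_eq im gQ1 gQ2 eQ).
  apply: filterS2 (filterI hQ1 hQ2) nH => y [hy1 hy2] hy K12y.
  case: (K12y) => Ky; first by rewrite GE1 // hy1.
  by rewrite GE2 // hy2 // hy.
- have [Q1 gQ1 hQ1] := h1 x K1x; exists Q1 => //.
  by apply: filterS2 hQ1 (out K2 cl2 nK2) => y hy ny [Ky|//]; rewrite GE1 // hy.
- have [Q2 gQ2 hQ2] := h2 x K2x; exists Q2 => //.
  by apply: filterS2 hQ2 (out K1 cl1 nK1) => y hy ny [//|Ky]; rewrite GE2 // hy.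
- by case: K12x.
Qed.

Lemma flat_lift_segment_ratio (X : topologicalType) (K : set X) H G G' (g : R -> X) a b :
  a <= b -> continuous g -> (forall t, a <= t <= b -> K (g t)) ->
  continuous_on K H -> flat_lift K H G -> flat_lift K H G' ->
  qmul (G' (g a)) (qconj (G (g a))) = qmul (G' (g b)) (qconj (G (g b))).
Proof.
move=> ab cg gK cH hG hG'.
apply: (locally_constant_segment (f := fun t => qmul (G' (g t)) (qconj (G (g t)))) ab) => t tab.
have n : \forall s \near t, K (g s) ->
    qmul (G' (g s)) (qconj (G (g s))) = qmul (G' (g t)) (qconj (G (g t))) :=
  cg t _ (flat_lift_ratio cH hG hG' (gK _ tab)).
by apply: filterS n => s hs sab; exact: hs (gK _ sab).
Qed.

Definition liftable (X : topologicalType) (K : set X) (H : X -> R * R) :=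
  exists G, flat_lift K H G.

Lemma flat_lift_sub (X : topologicalType) (K K' : set X) H G :
  K `<=` K' -> flat_lift K' H G -> flat_lift K H G.
Proof.
move=> KK' h x Kx; have [Q gQ hQ] := h x (KK' _ Kx); exists Q => //.
by apply: filterS hQ => y hy Ky; exact: hy (KK' _ Ky).
Qed.

(** Over the common segment the two lifts have a constant ratio; left
    multiplication by it makes the second lift agree with the first. *)
Lemma liftable_glue (X : topologicalType) (K1 K2 : set X) H (g : R -> X) a b :
  a <= b -> closed K1 -> closed K2 -> continuous g ->
  (forall t, a <= t <= b -> K1 (g t) /\ K2 (g t)) ->
  (forall x, K1 x -> K2 x -> exists2 t, a <= t <= b & g t = x) ->
  continuous_on (K1 `|` K2) H -> liftable K1 H -> liftable K2 H -> liftable (K1 `|` K2) H.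
Proof.
move=> ab cl1 cl2 cg gK Kg cH [G1 h1] [G2 h2].
have aab : a <= a <= b by rewrite lexx.
have [K1a K2a] := gK _ aab.
pose k := qmul (G1 (g a)) (qconj (G2 (g a))).
have k1 : qdot k k = 1.
  by rewrite qdotM qdot_conj (flat_lift_unit h1) // (flat_lift_unit h2) // mulr1.
have [//|G [hG _ _]] := flat_lift_glue cl1 cl2 cH h1 (flat_lift_mull k1 h2); last by exists G.
move=> x K1x K2x; have [t /andP[at_ tb] <-] := Kg x K1x K2x.
have -> : k = qmul (G1 (g t)) (qconj (G2 (g t))).
  apply: (@flat_lift_segment_ratio _ (K1 `&` K2) H G2 G1 g a t at_ cg).
  - by move=> s /andP[as_ st]; apply: gK; rewrite as_ (le_trans st).
  - by apply: continuous_on_sub cH => y [? _]; left.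
  - by apply: flat_lift_sub h2 => y [].
  - by apply: flat_lift_sub h1 => y [].
have [|_ K2t] := gK t; first by rewrite at_ tb.
by rewrite -qmulA qmulVq (flat_lift_unit h2) ?scale1r ?qmul1r.
Qed.

Definition rectangle (a b c d : R) : set (R * R) :=
  [set x | a <= x.1 <= b /\ c <= x.2 <= d].

Lemma closed_rectangle a b c d : closed (rectangle a b c d).
Proof.
have -> : rectangle a b c d = (fst @^-1` `[a, b]) `&` (snd @^-1` `[c, d]).
  by apply/seteqP; split=> x []; rewrite /= !in_itv.
have pre (f : R * R -> R) x y : continuous f -> closed (f @^-1` `[x, y]).
  by move=> /continuous_closedP h; apply: h; exact: interval_closed.
by apply: closedI; apply: pre => x; [exact: cvg_fst|exact: cvg_snd].
Qed.

(** Small rectangles map into the domain of one local solution, and lifts glue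
    along common edges. Cousin's lemma is applied to horizontal strips of
    unspecified small height around each ordinate, then to the ordinate. *)
Lemma liftable_unit_square (H : R * R -> R * R) (hex : forall z, U z -> exists Q, germ Q z) :
  continuous_on (rectangle 0 1 0 1) H -> (forall x, rectangle 0 1 0 1 x -> U (H x)) ->
  liftable (rectangle 0 1 0 1) H.
Proof.
move=> cH HU.
have sub a b c d : 0 <= a -> b <= 1 -> 0 <= c -> d <= 1 ->
    rectangle a b c d `<=` rectangle 0 1 0 1.
  move=> a0 b1 c0 d1 x [/andP[? ?] /andP[? ?]]; split; apply/andP; split.
  - exact: le_trans a0 _. - exact: le_trans b1.
  - exact: le_trans c0 _. - exact: le_trans d1.
have horizontal a b e c d : 0 <= a -> a <= b -> b <= e -> e <= 1 -> 0 <= c -> c <= d -> d <= 1 ->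
    liftable (rectangle a b c d) H -> liftable (rectangle b e c d) H ->
    liftable (rectangle a e c d) H.
  move=> a0 ab be e1 c0 cd d1 h1 h2.
  have E : rectangle a e c d = rectangle a b c d `|` rectangle b e c d.
    apply/seteqP; split=> [x [/andP[ax xe] ?]|x [[/andP[ax xb] ?]|[/andP[bx xe] ?]]].
    - by case: (leP x.1 b) => xb; [left|right]; split => //; apply/andP; split => //; exact: ltW.
    - by split => //; rewrite ax (le_trans xb).
    - by split => //; rewrite xe andbT (le_trans ab).
  rewrite E; apply: (@liftable_glue _ _ _ H (fun t => (b, t)) c d cd) => //.
  - exact: closed_rectangle.
  - exact: closed_rectangle.
  - by move=> t; exact: (cvg_pair (cvg_cst b) (@cvg_id _ _)).
  - by move=> t tcd; split; split => //=; rewrite ?ab ?be lexx.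
  - move=> [x1 x2] [/= /andP[_ xb] x2cd] [/= /andP[bx _] _]; exists x2 => //.
    by congr pair; apply/le_anti; rewrite bx.
  - by rewrite -E; apply: continuous_on_sub cH; apply: sub.
have vertical a b c d e : 0 <= a -> a <= b -> b <= 1 -> 0 <= c -> c <= d -> d <= e -> e <= 1 ->
    liftable (rectangle a b c d) H -> liftable (rectangle a b d e) H ->
    liftable (rectangle a b c e) H.
  move=> a0 ab b1 c0 cd de e1 h1 h2.
  have E : rectangle a b c e = rectangle a b c d `|` rectangle a b d e.
    apply/seteqP; split=> [x [? /andP[cx xe]]|x [[? /andP[cx xd]]|[? /andP[dx xe]]]].
    - by case: (leP x.2 d) => xd; [left|right]; split => //; apply/andP; split => //; exact: ltW.
    - by split => //; rewrite cx (le_trans xd).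
    - by split => //; rewrite xe andbT (le_trans cd).
  rewrite E; apply: (@liftable_glue _ _ _ H (fun t => (t, d)) a b ab) => //.
  - exact: closed_rectangle.
  - exact: closed_rectangle.
  - by move=> t; exact: (cvg_pair (@cvg_id _ _) (cvg_cst d)).
  - by move=> t tab; split; split => //=; rewrite ?cd ?de lexx.
  - move=> [x1 x2] [/= x1ab /andP[_ xd]] [/= _ /andP[dx _]]; exists x1 => //.
    by congr pair; apply/le_anti; rewrite dx xd.
  - by rewrite -E; apply: continuous_on_sub cH; apply: sub.
(* One local solution serves all rectangles near (s, t). *)
have loc s t : 0 <= s <= 1 -> 0 <= t <= 1 -> exists2 r, 0 < r &
    forall a b c d, 0 <= a -> b <= 1 -> 0 <= c -> d <= 1 -> `|a - s| < r -> `|b - s| < r ->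
      `|c - t| < r -> `|d - t| < r -> liftable (rectangle a b c d) H.
  move=> s01 t01; have Kst : rectangle 0 1 0 1 (s, t) by [].
  have [Q gQ] := hex _ (HU _ Kst).
  have /near_planeP[r r0 hr] := cH _ Kst _ (flat_germ_near gQ).
  exists r => // a b c d a0 b1 c0 d1 ar br cr dr; exists (Q \o H) => -[x y] Kxy.
  exists Q; last by apply: filterE.
  apply: hr; last exact: (sub a b c d).
    apply: (between_radius2 ar br); case: Kxy => /andP[/= h1 h2] _.
    by rewrite ge_min h1 le_max h2 orbT.
  apply: (between_radius2 cr dr); case: Kxy => _ /andP[/= h1 h2].
  by rewrite ge_min h1 le_max h2 orbT.
(* Additivity in the abscissa takes the minimum of two heights. *)
have strip t : 0 <= t <= 1 -> exists2 r, 0 < r & forall c d, 0 <= c -> c <= d -> d <= 1 ->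
    `|c - t| < r -> `|d - t| < r -> liftable (rectangle 0 1 c d) H.
  move=> t01.
  apply: (@cousin _ (fun a b => exists2 r, 0 < r & forall c d, 0 <= c -> c <= d -> d <= 1 ->
    `|c - t| < r -> `|d - t| < r -> liftable (rectangle a b c d) H) 0 1 ler01).
  - move=> a b e a0 ab be e1 [r r0 h] [r' r'0 h'].
    exists (Num.min r r'); first by rewrite lt_min r0.
    move=> c d c0 cd d1; rewrite !lt_min => /andP[cr cr'] /andP[dr dr'].
    by apply: (horizontal a b e) => //; [exact: h|exact: h'].
  - move=> s s01; have [r r0 h] := loc s t s01 t01; exists r => // a b a0 ab b1 ar br.
    by exists r => // c d c0 cd d1 cr dr; exact: h.
apply: (@cousin _ (fun c d => liftable (rectangle 0 1 c d) H) 0 1 ler01).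
- move=> c d e c0 cd de e1; exact: vertical.
- by move=> t t01; have [r r0 h] := strip t t01; exists r => // c d c0 cd d1 cr dr; exact: h.
Qed.

End Lifts.

(** * Monodromy and global solutions *)

Section Continuation.
Context {R : realType} (U : set (R * R)) (A B : R * R -> quat R).
Context (im : forall z, U z -> qre (A z) = 0 /\ qre (B z) = 0).
Implicit Types (Q : R * R -> quat R) (z : R * R).
Local Notation germ := (flat_germ U A B).
Local Notation I01 := [set s : R | 0 <= s <= 1].

(** The value a at z is carried to a' at z' by the lift of some path. *)
Definition continuation z a z' a' :=
  exists (gamma : R -> R * R) (g : R -> quat R),
    [/\ continuous_on I01 gamma, (forall s, I01 s -> U (gamma s)),
        flat_lift U A B I01 gamma g, gamma 0 = z /\ g 0 = a & gamma 1 = z' /\ g 1 = a'].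

Lemma continuous_affine (a b : R) : continuous (fun s : R => a + s * b).
Proof.
move=> x; apply: cvgD; first exact: cvg_cst.
by apply: cvgM; [exact: cvg_id|exact: cvg_cst].
Qed.

Lemma continuation_sym z a z' a' : continuation z a z' a' -> continuation z' a' z a.
Proof.
move=> [gamma [g [c1 gU h [<- <-] [<- <-]]]].
have ca := @continuous_affine 1 (-1).
have ca01 x : I01 x -> I01 (1 + x * -1) by move=> /= /andP[? ?]; apply/andP; split; lra.
exists (gamma \o (fun s => 1 + s * -1)), (g \o (fun s => 1 + s * -1)); split => /=.
- exact: continuous_on_comp ca ca01 c1.
- by move=> s s01; apply: gU; exact: ca01.
- exact: flat_lift_comp ca ca01 h.
- by rewrite mul0r addr0.
- by rewrite mul1r subrr.
Qed.

Lemma closed_segment (a b : R) : closed [set s : R | a <= s <= b].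
Proof.
have -> : [set s : R | a <= s <= b] = [set` `[a, b]] by apply/seteqP; split=> x; rewrite /= in_itv.
exact: interval_closed.
Qed.

Lemma continuous_on_glue (X Y : topologicalType) (K1 K2 : set X) (H : X -> Y) :
  closed K1 -> closed K2 -> continuous_on K1 H -> continuous_on K2 H ->
  continuous_on (K1 `|` K2) H.
Proof.
move=> cl1 cl2 h1 h2 x K12x N nN.
have loc (K : set X) : closed K -> continuous_on K H -> \forall y \near x, K y -> N (H y).
  move=> cK cH; have [Kx|nK] := pselect (K x); first exact: cH.
  have : \forall y \near x, ~ K y by apply: open_nbhs_nbhs; split => //; exact: closed_openC.
  by apply: filterS => y nKy /nKy.
apply: filterS2 (loc K1 cl1 h1) (loc K2 cl2 h2) => y hy1 hy2 [Ky|Ky]; [exact: hy1|exact: hy2].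
Qed.

Lemma eq_continuous_on (X Y : topologicalType) (K : set X) (H H' : X -> Y) :
  (forall x, K x -> H x = H' x) -> continuous_on K H -> continuous_on K H'.
Proof.
move=> e c x Kx N; rewrite -e // => nN; apply: filterS (c x Kx N nN) => y hy Ky.
by rewrite -e //; exact: hy.
Qed.

Lemma eq_flat_lift (X : topologicalType) (K : set X) (H H' : X -> R * R) G :
  (forall x, K x -> H x = H' x) -> flat_lift U A B K H G -> flat_lift U A B K H' G.
Proof.
move=> e h x Kx; have [Q gQ hQ] := h x Kx; exists Q; first by rewrite -e.
by apply: filterS hQ => y hy Ky; rewrite -e //; exact: hy.
Qed.

Lemma continuation_trans z a z' a' z'' a'' :
  continuation z a z' a' -> continuation z' a' z'' a'' -> continuation z a z'' a''.
Proof.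
move=> [gam1 [g1 [c1 gU1 h1 [e1 f1] [e1' f1']]]] [gam2 [g2 [c2 gU2 h2 [e2 f2] [e2' f2']]]].
pose h : R := 2^-1.
have h2E : h * 2 = 1 by rewrite mulVf // pnatr_eq0.
pose K1 := [set s : R | 0 <= s <= h]; pose K2 := [set s : R | h <= s <= 1].
have m0 : -1 + 1 = 0 :> R by rewrite addrC subrr.
have hh : h = 1 / 2 by rewrite div1r.
have h0 : 0 <= h by lra.
have h1' : h <= 1 by lra.
have E : I01 = K1 `|` K2.
  apply/seteqP; split=> s /=.
    by case: (leP s h) => sh /andP[s0 s1]; [left|right]; rewrite /K1 /K2 /= ?s0 ?s1 ?sh // ltW.
  by move=> [|] /andP[? ?]; apply/andP; split; lra.
pose gam s := if s <= h then gam1 (0 + s * 2) else gam2 (-1 + s * 2).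
have gE1 s : K1 s -> gam s = gam1 (0 + s * 2) by move=> /andP[_ sh]; rewrite /gam sh.
have gE2 s : K2 s -> gam s = gam2 (-1 + s * 2).
  move=> /andP[hs _]; rewrite /gam; case: ifPn => // sh.
  have -> : s = h by apply/le_anti; rewrite sh.
  by rewrite h2E m0 add0r e1' e2.
have k1 s : K1 s -> I01 (0 + s * 2) by move=> /= /andP[? ?]; apply/andP; split; lra.
have k2 s : K2 s -> I01 (-1 + s * 2) by move=> /= /andP[? ?]; apply/andP; split; lra.
have ca1 := @continuous_affine 0 2; have ca2 := @continuous_affine (-1) 2.
have cg1 : continuous_on K1 gam.
  apply: eq_continuous_on (continuous_on_comp ca1 k1 c1) => s Ks; by rewrite gE1.
have cg2 : continuous_on K2 gam.
  apply: eq_continuous_on (continuous_on_comp ca2 k2 c2) => s Ks; by rewrite gE2.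
have cl1 : closed K1 by exact: closed_segment.
have cl2 : closed K2 by exact: closed_segment.
have l1 : flat_lift U A B K1 gam (g1 \o (fun s => 0 + s * 2)).
  apply: eq_flat_lift (flat_lift_comp ca1 k1 h1) => s Ks; by rewrite gE1.
have l2 : flat_lift U A B K2 gam (g2 \o (fun s => -1 + s * 2)).
  apply: eq_flat_lift (flat_lift_comp ca2 k2 h2) => s Ks; by rewrite gE2.
have cg := continuous_on_glue cl1 cl2 cg1 cg2.
have [|G [hG GE1 GE2]] := flat_lift_glue im cl1 cl2 cg l1 l2.
  move=> s /andP[_ sh] /andP[hs _].
  have -> : s = h by apply/le_anti; rewrite sh.
  by rewrite /= h2E m0 add0r f1' f2.
have K10 : K1 0 by rewrite /K1 /= lexx.
have K21 : K2 1 by rewrite /K2 /= h1' lexx.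
exists gam, G; rewrite E; split => //.
- by move=> s [Ks|Ks]; [rewrite gE1 //; apply: gU1; exact: k1|rewrite gE2 //; apply: gU2; exact: k2].
- by rewrite gE1 // GE1 //= mul0r addr0.
- by rewrite gE2 // GE2 //= mul1r (_ : -1 + 2 = 1 :> R) //; ring.
Qed.

Lemma continuation_mull c z a z' a' : qdot c c = 1 ->
  continuation z a z' a' -> continuation z (qmul c a) z' (qmul c a').
Proof.
move=> c1 [gam [g [h1 h2 h3 [e1 e2] [e3 e4]]]]; exists gam, (fun s => qmul c (g s)).
by split => //; [exact: flat_lift_mull|rewrite e2|rewrite e4].
Qed.

(** Balls are convex, so a segment serves as path. *)
Lemma continuation_ball Q z r z' : (forall y, ball z r y -> U y /\ flat_solution A B Q y) ->
  ball z r z' -> continuation z (Q z) z' (Q z').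
Proof.
move=> h zz'; pose gam (s : R) : R * R := (z.1 + s * (z'.1 - z.1), z.2 + s * (z'.2 - z.2)).
have cg : continuous gam.
  have c1 := @continuous_affine z.1 (z'.1 - z.1); have c2 := @continuous_affine z.2 (z'.2 - z.2).
  by move=> s; exact: (cvg_pair (c1 s) (c2 s)).
have gb s : I01 s -> ball z r (gam s).
  move=> /andP[s0 s1]; case: zz' => /= b1 b2.
  rewrite -ball_normE /= in b1; rewrite -ball_normE /= in b2.
  have k (x y : R) : `|x - y| < r -> `|x - (x + s * (y - x))| < r.
    move=> xy; have -> : x - (x + s * (y - x)) = s * (x - y) by ring.
    rewrite normrM ger0_norm //; apply: le_lt_trans xy; by rewrite ler_piMl.
  by split => /=; rewrite -ball_normE /=; exact: k.
have gb' s : I01 s -> germ Q (gam s).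
  move=> /gb Hs; apply: filterS h _; apply: open_nbhs_nbhs; split => //.
  exact: ball_open.
exists gam, (Q \o gam); split.
- move=> s _ N nN; have n : \forall y \near s, N (gam y) := cg s N nN.
  by apply: filterS n => y Ny _.
- by move=> s /gb /h [].
- by move=> s s01; exists Q; [exact: gb'|apply: filterE].
- by rewrite /= /gam !mul0r !addr0; case: (z).
- by rewrite /= /gam !mul1r !(addrC _ (_ - _)) !subrK; case: (z').
Qed.

Context (Usc : simply_connected (R := R) U).
Context (hex : forall z, U z -> exists Q, germ Q z).

(** Lift the contracting homotopy of the loop to the square. The lift is constant
    on the three edges that are sent to the base point, so its values at the ends of
    the remaining edge coincide; that edge carries a lift of the loop, which differs
    from the given one by a constant left factor. *)
Lemma monodromy z a b : continuation z a z b -> a = b.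
Proof.
move=> [gam [g [c gU h [e1 e2] [e3 e4]]]].
have w : {within `[0, 1], continuous gam}.
  apply/subspace_continuousP => s; rewrite /= in_itv => s01 N nN.
  by apply: filterS (c s s01 N nN) => y hy; rewrite /= in_itv; exact: hy.
have gU' s : s \in `[0, 1] -> U (gam s) by rewrite in_itv => s01; exact: gU.
have g01 : gam 0 = gam 1 by rewrite e1 e3.
have [H [cH HU H0 H1 Hs]] := Usc w gU' g01.
have RE : rectangle 0 1 0 1 = `[0, 1] `*` `[0, 1] :> set (R * R).
  by apply/seteqP; split=> x []; rewrite /= !in_itv.
have cH' : continuous_on (rectangle 0 1 0 1) H.
  by rewrite RE; exact: within_continuous_on.
have HU' x : rectangle 0 1 0 1 x -> U (H x).
  by case: x => s t [/= s01 t01]; apply: HU; rewrite in_itv.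
have [G hG] := liftable_unit_square im hex cH' HU'.
have [i0 i1] : (0 <= 0 :> R) /\ (0 <= 1 :> R) by split.
have edge (f : R -> R * R) : continuous f -> (forall t, 0 <= t <= 1 -> rectangle 0 1 0 1 (f t)) ->
    (forall t, 0 <= t <= 1 -> H (f t) = gam 0) -> G (f 0) = G (f 1).
  move=> cf fK fc; apply: (locally_constant_segment (f := G \o f) ler01) => t t01.
  have [Q gQ hQ] := hG _ (fK _ t01).
  have n : \forall s \near t, rectangle 0 1 0 1 (f s) -> G (f s) = Q (H (f s)) := cf t _ hQ.
  apply: filterS n => s hs s01; rewrite /= (hs (fK _ s01)) (nbhs_singleton hQ) ?fc //; exact: fK.
have left_edge : G (0, 0) = G (0, 1).
  apply: (edge (fun t => (0, t))) => [t|t t01|t t01].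
  - exact: (cvg_pair (cvg_cst 0) (@cvg_id _ _)).
  - by split; rewrite //= lexx ler01.
  - by case: (Hs t); rewrite ?in_itv.
have right_edge : G (1, 0) = G (1, 1).
  apply: (edge (fun t => (1, t))) => [t|t t01|t t01].
  - exact: (cvg_pair (cvg_cst (1 : R)) (@cvg_id _ _)).
  - by split; rewrite //= lexx ler01.
  - by case: (Hs t); rewrite ?in_itv.
have top_edge : G (0, 1) = G (1, 1).
  apply: (edge (fun t => (t, 1))) => [t|t t01|t t01].
  - exact: (cvg_pair (@cvg_id _ _) (cvg_cst (1 : R))).
  - by split; rewrite //= lexx ler01.
  - by rewrite H1 // in_itv.
have bottom (t : R) : 0 <= t <= 1 -> rectangle 0 1 0 1 (t, 0 : R).
  by move=> t01; split; rewrite //= lexx ler01.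
have cb : continuous (fun t : R => (t, 0 : R)).
  by move=> t; exact: (cvg_pair (@cvg_id _ _) (cvg_cst 0)).
have hG0 : flat_lift U A B I01 gam (G \o (fun t => (t, 0))).
  apply: eq_flat_lift (flat_lift_comp cb bottom hG) => t t01 /=.
  by rewrite H0 // in_itv.
have cid : continuous (fun t : R => t) by move=> t; exact: cvg_id.
have E := flat_lift_segment_ratio im ler01 cid
  (fun t (t01 : 0 <= t <= 1) => t01) c hG0 h.
move: E; rewrite /= left_edge top_edge -right_edge e2 e4 => E.
have G1 : qdot (G (1, 0)) (G (1, 0)) = 1.
  by apply: (flat_lift_unit hG); apply: bottom; rewrite lexx ler01.
have : qmul (qmul a (qconj (G (1, 0)))) (G (1, 0)) = qmul (qmul b (qconj (G (1, 0)))) (G (1, 0)).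
  by rewrite E.
by rewrite -!qmulA qmulVq G1 scale1r !qmul1r.
Qed.

Context (U_connected : connected U).

(** Values are obtained by continuation from a base point. The set of points
    reached by continuation is open, and so is its complement in U, because a ball that
    carries a local solution is reached entirely or not at all. *)
Lemma global_flat_solution : exists Q, forall z, U z -> flat_solution A B Q z.
Proof.
have [[z0 Uz0]|nU] := pselect (exists z, U z); last first.
  by exists (fun=> 0) => z Uz; exfalso; apply: nU; exists z.
have loc z : U z -> exists Q r, [/\ 0 < r, qdot (Q z) (Q z) = 1 &
    forall y, ball z r y -> U y /\ flat_solution A B Q y].
  move=> Uz; have [Q gQ] := hex Uz.
  have /nbhs_ballP[r r0 h] := gQ; exists Q, r; split => //.
  by have [_ []] := nbhs_singleton gQ.
pose S := [set z | U z /\ exists a, continuation z0 quat1 z a].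
(* A ball carrying a local solution is reached from any one of its points. *)
have spread z Q r y b : (forall y, ball z r y -> U y /\ flat_solution A B Q y) ->
    0 < r -> ball z r y -> continuation z0 quat1 y b -> qdot b b = 1 ->
    forall y', ball z r y' ->
      continuation z0 quat1 y' (qmul (qmul b (qconj (Q y))) (Q y')).
  move=> h r0 zy cy b1 y' zy'; set c := qmul b _.
  have [_ [_ _ _ Qy1]] := h y zy.
  have c1 : qdot c c = 1 by rewrite qdotM qdot_conj b1 Qy1 mulr1.
  have ey : b = qmul c (Q y) by rewrite -qmulA qmulVq Qy1 scale1r qmul1r.
  rewrite ey in cy; apply: continuation_trans cy _.
  apply: continuation_trans (continuation_mull c1 (continuation_ball h zy')).
  apply: continuation_sym; apply: continuation_mull c1 _.
  exact: (continuation_ball h zy).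
have unit_end y b : continuation z0 quat1 y b -> qdot b b = 1.
  move=> [gam [g [_ _ h _ [_ <-]]]]; apply: (flat_lift_unit h) => /=.
  by rewrite ler01 lexx.
have SU : S = U.
  apply: U_connected.
  - exists z0; split => //; exists quat1.
    have [Q [r [r0 Q1 h]]] := loc z0 Uz0.
    have -> : quat1 = qmul (qconj (Q z0)) (Q z0) by rewrite qmulVq Q1 scale1r.
    apply: continuation_mull; first by rewrite qdot_conj.
    by apply: (continuation_ball h); exact: ballxx.
  - exists S; last by apply/seteqP; split=> z [].
    rewrite openE => z [Uz [a ca]].
    have [Q [r [r0 Q1 h]]] := loc z Uz.
    apply/nbhs_ballP; exists r => // y zy; split; first by case: (h y zy).
    by eexists; apply: (spread z Q r z a h r0 (ballxx _ r0) ca (unit_end _ _ ca)).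
  - exists (~` (U `&` ~` S)).
      apply: open_closedC; rewrite openE => z [Uz nSz].
      have [Q [r [r0 Q1 h]]] := loc z Uz.
      apply/nbhs_ballP; exists r => // y zy; split; first by case: (h y zy).
      move=> [Uy [b cb]]; apply: nSz; split => //.
      by eexists; apply: (spread z Q r y b h r0 zy cb (unit_end _ _ cb)); exact: ballxx.
    apply/seteqP; split=> z.
      by move=> Sz; split; [case: Sz|move=> [_ nS]].
    move=> [Uz nn]; have [//|nS] := pselect (S z); by exfalso; apply: nn.
have hS z : exists a, U z -> continuation z0 quat1 z a.
  have [Uz|nUz] := pselect (U z); last by exists 0.
  by move: (Uz); rewrite -SU => -[_ [a ca]]; exists a.
have [F hF] := choice hS.
exists F => z Uz.
have [Q [r [r0 Q1 h]]] := loc z Uz.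
pose c := qmul (F z) (qconj (Q z)).
have c1 : qdot c c = 1 by rewrite qdotM qdot_conj Q1 (unit_end _ _ (hF _ Uz)) mulr1.
have FE y : ball z r y -> qmul c (Q y) = F y.
  move=> zy; have [Uy _] := h y zy.
  have k := spread z Q r z (F z) h r0 (ballxx _ r0) (hF _ Uz) (unit_end _ _ (hF _ Uz)) y zy.
  exact: monodromy (continuation_trans (continuation_sym k) (hF _ Uy)).
have nF : \forall y \near z, qmul c (Q y) = F y by apply/nbhs_ballP; exists r.
have [_ sQ] := h z (ballxx _ r0).
have [du dv dQ u1] := flat_solution_mull c1 sQ.
have eF := nbhs_singleton nF.
split.
- by rewrite -eF; exact: near_eq_is_derive nF du.
- by rewrite -eF; exact: near_eq_is_derive nF dv.
- exact: near_eq_differentiable nF dQ.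
- by rewrite -eF.
Qed.

End Continuation.

(** * Elementary functions and orthogonal frames *)

Section ElementaryFunctions.
Context {R : realType}.

Lemma is_derive_scalar_comp (V : normedModType R) (g : R -> R) (f : V -> R) x v (dg df : R) :
  is_derive (f x) 1 g dg -> differentiable f x -> is_derive x v f df ->
  is_derive x v (fun y => g (f y)) (dg * df).
Proof.
move=> [dg1 dg2] df1 [_ <-].
have dgd : differentiable g (f x) by exact/derivable1_diffP.
have dc : differentiable (g \o f) x by exact: differentiable_comp.
have -> : (fun y => g (f y)) = g \o f by [].
split; first exact: diff_derivable.
rewrite deriveE // diff_comp //= -(deriveE v df1) -dg2 (deriveE _ dgd).
by rewrite -[in LHS](mulr1 ('D_v f x)) linearZ /= mulrC.
Qed.

Lemma is_derive_dir (f : R -> R) (x v df : R) : is_derive x 1 f df -> is_derive x v f (v * df).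
Proof.
move=> [h1 <-]; have df1 : differentiable f x by exact/derivable1_diffP.
split; first exact: diff_derivable.
by rewrite !deriveE // -[in LHS](mulr1 v) linearZ.
Qed.

Lemma class_C_of_derive (f g : R -> R) k : (forall x : R, is_derive x 1 f (g x)) ->
  class_C k (@setT R) g -> class_C k.+1 (@setT R) f.
Proof.
move=> dfg cg; split=> [x _|v].
  by apply/derivable1_diffP; case: (dfg x).
apply: (@eq_class_C _ _ _ _ _ (fun x => v * g x)) => //; first exact: openT.
  move=> x _; apply/esym; apply: derive_val.
  exact: is_derive_dir.
by apply: class_C_mul => //; [exact: openT|exact: class_C_cst].
Qed.

Lemma class_C_expR k : class_C k (@setT R) expR.
Proof.
elim: k => [x _|k IH]; first exact: continuous_expR.
apply: class_C_of_derive IH => x; exact: is_derive_expR.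
Qed.

(** Simultaneous induction, each function being up to sign the derivative of the
    other. *)
Lemma class_C_cos_sin k : class_C k (@setT R) cos /\ class_C k (@setT R) sin.
Proof.
elim: k => [|k [IHc IHs]]; first by split=> x _; [exact: continuous_cos|exact: continuous_sin].
split.
  apply: (@class_C_of_derive _ (fun x => - sin x)).
  by apply: class_C_opp => //; exact: openT.
by apply: (@class_C_of_derive _ cos) => // x; exact: is_derive_sin.
Qed.

End ElementaryFunctions.

Section OrthogonalFrame.
Context {R : realType}.
Context (a b n : quat R) (L : R).
Context (L0 : L != 0) (a_im : qre a = 0) (b_im : qre b = 0).
Context (aa : qdot a a = L) (bb : qdot b b = L) (ab : qdot a b = 0).
Context (nE : n = L^-1 *: qcross a b).

Lemma frame_ab : qmul a b = L *: n.
Proof.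
rewrite nE scalerA divff // scale1r; move: ab; rewrite qdotE a_im b_im => ab0.
apply: quatP; quat_simp => //; rewrite a_im b_im.
transitivity (- (0 * 0 + qi a * qi b + qj a * qj b + qk a * qk b)); first by ring.
by rewrite ab0 oppr0.
Qed.

Lemma frame_ba : qmul b a = - (L *: n).
Proof.
rewrite -frame_ab; move: ab; rewrite qdotE a_im b_im => ab0.
apply: quatP; quat_simp; rewrite a_im b_im; last 3 first.
- by ring. - by ring. - by ring.
apply/eqP; rewrite -subr_eq0; apply/eqP.
transitivity (-2 * (0 * 0 + qi a * qi b + qj a * qj b + qk a * qk b)); first by ring.
by rewrite ab0 mulr0.
Qed.

Lemma imaginary_sqr (x : quat R) : qre x = 0 -> qmul x x = - (qdot x x *: quat1).
Proof. by move=> x0; apply: quatP; quat_simp; rewrite x0; ring. Qed.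

Lemma frame_aa : qmul a a = - (L *: quat1). Proof. by rewrite imaginary_sqr // aa. Qed.
Lemma frame_bb : qmul b b = - (L *: quat1). Proof. by rewrite imaginary_sqr // bb. Qed.

Lemma frame_na : qmul n a = b.
Proof.
apply: (scalerI L0); rewrite -qmulZl -frame_ab.
have -> : qmul a b = - qmul b a by rewrite frame_ab frame_ba opprK.
by rewrite qmulNl -qmulA frame_aa qmulNr opprK qmulZr qmul1r.
Qed.

Lemma frame_an : qmul a n = - b.
Proof.
apply: (scalerI L0); rewrite -qmulZr -frame_ab qmulA frame_aa qmulNl qmulZl qmul1l.
by rewrite scalerN.
Qed.

Lemma frame_bn : qmul b n = a.
Proof.
apply: (scalerI L0); rewrite -qmulZr -frame_ab.
have -> : qmul a b = - qmul b a by rewrite frame_ab frame_ba opprK.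
by rewrite qmulNr qmulA frame_bb qmulNl opprK qmulZl qmul1l.
Qed.

Lemma frame_nb : qmul n b = - a.
Proof.
apply: (scalerI L0); rewrite -qmulZl -frame_ab -qmulA frame_bb qmulNr qmulZr qmul1r.
by rewrite scalerN.
Qed.

Lemma frame_nn : qmul n n = - quat1.
Proof.
apply: (scalerI L0); rewrite -qmulZr -frame_ab qmulA frame_na frame_bb.
by rewrite scalerN.
Qed.

Lemma frame_n_im : qre n = 0.
Proof. by rewrite nE; quat_simp; rewrite mulr0. Qed.

Lemma frame_n_unit : qdot n n = 1.
Proof.
have := frame_nn; rewrite imaginary_sqr ?frame_n_im // => /oppr_inj.
by move/(congr1 qre); rewrite !qcoordE !mulr1.
Qed.

Lemma frame_an0 : qdot a n = 0.
Proof. by rewrite nE !qdotE; quat_simp; rewrite a_im b_im; ring. Qed.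

Lemma frame_bn0 : qdot b n = 0.
Proof. by rewrite nE !qdotE; quat_simp; rewrite a_im b_im; ring. Qed.

(** For imaginary a, b, x, with c the vector product of a and b, the identity
    (|a|^2 |b|^2 - (a.b)^2) x = (x.a |b|^2 - x.b a.b) a + (x.b |a|^2 - x.a a.b) b
    + (x.c) c is a polynomial identity in the coordinates. *)
Lemma frame_expansion (x : quat R) : qre x = 0 ->
  x = (qdot x a / L) *: a + (qdot x b / L) *: b + qdot x n *: n.
Proof.
move=> x0.
have L20 : L * L != 0 by rewrite mulf_neq0.
apply: (scalerI L20).
have -> : L * L = qdot a a * qdot b b - qdot a b * qdot a b by rewrite aa bb ab mul0r subr0.
have -> : (qdot a a * qdot b b - qdot a b * qdot a b) *: x =
    (qdot x a * qdot b b - qdot x b * qdot a b) *: a +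
    (qdot x b * qdot a a - qdot x a * qdot a b) *: b + qdot x (qcross a b) *: qcross a b.
  by apply: quatP; rewrite !qdotE; quat_simp; rewrite x0 a_im b_im; ring.
rewrite aa bb ab !mulr0 !subr0 nE qdotZr !scalerDr !scalerA.
congr (_ *: _ + _ *: _ + _ *: _); by field.
Qed.

Lemma frame_commutator (x1 x2 x3 y1 y2 y3 : R) :
  let x := x1 *: a + x2 *: b + x3 *: n in let y := y1 *: a + y2 *: b + y3 *: n in
  qmul x y - qmul y x = (2 * (x2 * y3 - x3 * y2)) *: a + (2 * (x3 * y1 - x1 * y3)) *: b +
    (2 * L * (x1 * y2 - x2 * y1)) *: n.
Proof.
rewrite /= !qmulDl !qmulDr !qmulZl !qmulZr frame_aa frame_bb frame_nn frame_ab frame_ba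
  frame_na frame_an frame_bn frame_nb.
by apply/rowP => i; rewrite !mxE; ring.
Qed.

Lemma frame_bracket : qmul a b - qmul b a = (2 * L) *: n.
Proof. by rewrite frame_ab frame_ba opprK -scalerDl; congr (_ *: _); ring. Qed.

Lemma frame_components (x : quat R) (c1 c2 c3 : R) : qre x = 0 -> qdot x a = c1 * L ->
  qdot x b = c2 * L -> qdot x n = c3 -> x = c1 *: a + c2 *: b + c3 *: n.
Proof.
by move=> x0 e1 e2 e3; rewrite {1}(frame_expansion x0) e1 e2 e3 !mulfK.
Qed.

Lemma frame_normal_u_algebra (x y t : quat R) (r s : R) :
  L *: x = qmul y b + qmul a t - (r * L) *: n ->
  y = (r / 2) *: a + (- (s / 2)) *: b + (-2) *: n ->
  t = (s / 2) *: a + (r / 2) *: b + (- L) *: n -> x = (2 / L) *: a + b.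
Proof.
move=> E Ey Et; rewrite Ey Et in E; apply: (scalerI L0); rewrite E.
rewrite !qmulDl !qmulDr !qmulZl !qmulZr frame_ab frame_bb frame_nb frame_aa frame_an.
by apply/rowP => i; rewrite !mxE; field.
Qed.

Lemma frame_normal_v_algebra (x y t : quat R) (r s : R) :
  L *: x = qmul y b + qmul a t - (s * L) *: n ->
  y = (s / 2) *: a + (r / 2) *: b + L *: n ->
  t = (- (r / 2)) *: a + (s / 2) *: b + 2 *: n -> x = - a - (2 / L) *: b.
Proof.
move=> E Ey Et; rewrite Ey Et in E; apply: (scalerI L0); rewrite E.
rewrite !qmulDl !qmulDr !qmulZl !qmulZr frame_ab frame_bb frame_nb frame_aa frame_an.
by apply/rowP => i; rewrite !mxE; field.
Qed.

End OrthogonalFrame.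

(** * Structure equations of the minimal surface *)

Section SecondFundamentalForm.
Context {R : realType}.
Implicit Types (w : R * R -> R) (p : R * R -> quat R) (z : R * R).

(** In conformal coordinates minimality is the vanishing of the trace of the
    second fundamental form in the coordinate basis. *)
Lemma mean_curvature_conformal w p z (L : R) : L != 0 ->
  qdot ('D_e_u p z) ('D_e_u p z) = L -> qdot ('D_e_v p z) ('D_e_v p z) = L ->
  qdot ('D_e_u p z) ('D_e_v p z) = 0 -> mean_curvature w p z = 0 ->
  sff w p z e_u e_u + sff w p z e_v e_v = 0.
Proof.
move=> L0; rewrite /mean_curvature.
generalize (sff w p z e_u e_u) (sff w p z e_u e_v) (sff w p z e_v e_v).
generalize (qdot ('D_e_u p z) ('D_e_u p z)) (qdot ('D_e_v p z) ('D_e_v p z))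
  (qdot ('D_e_u p z) ('D_e_v p z)).
move=> x y t h1 h2 h3 -> -> -> H.
have : (h1 + h3) / (2 * L) = 0 by rewrite -H; field.
move/eqP; rewrite mulf_eq0 invr_eq0 mulf_eq0 pnatr_eq0 (negbTE L0) !orbF.
by move/eqP.
Qed.

(** The real and imaginary parts of sigma(dz, dz) = -1, multiplied by 4 and -4.
    The symmetry of sff is not yet known, so both mixed terms occur. *)
Lemma sffC_dz w p z : sffC w p z dz dz = -1 ->
  sff w p z e_u e_u - sff w p z e_v e_v = -4 /\
  sff w p z e_u e_v + sff w p z e_v e_u = 0.
Proof.
rewrite /sffC /dz /=.
generalize (sff w p z e_u e_u) (sff w p z e_u e_v) (sff w p z e_v e_u) (sff w p z e_v e_v).
move=> h1 h2 h3 h4.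
have -> : (2^-1 : R[i]) = (2^-1)%:C%C by rewrite fmorphV rmorph_nat.
move=> /eqP; rewrite eq_complex /= => /andP[/eqP re /eqP im].
split; lra.
Qed.

End SecondFundamentalForm.

Section StructureEquations.
Context {R : realType} (U : set (R * R)) (w : R * R -> R) (p : R * R -> quat R).
Context (U_open : open U) (w_smooth : smooth_on U w).
Context (p_surface : associated_minimal_surface U w p).
Implicit Types (z v : R * R).

(** The conormal p^-1 N, a unit imaginary quaternion. *)
Definition frame_normal z : quat R := (2 * expR (w z))^-1 *: alpha23 p z.
Local Notation a := (alpha2 p).
Local Notation b := (alpha3 p).
Local Notation n := frame_normal.
Local Notation L z := (2 * expR (w z)).

Lemma smooth_p k : class_C k U p.
Proof. by case: (ams_immersion p_surface) => h _; exact: h. Qed.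

Lemma class_C_derive k v (W : normedModType R) (f : R * R -> W) :
  class_C k.+1 U f -> class_C k U ('D_v f).
Proof. by case=> _ h; exact: h. Qed.

Lemma smooth_alpha2 k : class_C k U a.
Proof.
apply: class_C_qmul => //; last exact: (class_C_derive e_u (smooth_p k.+1)).
by apply: class_C_qconj => //; exact: smooth_p.
Qed.

Lemma smooth_alpha3 k : class_C k U b.
Proof.
apply: class_C_qmul => //; last exact: (class_C_derive e_v (smooth_p k.+1)).
by apply: class_C_qconj => //; exact: smooth_p.
Qed.

Lemma smooth_expN_w k : class_C k U (fun z => expR (- w z)).
Proof.
apply: (@class_C_comp _ _ k U expR (fun z => - w z)) => //; first exact: class_C_expR.
by apply: class_C_opp => //; exact: w_smooth.
Qed.

Lemma frame_normalE z : n z = (2^-1 * expR (- w z)) *: alpha23 p z.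
Proof. by rewrite /n invfM expRN. Qed.

Lemma smooth_frame_normal k : class_C k U n.
Proof.
apply: (@eq_class_C _ _ _ _ _ (fun z => (2^-1 * expR (- w z)) *: alpha23 p z)) => //.
  by move=> z _; rewrite frame_normalE.
apply: class_C_scale => //.
  by apply: class_C_mul => //; [exact: class_C_cst|exact: smooth_expN_w].
by apply: class_C_qim => //; apply: class_C_qmul => //; [exact: smooth_alpha2|exact: smooth_alpha3].
Qed.

Lemma smooth_is_derive (W : normedModType R) (f : R * R -> W) z v :
  class_C 1 U f -> U z -> is_derive z v f ('D_v f z).
Proof. by move=> [df _] Uz; apply: differentiable_is_derive; exact: df. Qed.

(** Differentiating an identity between functions on U. *)
Lemma is_derive_eq_on (W : normedModType R) (f g : R * R -> W) z v df dg :
  (forall y, U y -> f y = g y) -> U z -> is_derive z v f df -> is_derive z v g dg -> df = dg.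
Proof.
move=> fg Uz hf hg.
have h : is_derive z v g df.
  apply: near_eq_is_derive hf.
  by apply: filterS (open_nbhs_nbhs (conj U_open Uz)) => y; exact: fg.
by rewrite -(@derive_val _ _ _ _ _ _ _ hg) (@derive_val _ _ _ _ _ _ _ h).
Qed.

Lemma p_unit z : U z -> qdot (p z) (p z) = 1.
Proof. exact: (ams_sphere p_surface). Qed.

Lemma p_orthogonal z v : U z -> qdot (p z) ('D_v p z) = 0.
Proof.
move=> Uz; have dp := smooth_is_derive v (smooth_p 1) Uz.
have h := is_derive_eq_on p_unit Uz (is_derive_qdot dp dp) (is_derive_cst (1 : R) z v).
by rewrite qdotC -mulr2n in h; move/eqP: h; rewrite mulrn_eq0 /= => /eqP.
Qed.

Lemma qre_conj_mul (x y : quat R) : qre (qmul (qconj x) y) = qdot x y.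
Proof. by rewrite qdotE; quat_simp; ring. Qed.

Lemma alpha2_im z : U z -> qre (a z) = 0.
Proof. by move=> Uz; rewrite qre_conj_mul p_orthogonal. Qed.

Lemma alpha3_im z : U z -> qre (b z) = 0.
Proof. by move=> Uz; rewrite qre_conj_mul p_orthogonal. Qed.

Lemma p_u z : U z -> 'D_e_u p z = qmul (p z) (a z).
Proof. by move=> Uz; rewrite unit_mulK // p_unit. Qed.

Lemma p_v z : U z -> 'D_e_v p z = qmul (p z) (b z).
Proof. by move=> Uz; rewrite unit_mulK // p_unit. Qed.

Lemma metric_neq0 z : L z != 0.
Proof. by rewrite mulf_neq0 // gt_eqF // expR_gt0. Qed.

Lemma alpha2_norm z : U z -> qdot (a z) (a z) = L z.
Proof.
by move=> Uz; rewrite qdot_mull qdot_conj p_unit // mul1r (ams_uu p_surface).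
Qed.

Lemma alpha3_norm z : U z -> qdot (b z) (b z) = L z.
Proof.
by move=> Uz; rewrite qdot_mull qdot_conj p_unit // mul1r (ams_vv p_surface).
Qed.

Lemma alpha23_orthogonal z : U z -> qdot (a z) (b z) = 0.
Proof.
by move=> Uz; rewrite qdot_mull qdot_conj p_unit // mul1r (ams_uv p_surface).
Qed.

Lemma is_derive_alpha2 z v : U z -> is_derive z v a ('D_v a z).
Proof. exact: smooth_is_derive (smooth_alpha2 1). Qed.
Lemma is_derive_alpha3 z v : U z -> is_derive z v b ('D_v b z).
Proof. exact: smooth_is_derive (smooth_alpha3 1). Qed.

Lemma is_derive_metric z v : U z -> is_derive z v (fun y => L y) ('D_v w z * L z).
Proof.
move=> Uz; have dw := smooth_is_derive v (w_smooth 1) Uz.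
have dwd : differentiable w z by case: (w_smooth 1) => h _; exact: h.
apply: (is_derive_eq (is_derive_mul (is_derive_cst (2 : R) z v)
  (is_derive_scalar_comp (is_derive_expR (w z)) dwd dw))).
by rewrite mul0r add0r /cst; ring.
Qed.

Lemma second_derivative_u z v : U z ->
  'D_v ('D_e_u p) z = qmul (qmul (p z) (qmul (qconj (p z)) ('D_v p z))) (a z) + qmul (p z) ('D_v a z).
Proof.
move=> Uz; rewrite unit_mulK ?p_unit //.
apply: (is_derive_eq_on p_u Uz (smooth_is_derive v (class_C_derive e_u (smooth_p 2)) Uz)).
exact: is_derive_qmul (smooth_is_derive v (smooth_p 1) Uz) (is_derive_alpha2 v Uz).
Qed.

Lemma second_derivative_v z v : U z ->
  'D_v ('D_e_v p) z = qmul (qmul (p z) (qmul (qconj (p z)) ('D_v p z))) (b z) + qmul (p z) ('D_v b z).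
Proof.
move=> Uz; rewrite unit_mulK ?p_unit //.
apply: (is_derive_eq_on p_v Uz (smooth_is_derive v (class_C_derive e_v (smooth_p 2)) Uz)).
exact: is_derive_qmul (smooth_is_derive v (smooth_p 1) Uz) (is_derive_alpha3 v Uz).
Qed.

Lemma maurer_cartan_algebra (x c d dc dd : quat R) : qdot x x = 1 ->
  qmul (qmul x c) d + qmul x dd = qmul (qmul x d) c + qmul x dc ->
  dc - dd = qmul c d - qmul d c.
Proof.
move=> x1; rewrite -!qmulA -!qmulDr => /(congr1 (qmul (qconj x))).
rewrite !unit_conjK // => E.
have -> : dc = qmul c d + dd - qmul d c by rewrite E addrC addKr.
by rewrite addrAC addrK.
Qed.

(** Differentiate p_u = p alpha2 in v and p_v = p alpha3 in u, and use the
    symmetry of second derivatives. *)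
Lemma maurer_cartan z : U z ->
  'D_e_v a z - 'D_e_u b z = qmul (a z) (b z) - qmul (b z) (a z).
Proof.
move=> Uz; apply: (maurer_cartan_algebra (p_unit Uz)).
exact: (etrans (esym (second_derivative_v e_u Uz))
  (etrans (schwarz_quat U_open (smooth_p 2) Uz) (second_derivative_u e_v Uz))).
Qed.

Section AtPoint.
Context (z : R * R) (Uz : U z).

Let L0 := metric_neq0 z.
Let a_im := alpha2_im Uz.
Let b_im := alpha3_im Uz.
Let aa := alpha2_norm Uz.
Let bb := alpha3_norm Uz.
Let ab := alpha23_orthogonal Uz.
Let nE : n z = (L z)^-1 *: qcross (a z) (b z) := erefl.

Lemma sff_uE X Y : sff w p z X Y = qdot ('D_X ('D_Y p) z) (qmul (p z) (n z)).
Proof. by []. Qed.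

Lemma qdot1l (x : quat R) : qdot quat1 x = qre x.
Proof. by rewrite qdotE /quat1 !qcoordE; ring. Qed.

Lemma sff_uu : sff w p z e_u e_u = qdot ('D_e_u a z) (n z).
Proof.
rewrite sff_uE second_derivative_u // -qmulA -qmulDr qdot_mull p_unit // mul1r -/(a z).
rewrite qdotDl (frame_aa a_im aa) qdotNl qdotZl qdot1l (frame_n_im nE).
by rewrite mulr0 oppr0 add0r.
Qed.

Lemma sff_vv : sff w p z e_v e_v = qdot ('D_e_v b z) (n z).
Proof.
rewrite sff_uE second_derivative_v // -qmulA -qmulDr qdot_mull p_unit // mul1r -/(b z).
rewrite qdotDl (frame_bb b_im bb) qdotNl qdotZl qdot1l (frame_n_im nE).
by rewrite mulr0 oppr0 add0r.
Qed.

Lemma sff_uv : sff w p z e_u e_v = L z + qdot ('D_e_u b z) (n z).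
Proof.
rewrite sff_uE second_derivative_v // -qmulA -qmulDr qdot_mull p_unit // mul1r -/(a z).
rewrite qdotDl (frame_ab L0 a_im b_im ab nE) qdotZl.
by rewrite (frame_n_unit L0 a_im b_im aa bb ab nE) mulr1.
Qed.

Lemma sff_vu : sff w p z e_v e_u = - L z + qdot ('D_e_v a z) (n z).
Proof.
rewrite sff_uE second_derivative_u // -qmulA -qmulDr qdot_mull p_unit // mul1r -/(b z).
rewrite qdotDl (frame_ba L0 a_im b_im ab nE) qdotNl qdotZl.
by rewrite (frame_n_unit L0 a_im b_im aa bb ab nE) mulr1.
Qed.

Lemma derivative_imaginary (f : R * R -> quat R) v : class_C 1 U f ->
  (forall y, U y -> qre (f y) = 0) -> qre ('D_v f z) = 0.
Proof.
move=> cf f0.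
exact: (is_derive_eq_on f0 Uz (is_derive_coord _ (smooth_is_derive v cf Uz)) (is_derive_cst (0 : R) z v)).
Qed.

Lemma half_of_double (x y : R) : x + x = y -> x = y / 2.
Proof. by move=> <-; lra. Qed.

Lemma dot_a_da v : qdot ('D_v a z) (a z) = 'D_v w z * L z / 2.
Proof.
apply: half_of_double; rewrite {2}qdotC.
exact: (is_derive_eq_on alpha2_norm Uz (is_derive_qdot (is_derive_alpha2 v Uz)
  (is_derive_alpha2 v Uz)) (is_derive_metric v Uz)).
Qed.

Lemma dot_b_db v : qdot ('D_v b z) (b z) = 'D_v w z * L z / 2.
Proof.
apply: half_of_double; rewrite {2}qdotC.
exact: (is_derive_eq_on alpha3_norm Uz (is_derive_qdot (is_derive_alpha3 v Uz)
  (is_derive_alpha3 v Uz)) (is_derive_metric v Uz)).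
Qed.

Lemma dot_a_db v : qdot ('D_v b z) (a z) = - qdot ('D_v a z) (b z).
Proof.
have := is_derive_eq_on alpha23_orthogonal Uz (is_derive_qdot (is_derive_alpha2 v Uz) (is_derive_alpha3 v Uz))
  (is_derive_cst (0 : R) z v).
generalize ('D_v a z) ('D_v b z) => x y /eqP.
by rewrite addr_eq0 => /eqP ->; rewrite opprK qdotC.
Qed.

Lemma maurer_cartan_frame : 'D_e_v a z - 'D_e_u b z = (2 * L z) *: n z.
Proof.
exact: etrans (maurer_cartan Uz) (frame_bracket L0 a_im b_im ab nE).
Qed.

Lemma dot_dva_a : qdot ('D_e_v a z) (a z) = qdot ('D_e_u b z) (a z).
Proof.
have := maurer_cartan_frame; generalize ('D_e_v a z) ('D_e_u b z) => x y E.
apply/eqP; rewrite -subr_eq0 -qdotNl -qdotDl E qdotZl qdotC.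
by rewrite (frame_an0 a_im b_im nE) mulr0.
Qed.

Lemma dot_dva_b : qdot ('D_e_v a z) (b z) = qdot ('D_e_u b z) (b z).
Proof.
have := maurer_cartan_frame; generalize ('D_e_v a z) ('D_e_u b z) => x y E.
apply/eqP; rewrite -subr_eq0 -qdotNl -qdotDl E qdotZl qdotC.
by rewrite (frame_bn0 a_im b_im nE) mulr0.
Qed.

Lemma dot_dva_n : qdot ('D_e_v a z) (n z) - qdot ('D_e_u b z) (n z) = 2 * L z.
Proof.
have := maurer_cartan_frame; generalize ('D_e_v a z) ('D_e_u b z) => x y E.
rewrite -qdotNl -qdotDl E qdotZl.
by rewrite (frame_n_unit L0 a_im b_im aa bb ab nE) mulr1.
Qed.

(** Minimality and the real part of sigma(dz, dz) = -1 give the pure second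
    derivatives; its imaginary part and the Maurer-Cartan equation give the mixed
    ones. *)
Lemma normal_components :
  [/\ qdot ('D_e_u a z) (n z) = -2, qdot ('D_e_v b z) (n z) = 2,
      qdot ('D_e_u b z) (n z) = - L z & qdot ('D_e_v a z) (n z) = L z].
Proof.
have h1 := mean_curvature_conformal L0 (ams_uu p_surface Uz) (ams_vv p_surface Uz)
  (ams_uv p_surface Uz) (ams_minimal p_surface Uz).
have [h2 h3] := sffC_dz (ams_sff p_surface Uz).
move: h1 h2 h3 dot_dva_n sff_uu sff_vv sff_uv sff_vu.
generalize (sff w p z e_u e_u) (sff w p z e_u e_v) (sff w p z e_v e_u) (sff w p z e_v e_v).
generalize (qdot ('D_e_u a z) (n z)) (qdot ('D_e_v b z) (n z))
  (qdot ('D_e_u b z) (n z)) (qdot ('D_e_v a z) (n z)) (2 * expR (w z)).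
by clear; move=> x1 x2 x3 x4 l s1 s2 s3 s4 *; split; lra.
Qed.

Local Notation wu := ('D_e_u w z).
Local Notation wv := ('D_e_v w z).

(** Derivatives of |alpha2|^2 = |alpha3|^2 = 2 e^w and alpha2 . alpha3 = 0, combined
    with the Maurer-Cartan equation, whose right-hand side is normal. *)
Lemma tangential_components :
  [/\ qdot ('D_e_u a z) (a z) = wu / 2 * L z /\ qdot ('D_e_u a z) (b z) = - (wv / 2) * L z,
      qdot ('D_e_v a z) (a z) = wv / 2 * L z /\ qdot ('D_e_v a z) (b z) = wu / 2 * L z,
      qdot ('D_e_u b z) (a z) = wv / 2 * L z /\ qdot ('D_e_u b z) (b z) = wu / 2 * L z &
      qdot ('D_e_v b z) (a z) = - (wu / 2) * L z /\ qdot ('D_e_v b z) (b z) = wv / 2 * L z].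
Proof.
move: (dot_a_da e_u) (dot_a_da e_v) (dot_b_db e_u) (dot_b_db e_v) (dot_a_db e_u) (dot_a_db e_v)
  dot_dva_a dot_dva_b.
generalize (qdot ('D_e_u a z) (a z)) (qdot ('D_e_u a z) (b z)) (qdot ('D_e_v a z) (a z))
  (qdot ('D_e_v a z) (b z)) (qdot ('D_e_u b z) (a z)) (qdot ('D_e_u b z) (b z))
  (qdot ('D_e_v b z) (a z)) (qdot ('D_e_v b z) (b z)) ('D_e_u w z) ('D_e_v w z) (2 * expR (w z)).
by clear; move=> x1 x2 x3 x4 x5 x6 x7 x8 r s l; repeat split; lra.
Qed.

Lemma alpha2_u : 'D_e_u a z = (wu / 2) *: a z + (- (wv / 2)) *: b z + (-2) *: n z.
Proof.
have [h1 _ _ _] := normal_components; have [[t1 t2] _ _ _] := tangential_components.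
exact: (frame_components L0 a_im b_im aa bb ab nE
  (derivative_imaginary e_u (smooth_alpha2 1) alpha2_im) t1 t2 h1).
Qed.

Lemma alpha2_v : 'D_e_v a z = (wv / 2) *: a z + (wu / 2) *: b z + L z *: n z.
Proof.
have [_ _ _ h4] := normal_components; have [_ [t1 t2] _ _] := tangential_components.
exact: (frame_components L0 a_im b_im aa bb ab nE
  (derivative_imaginary e_v (smooth_alpha2 1) alpha2_im) t1 t2 h4).
Qed.

Lemma alpha3_u : 'D_e_u b z = (wv / 2) *: a z + (wu / 2) *: b z + (- L z) *: n z.
Proof.
have [_ _ h3 _] := normal_components; have [_ _ [t1 t2] _] := tangential_components.
exact: (frame_components L0 a_im b_im aa bb ab nE
  (derivative_imaginary e_u (smooth_alpha3 1) alpha3_im) t1 t2 h3).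
Qed.

Lemma alpha3_v : 'D_e_v b z = (- (wu / 2)) *: a z + (wv / 2) *: b z + 2 *: n z.
Proof.
have [_ h2 _ _] := normal_components; have [_ _ _ [t1 t2]] := tangential_components.
exact: (frame_components L0 a_im b_im aa bb ab nE
  (derivative_imaginary e_v (smooth_alpha3 1) alpha3_im) t1 t2 h2).
Qed.

Lemma frame_normal_derive v : L z *: 'D_v n z =
  qmul ('D_v a z) (b z) + qmul (a z) ('D_v b z) - ('D_v w z * L z) *: n z.
Proof.
have Ln y : U y -> L y *: n y = qmul (a y) (b y).
  by move=> Uy; rewrite (frame_ab (metric_neq0 y) (alpha2_im Uy) (alpha3_im Uy)
    (alpha23_orthogonal Uy) erefl).
have dn := smooth_is_derive v (smooth_frame_normal 1) Uz.
have := is_derive_eq_on Ln Uz (is_derive_scaleq (is_derive_metric v Uz) dn)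
  (is_derive_qmul (is_derive_alpha2 v Uz) (is_derive_alpha3 v Uz)).
generalize ('D_v n z) ('D_v a z) ('D_v b z) ('D_v w z) => x y t s <-.
by rewrite addrC addKr.
Qed.

Lemma two_div_metric : 2 / (2 * expR (w z)) = (expR (w z))^-1.
Proof. by rewrite invfM mulrA divff ?mul1r. Qed.

Lemma frame_normal_u : 'D_e_u n z = (expR (w z))^-1 *: a z + b z.
Proof.
rewrite -two_div_metric; exact: (frame_normal_u_algebra L0 a_im b_im aa bb ab nE
  (frame_normal_derive e_u) alpha2_u alpha3_u).
Qed.

Lemma frame_normal_v : 'D_e_v n z = - a z - (expR (w z))^-1 *: b z.
Proof.
rewrite -two_div_metric; exact: (frame_normal_v_algebra L0 a_im b_im aa bb ab nE
  (frame_normal_derive e_v) alpha2_v alpha3_v).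
Qed.

End AtPoint.

End StructureEquations.

(** * The flat connection of the surface *)

Section ConnectionAlgebra.
Context {R : realType} (a b n : quat R) (e : R).
Context (e0 : e != 0) (a_im : qre a = 0) (b_im : qre b = 0).
Context (aa : qdot a a = 2 * e) (bb : qdot b b = 2 * e) (ab : qdot a b = 0).
Context (nE : n = (2 * e)^-1 *: qcross a b).

Let L0 : 2 * e != 0. Proof. by rewrite mulf_neq0. Qed.

(** The derivatives of the frame are replaced by their expansions and the bracket
    by frame_commutator. The components on a and b cancel identically; that on n
    cancels by the Sinh-Gordon equation. *)
Lemma connection_flat_algebra (F : R) (au av bu bv nu nv : quat R) (wu wv wuu wvv : R) :
  F = e^-1 ->
  av = (wv / 2) *: a + (wu / 2) *: b + (2 * e) *: n ->
  au = (wu / 2) *: a + (- (wv / 2)) *: b + (-2) *: n ->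
  bu = (wv / 2) *: a + (wu / 2) *: b + (- (2 * e)) *: n ->
  bv = (- (wu / 2)) *: a + (wv / 2) *: b + 2 *: n ->
  nu = e^-1 *: a + b -> nv = - a - e^-1 *: b ->
  wuu + wvv = - 8 * ((e - F) / 2) ->
  let A := 2^-1 *: a + (- (F / 2)) *: b + (wv / 4) *: n in
  let B := (- (F / 2)) *: a + 2^-1 *: b + (- (wu / 4)) *: n in
  ((0 *: a + 2^-1 *: av) + ((wv * F / 2) *: b + (- (F / 2)) *: bv) +
    ((wvv / 4) *: n + (wv / 4) *: nv)) -
  (((wu * F / 2) *: a + (- (F / 2)) *: au) + (0 *: b + 2^-1 *: bu) +
    ((- (wuu / 4)) *: n + (- (wu / 4)) *: nu)) =
  qmul A B - qmul B A.
Proof.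
move=> -> -> -> -> -> -> -> lap /=.
rewrite (frame_commutator L0 a_im b_im aa bb ab nE).
have -> : wuu = - 8 * ((e - e^-1) / 2) - wvv by rewrite -lap addrK.
by apply/rowP => i; rewrite !mxE; field.
Qed.

Lemma connection_normal_algebra (y1 y2 y3 : R) :
  let A := y1 *: a + y2 *: b + y3 *: n in
  qmul n A - qmul A n = (- 2 * y2) *: a + (2 * y1) *: b.
Proof.
have := frame_commutator L0 a_im b_im aa bb ab nE 0 0 1 y1 y2 y3.
rewrite /= !scale0r !add0r scale1r => ->.
by apply/rowP => i; rewrite !mxE; ring.
Qed.

End ConnectionAlgebra.

Section RightHandSides.
Context {R : realType} (x a b n c : quat R) (e F r : R).
Context (e0 : e != 0) (FE : F = e^-1) (cE : c = (2 * e) *: n).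

Lemma rhs_u_algebra :
  (F / 8) *: ((4 * e) *: qmul x a - 4 *: qmul x b + r *: qmul x c) =
  qmul x (2^-1 *: a + (- (F / 2)) *: b + (r / 4) *: n).
Proof.
rewrite cE FE !qmulDr !qmulZr; move: (qmul x a) (qmul x b) (qmul x n) => X Y Z.
by apply/rowP => i; rewrite !mxE; field.
Qed.

Lemma rhs_v_algebra :
  - (F / 8) *: (4 *: qmul x a - (4 * e) *: qmul x b + r *: qmul x c) =
  qmul x ((- (F / 2)) *: a + 2^-1 *: b + (- (r / 4)) *: n).
Proof.
rewrite cE FE !qmulDr !qmulZr; move: (qmul x a) (qmul x b) (qmul x n) => X Y Z.
by apply/rowP => i; rewrite !mxE; field.
Qed.

Lemma rhs_t_algebra : - (r * F / 4) *: qmul x c = qmul x (- (r / 2) *: n).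
Proof. by rewrite cE FE !qmulZr scalerA; congr (_ *: _); field. Qed.

End RightHandSides.

Section Connection.
Context {R : realType} (U : set (R * R)) (w : R * R -> R) (p : R * R -> quat R).
Context (U_open : open U) (w_sinh_gordon : sinh_gordon U w).
Context (p_surface : associated_minimal_surface U w p).
Implicit Types (z v : R * R).
Local Notation a := (alpha2 p).
Local Notation b := (alpha3 p).
Local Notation n := (frame_normal w p).

Let w_smooth : smooth_on U w := proj1 w_sinh_gordon.

(** The coefficient of du in q^-1 dq. *)
Definition connection_u z : quat R :=
  2^-1 *: a z + (- (expR (- w z) / 2)) *: b z + ('D_e_v w z / 4) *: n z.
(** The coefficient of dv in q^-1 dq. *)
Definition connection_v z : quat R :=
  (- (expR (- w z) / 2)) *: a z + 2^-1 *: b z + (- ('D_e_u w z / 4)) *: n z.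
Local Notation A := connection_u.
Local Notation B := connection_v.

Lemma expR_w_neq0 z : expR (w z) != 0. Proof. by rewrite gt_eqF // expR_gt0. Qed.

Lemma smooth_half_exp k : class_C k U (fun z => - (expR (- w z) / 2)).
Proof.
apply: class_C_opp => //; apply: class_C_mul => //; last exact: class_C_cst.
exact: (smooth_expN_w U_open w_smooth).
Qed.

Lemma smooth_connection_u k : class_C k U A.
Proof.
apply: class_C_add => //; first apply: class_C_add => //.
- apply: class_C_scale => //; first exact: class_C_cst.
  exact: (smooth_alpha2 U_open p_surface).
- apply: class_C_scale => //; first exact: smooth_half_exp.
  exact: (smooth_alpha3 U_open p_surface).
- apply: class_C_scale => //; last exact: (smooth_frame_normal U_open w_smooth p_surface).
  apply: class_C_mul => //; last exact: class_C_cst.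
  exact: class_C_derive (w_smooth k.+1).
Qed.

Lemma smooth_connection_v k : class_C k U B.
Proof.
apply: class_C_add => //; first apply: class_C_add => //.
- apply: class_C_scale => //; first exact: smooth_half_exp.
  exact: (smooth_alpha2 U_open p_surface).
- apply: class_C_scale => //; first exact: class_C_cst.
  exact: (smooth_alpha3 U_open p_surface).
- apply: class_C_scale => //; last exact: (smooth_frame_normal U_open w_smooth p_surface).
  apply: class_C_opp => //; apply: class_C_mul => //; last exact: class_C_cst.
  exact: class_C_derive (w_smooth k.+1).
Qed.

Lemma normal_im z : qre (n z) = 0.
Proof. by rewrite /frame_normal /alpha23; quat_simp; rewrite mulr0. Qed.

Lemma imaginary_combination (x y t : quat R) (c1 c2 c3 : R) :
  qre x = 0 -> qre y = 0 -> qre t = 0 -> qre (c1 *: x + c2 *: y + c3 *: t) = 0.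
Proof. by move=> x0 y0 t0; rewrite !qcoordE x0 y0 t0 !mulr0 !addr0. Qed.

Lemma connection_im z : U z -> qre (A z) = 0 /\ qre (B z) = 0.
Proof.
move=> Uz; have a0 := alpha2_im U_open p_surface Uz; have b0 := alpha3_im U_open p_surface Uz.
by split; apply: imaginary_combination => //; exact: normal_im.
Qed.

Lemma is_derive_half_exp z v : U z ->
  is_derive z v (fun y => - (expR (- w y) / 2)) ('D_v w z * expR (- w z) / 2).
Proof.
move=> Uz; have dw := smooth_is_derive v (w_smooth 1) Uz.
have dwd : differentiable w z by case: (w_smooth 1) => h _; exact: h.
have dN : differentiable (fun y => - w y) z by exact: (differentiableN dwd).
have -> : (fun y => - (expR (- w y) / 2)) = (fun y => - (expR (- w y) * cst (2^-1) y)) by [].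
apply: (is_derive_eq (is_derive_opp (is_derive_mul
  (@is_derive_scalar_comp _ _ expR (fun y => - w y) z v _ _ (is_derive_expR (- w z)) dN
    (is_derive_opp dw))
  (is_derive_cst (2^-1 : R) z v)))).
by rewrite mulr0 addr0 /cst; ring.
Qed.

Lemma is_derive_quarter (c : R) z v v' : U z ->
  is_derive z v (fun y => 'D_v' w y / c) ('D_v ('D_v' w) z / c).
Proof.
move=> Uz; have dw := smooth_is_derive v (class_C_derive v' (w_smooth 2)) Uz.
apply: (is_derive_eq (is_derive_mul dw (is_derive_cst (c^-1 : R) z v))).
by rewrite mulr0 addr0.
Qed.

Lemma connection_flat z : U z ->
  'D_e_v A z - 'D_e_u B z = qmul (A z) (B z) - qmul (B z) (A z).
Proof.
move=> Uz.
have dfa v := is_derive_alpha2 U_open p_surface v Uz; have dfb v := is_derive_alpha3 U_open p_surface v Uz.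
have dfn v := smooth_is_derive v (smooth_frame_normal U_open w_smooth p_surface 1) Uz.
have EA := @derive_val _ _ _ _ _ _ _ (is_derive_add (is_derive_add
  (is_derive_scaleq (is_derive_cst (2^-1 : R) z e_v) (dfa e_v))
  (is_derive_scaleq (is_derive_half_exp e_v Uz) (dfb e_v)))
  (is_derive_scaleq (is_derive_quarter 4 e_v e_v Uz) (dfn e_v))).
have EB := @derive_val _ _ _ _ _ _ _ (is_derive_add (is_derive_add
  (is_derive_scaleq (is_derive_half_exp e_u Uz) (dfa e_u))
  (is_derive_scaleq (is_derive_cst (2^-1 : R) z e_u) (dfb e_u)))
  (is_derive_scaleq (is_derive_opp (is_derive_quarter 4 e_u e_u Uz)) (dfn e_u))).
apply: etrans (congr2 (fun x y => x - y) EA EB) _.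
have lap := proj2 w_sinh_gordon z Uz.
have H := connection_flat_algebra (expR_w_neq0 z) (alpha2_im U_open p_surface Uz)
  (alpha3_im U_open p_surface Uz) (alpha2_norm p_surface Uz) (alpha3_norm p_surface Uz)
  (alpha23_orthogonal p_surface Uz) erefl (expRN (w z))
  (alpha2_v U_open w_smooth p_surface Uz) (alpha2_u U_open w_smooth p_surface Uz)
  (alpha3_u U_open w_smooth p_surface Uz) (alpha3_v U_open w_smooth p_surface Uz)
  (frame_normal_u U_open w_smooth p_surface Uz) (frame_normal_v U_open w_smooth p_surface Uz).
exact: (H _ _ lap).
Qed.

(** The conormal is parallel for the adjoint connection. This is the compatibility
    of the t-equation with the two others. *)
Lemma normal_connection_u z : U z -> 'D_e_u n z = qmul (n z) (A z) - qmul (A z) (n z).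
Proof.
move=> Uz; apply: etrans (frame_normal_u U_open w_smooth p_surface Uz) _.
apply: esym; apply: etrans (connection_normal_algebra (expR_w_neq0 z)
  (alpha2_im U_open p_surface Uz)
  (alpha3_im U_open p_surface Uz) (alpha2_norm p_surface Uz) (alpha3_norm p_surface Uz)
  (alpha23_orthogonal p_surface Uz) erefl _ _ _) _.
have e0 := expR_w_neq0 z.
by rewrite expRN; congr (_ + _); [congr (_ *: _); field|rewrite divff // scale1r].
Qed.

Lemma normal_connection_v z : U z -> 'D_e_v n z = qmul (n z) (B z) - qmul (B z) (n z).
Proof.
move=> Uz; apply: etrans (frame_normal_v U_open w_smooth p_surface Uz) _.
apply: esym; apply: etrans (connection_normal_algebra (expR_w_neq0 z)
  (alpha2_im U_open p_surface Uz)
  (alpha3_im U_open p_surface Uz) (alpha2_norm p_surface Uz) (alpha3_norm p_surface Uz)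
  (alpha23_orthogonal p_surface Uz) erefl _ _ _) _.
have e0 := expR_w_neq0 z.
rewrite expRN; move: e0; generalize (expR (w z)) (alpha2 p z) (alpha3 p z) => e x y e0.
by apply/rowP => i; rewrite !mxE; field.
Qed.

Lemma alpha23E z : alpha23 p z = (2 * expR (w z)) *: n z.
Proof. by rewrite /frame_normal scalerA divff ?scale1r // metric_neq0. Qed.

Lemma q_system_rhs_u (x : quat R) z :
  (expR (- w z) / 8) *: ((4 * expR (w z)) *: qmul x (a z) - 4 *: qmul x (b z)
     + 'D_e_v w z *: qmul x (alpha23 p z)) = qmul x (A z).
Proof. exact: (rhs_u_algebra _ _ _ _ (expR_w_neq0 z) (expRN _) (alpha23E z)). Qed.

Lemma q_system_rhs_v (x : quat R) z :
  - (expR (- w z) / 8) *: (4 *: qmul x (a z) - (4 * expR (w z)) *: qmul x (b z)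
     + 'D_e_u w z *: qmul x (alpha23 p z)) = qmul x (B z).
Proof. exact: (rhs_v_algebra _ _ _ _ (expR_w_neq0 z) (expRN _) (alpha23E z)). Qed.

Lemma q_system_rhs_t (x : quat R) z :
  - (Num.sqrt 3 * expR (- w z) / 4) *: qmul x (alpha23 p z) =
  qmul x (- (Num.sqrt 3 / 2) *: n z).
Proof. exact: (rhs_t_algebra _ _ (expR_w_neq0 z) (expRN _) (alpha23E z)). Qed.

Context (U_connected : connected U) (U_sc : simply_connected (R := R) U).

Lemma connection_solution : exists Q, forall z, U z -> flat_solution A B Q z.
Proof.
apply: (@global_flat_solution R U A B connection_im U_sc _ U_connected).
move=> z Uz.
have [Q _ hQ] := local_flat_solution U_open (smooth_connection_u 2) (smooth_connection_v 2)
  connection_im connection_flat Uz.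
by exists Q; apply: filterS2 hQ (open_nbhs_nbhs (conj U_open Uz)).
Qed.

End Connection.

(** * Functions on a cylinder and the nearly Kahler structure *)

Section Cylinder.
Context {R : realType}.
Implicit Types (W : normedModType R).

(** The two difference quotients are convertible. *)
Lemma is_derive_fst W (f : R * R -> W) (x v : R * R * R) df :
  is_derive x.1 v.1 f df -> is_derive x v (fun y => f y.1) df.
Proof.
by move=> [h1 h2]; split; [exact: h1|exact: h2].
Qed.

Lemma is_derive_snd W (f : R -> W) (x v : R * R * R) df :
  is_derive x.2 v.2 f df -> is_derive x v (fun y => f y.2) df.
Proof.
by move=> [h1 h2]; split; [exact: h1|exact: h2].
Qed.

Lemma differentiable_fst_comp W (f : R * R -> W) (x : R * R * R) :
  differentiable f x.1 -> differentiable (fun y => f y.1) x.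
Proof.
move=> df; apply: (@differentiable_comp _ _ _ _ fst f) => //.
have fst_lin : linear (@fst (R * R) R) by move=> k y z.
pose fstL : {linear (R * R * R)%type -> (R * R)%type} :=
  HB.pack (@fst (R * R) R) (GRing.isLinear.Build _ _ _ _ _ fst_lin).
rewrite -[@fst _ _]/(fstL : _ -> _).
by apply: linear_differentiable => y; exact: cvg_fst.
Qed.

Lemma differentiable_snd_comp W (f : R -> W) (x : R * R * R) :
  differentiable f x.2 -> differentiable (fun y => f y.2) x.
Proof.
move=> df; apply: (@differentiable_comp _ _ _ _ snd f) => //.
have snd_lin : linear (@snd (R * R) R) by move=> k y z.
pose sndL : {linear (R * R * R)%type -> R} :=
  HB.pack (@snd (R * R) R) (GRing.isLinear.Build _ _ _ _ _ snd_lin).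
rewrite -[@snd _ _]/(sndL : _ -> _).
by apply: linear_differentiable => y; exact: cvg_snd.
Qed.

Lemma open_cylinder (U : set (R * R)) : open U -> open (U `*` [set: R]).
Proof.
move=> oU.
have -> : U `*` [set: R] = fst @^-1` U by apply/seteqP; split=> x // [].
by apply: open_comp => // x _; exact: cvg_fst.
Qed.

Lemma class_C_fst W k (U : set (R * R)) (f : R * R -> W) : open U ->
  class_C k U f -> class_C k (U `*` [set: R]) (fun x => f x.1).
Proof.
move=> oU; have oC := open_cylinder oU.
elim: k f => [f cf x [Ux _]|k IH f [df Df]].
  by apply: (@continuous_comp _ _ _ fst f); [exact: cvg_fst|exact: cf].
split=> [x [Ux _]|v]; first by apply: differentiable_fst_comp; exact: df.
by apply: eq_class_C (IH _ (Df v.1)).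
Qed.

Lemma class_C_snd k (U : set (R * R)) (f : R -> R) : open U ->
  class_C k [set: R] f -> class_C k (U `*` [set: R]) (fun x => f x.2).
Proof.
move=> oU; have oC := open_cylinder oU.
elim: k f => [f cf x _|k IH f [df Df]].
  by apply: (@continuous_comp _ _ _ snd f); [exact: cvg_snd|exact: cf].
split=> [x _|v]; first by apply: differentiable_snd_comp; exact: df.
by apply: eq_class_C (IH _ (Df v.2)).
Qed.

Lemma locally_constant_connected (T : topologicalType) (X : Type) (S : set T) (f : T -> X) x y :
  connected S -> (forall z, S z -> \forall z' \near z, S z' /\ f z' = f z) ->
  S x -> S y -> f y = f x.
Proof.
move=> cS loc Sx Sy.
suff E : [set z | S z /\ f z = f x] = S by move: Sy; rewrite -E => -[].
apply: cS.
- by exists x.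
- exists [set z | S z /\ f z = f x]; last by apply/seteqP; split=> z // [].
  rewrite openE => z [Sz fz]; apply: filterS (loc z Sz) => z' [Sz' e].
  by split => //; rewrite e.
- exists (~` [set z | S z /\ f z <> f x]).
    apply: open_closedC; rewrite openE => z [Sz fz]; apply: filterS (loc z Sz) => z' [Sz' e].
    by split => //; rewrite e.
  apply/seteqP; split=> z; first by move=> [Sz fz]; split => // -[].
  by move=> [Sz nf]; split => //; have [//|ne] := pselect (f z = f x); case: nf.
Qed.

End Cylinder.

Section LagrangianAlgebra.
Context {R : realType} (P Q : quat R).
Context (P1 : qdot P P = 1) (Q1 : qdot Q Q = 1).

(** In the left trivialization of the tangent bundle, J is independent of the base
    point. *)
Lemma nk_J_frame (x y : quat R) : nk_J (P, Q) (qmul P x, qmul Q y) =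
  (qmul P ((Num.sqrt 3)^-1 *: (2 *: y - x)), qmul Q ((Num.sqrt 3)^-1 *: (y - 2 *: x))).
Proof.
rewrite /nk_J /qinv P1 Q1 invr1 !scale1r; congr pair.
  by rewrite -[qmul (qmul P _) _]qmulA unit_conjK // !qmulZr qmulBr qmulZr.
by rewrite -[qmul (qmul Q _) _]qmulA unit_conjK // !qmulZr qmulBr qmulZr addrC.
Qed.

Lemma prod_dot_frame (x y x' y' : quat R) :
  prod_dot (qmul P x, qmul Q y) (qmul P x', qmul Q y') = qdot x x' + qdot y y'.
Proof. by rewrite /prod_dot /= !qdot_mull P1 Q1 !mul1r. Qed.

(** As J^2 = -1, the metric pairing is half of JZ . Z' - Z . JZ', a multiple of
    y . x' - x . y'. *)
Lemma nk_g_JZ (x y x' y' : quat R) : qdot x y' = qdot y x' ->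
  nk_g (P, Q) (nk_J (P, Q) (qmul P x, qmul Q y)) (qmul P x', qmul Q y') = 0.
Proof.
move=> E; rewrite /nk_g !nk_J_frame !prod_dot_frame.
have s3 : (Num.sqrt 3 : R)^-1 * (Num.sqrt 3)^-1 = 3^-1.
  by rewrite -invfM -expr2 sqr_sqrtr.
move: (Num.sqrt 3 : R)^-1 s3 => s s3.
rewrite !(qdotZl, qdotZr, qdotDl, qdotDr, qdotNl, qdotNr) E.
move: (qdot y x') (qdot x x') (qdot y y') => c1 c2 c3.
transitivity (s / 2 * (2 * c1 - c2 + (c3 - 2 * c1)) * (1 - 3 * (s * s))); first by field.
by rewrite s3; field.
Qed.

End LagrangianAlgebra.

(** * From a planar solution to a solution on the cylinder *)

Section TwistAlgebra.
Context {R : realType}.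
Implicit Types (Q n A B W : quat R).

Lemma class_C_id k : class_C k [set: R] (fun t : R => t).
Proof.
case: k => [|k]; first by move=> x _; exact: cvg_id.
by apply: (class_C_of_derive (g := fun=> 1)) (class_C_cst k _ _) => x; exact: is_derive_id.
Qed.

Lemma unit_twist Q n (cs sn : R) : qdot Q Q = 1 -> qdot n n = 1 -> qre n = 0 ->
  cs ^+ 2 + sn ^+ 2 = 1 ->
  qdot (cs *: Q + (- sn) *: qmul Q n) (cs *: Q + (- sn) *: qmul Q n) = 1.
Proof.
move=> Q1 n1 n0 cs1.
have E : cs *: Q + (- sn) *: qmul Q n = qmul Q (cs *: quat1 + (- sn) *: n).
  by rewrite qmulDr !qmulZr qmul1r.
rewrite E qdot_mull Q1 mul1r !(qdotDl, qdotDr, qdotZl, qdotZr) n1 qdot11.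
have n10 : qdot quat1 n = 0 by rewrite -n0 qdotE /quat1 !qcoordE; ring.
transitivity (cs ^+ 2 + sn ^+ 2); last by [].
by rewrite (qdotC n) n10; ring.
Qed.

Lemma derive_normal_algebra n A B nu nv (r s : R) :
  nu = qmul n A - qmul A n -> nv = qmul n B - qmul B n ->
  r *: nu + s *: nv = qmul n (r *: A + s *: B) - qmul (r *: A + s *: B) n.
Proof.
move=> -> ->; rewrite qmulDr qmulDl !qmulZl !qmulZr.
by apply/rowP => i; rewrite !mxE; ring.
Qed.

(** W = Q^-1 dQ, so dn = [n, W]. The term Q W n cancels, and what is left factors
    through Q (cs - sn n). *)
Lemma twist_algebra Q n W (cs sn c r : R) : qmul n n = - quat1 ->
  ((- sn * (c * r)) *: Q + cs *: qmul Q W) +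
  ((- (cs * (c * r))) *: qmul Q n +
     (- sn) *: (qmul (qmul Q W) n + qmul Q (qmul n W - qmul W n))) =
  qmul (cs *: Q + (- sn) *: qmul Q n) (W + r *: (- c *: n)).
Proof.
move=> nn; rewrite !(qmulDl, qmulDr) qmulNr !qmulZl !qmulZr !qmulA.
have -> : qmul (qmul Q n) n = - Q by rewrite -qmulA nn qmulNr qmul1r.
move: (qmul Q W) (qmul Q n) (qmul (qmul Q W) n) (qmul (qmul Q n) W) => X Y Z T.
by apply/rowP => i; rewrite !mxE; ring.
Qed.

End TwistAlgebra.

Section Immersion.
Context {R : realType} (U : set (R * R)) (w : R * R -> R) (p : R * R -> quat R).
Context (U_open : open U) (w_sinh_gordon : sinh_gordon U w).
Context (p_surface : associated_minimal_surface U w p).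
Local Notation a := (alpha2 p).
Local Notation b := (alpha3 p).
Local Notation n := (frame_normal w p).
Local Notation A := (connection_u w p).
Local Notation B := (connection_v w p).
Local Notation C := (U `*` [set: R]).
Let w_smooth : smooth_on U w := proj1 w_sinh_gordon.
Let c : R := Num.sqrt 3 / 2.

(** The form q^-1 dq at (z, t), evaluated on the tangent vector v = ((v1, v2), s). *)
Definition q_form (z : R * R) (v : R * R * R) : quat R :=
  v.1.1 *: A z + v.1.2 *: B z + v.2 *: (- c *: n z).

Lemma q_form_im z v : U z -> qre (q_form z v) = 0.
Proof.
move=> Uz; have [a0 b0] := connection_im U_open p_surface Uz.
apply: imaginary_combination => //.
by move: (normal_im w p z) => n0; rewrite qcoordZ n0 mulr0.
Qed.

Section Solution.
Context (Q : R * R -> quat R) (hQ : forall z, U z -> flat_solution A B Q z).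

(** Q exp(- c t n), where n^2 = -1. *)
Definition twisted (x : R * R * R) : quat R :=
  cos (c * x.2) *: Q x.1 + (- sin (c * x.2)) *: qmul (Q x.1) (n x.1).
Local Notation q := twisted.

Lemma smooth_flat_solution k : class_C k U Q.
Proof.
elim: k => [z Uz|k IH].
  by apply: differentiable_continuous; case: (hQ Uz).
split=> [z Uz|v]; first by case: (hQ Uz).
apply: (@eq_class_C _ _ _ _ _ (fun z => qmul (Q z) (v.1 *: A z + v.2 *: B z))) => //.
  by move=> z Uz; apply/esym; case: (flat_solution_derive v (hQ Uz)).
apply: class_C_qmul => //; apply: class_C_add => //; apply: class_C_scale => //.
- exact: class_C_cst.
- exact: smooth_connection_u.
- exact: class_C_cst.
- exact: smooth_connection_v.
Qed.

Lemma smooth_twisted k : class_C k C q.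
Proof.
have oC := open_cylinder U_open.
have ct : class_C k C (fun x => c * x.2).
  apply: (@class_C_snd _ k U (fun t => c * t)) => //.
  apply: class_C_mul; [exact: openT|exact: class_C_cst|].
  exact: class_C_id.
apply: class_C_add => //; apply: class_C_scale => //.
- by apply: (@class_C_comp _ _ _ _ cos (fun x => c * x.2)) => //; case: (@class_C_cos_sin R k).
- by apply: class_C_fst => //; exact: smooth_flat_solution.
- apply: class_C_opp => //.
  by apply: (@class_C_comp _ _ _ _ sin (fun x => c * x.2)) => //; case: (@class_C_cos_sin R k).
- apply: (@class_C_fst _ _ k U (fun z => qmul (Q z) (n z))) => //.
  apply: class_C_qmul => //; first exact: smooth_flat_solution.
  exact: (smooth_frame_normal U_open w_smooth p_surface).
Qed.

Lemma frame_normal_nn z : U z -> qmul (n z) (n z) = - quat1.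
Proof.
move=> Uz; exact: (frame_nn (metric_neq0 w z) (alpha2_im U_open p_surface Uz)
  (alpha3_im U_open p_surface Uz) (alpha2_norm p_surface Uz) (alpha3_norm p_surface Uz)
  (alpha23_orthogonal p_surface Uz) erefl).
Qed.

Lemma frame_normal_unit z : U z -> qdot (n z) (n z) = 1.
Proof.
move=> Uz; exact: (frame_n_unit (metric_neq0 w z) (alpha2_im U_open p_surface Uz)
  (alpha3_im U_open p_surface Uz) (alpha2_norm p_surface Uz) (alpha3_norm p_surface Uz)
  (alpha23_orthogonal p_surface Uz) erefl).
Qed.

Lemma twisted_unit x : C x -> qdot (q x) (q x) = 1.
Proof.
move=> [Uz _]; have [_ _ _ Q1] := hQ Uz.
apply: (unit_twist Q1 (frame_normal_unit Uz) (normal_im w p x.1)).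
exact: cos2Dsin2.
Qed.

Lemma frame_normal_derive_dir z v : U z ->
  is_derive z v n (qmul (n z) (v.1 *: A z + v.2 *: B z) - qmul (v.1 *: A z + v.2 *: B z) (n z)).
Proof.
move=> Uz.
have [dn _] := smooth_frame_normal U_open w_smooth p_surface 1.
split; first exact/diff_derivable/dn.
apply: etrans (derive_plane v (dn _ Uz)) _.
apply: derive_normal_algebra.
  exact: (normal_connection_u U_open w_sinh_gordon p_surface Uz).
exact: (normal_connection_v U_open w_sinh_gordon p_surface Uz).
Qed.

Lemma is_derive_twisted x v : C x -> is_derive x v q (qmul (q x) (q_form x.1 v)).
Proof.
move=> [Uz _].
have dQ := is_derive_fst (flat_solution_derive v.1 (hQ Uz)).
have dQn := is_derive_fst (is_derive_qmul (flat_solution_derive v.1 (hQ Uz))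
  (frame_normal_derive_dir v.1 Uz)).
have dct : is_derive x.2 v.2 (fun t => c * t) (c * v.2).
  apply: (is_derive_eq (is_derive_mul (is_derive_cst c x.2 v.2) (is_derive_id x.2 v.2))).
  by rewrite mul0r add0r.
have dfct : differentiable (fun t => c * t) x.2.
  by apply: (differentiableM (differentiable_cst c x.2)).
have dc := is_derive_snd (@is_derive_scalar_comp _ _ cos (fun t => c * t) x.2 v.2 _ _
  (is_derive_cos (c * x.2)) dfct dct).
have ds := is_derive_snd (@is_derive_scalar_comp _ _ sin (fun t => c * t) x.2 v.2 _ _
  (is_derive_sin (c * x.2)) dfct dct).
apply: (is_derive_eq (is_derive_add (is_derive_scaleq dc dQ)
  (is_derive_scaleq (is_derive_opp ds) dQn))).
exact: twist_algebra (frame_normal_nn Uz).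
Qed.

End Solution.
End Immersion.

(** * The immersion and its uniqueness *)

Section ConclusionAlgebra.
Context {R : realType}.
Implicit Types (a b n x y W : quat R).

(** The matrix of the bilinear form on the left is symmetric: a and b have the same
    norm, and the two mixed coefficients of the connection are equal. *)
Lemma form_dot_algebra a b n (F r s c : R) (v v' : R * R * R) :
  qdot a a = qdot b b -> qdot a b = 0 -> qdot a n = 0 -> qdot b n = 0 ->
  let form (v : R * R * R) := v.1.1 *: (2^-1 *: a + (- (F / 2)) *: b + r *: n) +
    v.1.2 *: ((- (F / 2)) *: a + 2^-1 *: b + s *: n) + v.2 *: (c *: n) in
  qdot (v.1.1 *: a + v.1.2 *: b) (form v') = qdot (form v) (v'.1.1 *: a + v'.1.2 *: b).
Proof.
move=> aa ab an bn /=; rewrite !(qdotDl, qdotDr, qdotZl, qdotZr).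
by rewrite (qdotC b a) (qdotC n a) (qdotC n b) ab an bn aa; ring.
Qed.

Lemma independent_algebra a b (L x y : R) : L != 0 -> qdot a a = L -> qdot b b = L ->
  qdot a b = 0 -> x *: a + y *: b = 0 -> x = 0 /\ y = 0.
Proof.
move=> L0 aa bb ab E.
have Ea := congr1 (fun t => qdot t a) E; have Eb := congr1 (fun t => qdot t b) E.
rewrite /= !qdotDl !qdotZl aa (qdotC b a) ab mulr0 addr0 qdotE !qcoord0 !mul0r !addr0 in Ea.
rewrite /= !qdotDl !qdotZl bb ab mulr0 add0r qdotE !qcoord0 !mul0r !addr0 in Eb.
by split; apply/eqP; [move/eqP: Ea|move/eqP: Eb]; rewrite mulf_eq0 (negbTE L0) orbF.
Qed.

End ConclusionAlgebra.

Section Conclusion.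
Context {R : realType} (U : set (R * R)) (w : R * R -> R) (p : R * R -> quat R).
Context (U_open : open U) (w_sinh_gordon : sinh_gordon U w).
Context (p_surface : associated_minimal_surface U w p).
Local Notation a := (alpha2 p).
Local Notation b := (alpha3 p).
Local Notation n := (frame_normal w p).
Local Notation A := (connection_u w p).
Local Notation B := (connection_v w p).
Local Notation C := (U `*` [set: R]).

(** The system for q with its three equations gathered in one, along an arbitrary
    tangent vector. *)
Definition integrates_q_form (q : R * R * R -> quat R) :=
  forall x v, C x -> is_derive x v q (qmul (q x) (q_form w p x.1 v)).

Lemma q_form_u z : q_form w p z (e_u, 0) = A z.
Proof. by rewrite /q_form /e_u /= scale1r !scale0r !addr0. Qed.
Lemma q_form_v z : q_form w p z (e_v, 0) = B z.
Proof. by rewrite /q_form /e_v /= scale1r !scale0r addr0 add0r. Qed.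
Lemma q_form_t z : q_form w p z (0, 1) = - (Num.sqrt 3 / 2) *: n z.
Proof. by rewrite /q_form /= scale1r !scale0r !add0r. Qed.

Lemma integrates_q_system q : integrates_q_form q -> q_system U w p q.
Proof.
move=> hq; split=> z t Uz.
- rewrite q_system_rhs_t -q_form_t.
  exact: (@derive_val _ _ _ _ _ _ _ (hq (z, t) (0, 1) (conj Uz I))).
- rewrite q_system_rhs_u -q_form_u.
  exact: (@derive_val _ _ _ _ _ _ _ (hq (z, t) (e_u, 0) (conj Uz I))).
- rewrite q_system_rhs_v -q_form_v.
  exact: (@derive_val _ _ _ _ _ _ _ (hq (z, t) (e_v, 0) (conj Uz I))).
Qed.

Lemma derive_space (W : normedModType R) (f : R * R * R -> W) (x v : R * R * R) :
  differentiable f x ->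
  'D_v f x = v.1.1 *: 'D_(e_u, 0) f x + v.1.2 *: 'D_(e_v, 0) f x + v.2 *: 'D_(0, 1) f x.
Proof.
move=> df; have E : v = v.1.1 *: (e_u, 0) + v.1.2 *: (e_v, 0) + v.2 *: (0, 1) :> R * R * R.
  case: v => [[v1 v2] v3]; rewrite /e_u /e_v; congr (_, _, _) => /=;
  by rewrite /GRing.scale /= ?mulr1 ?mulr0 ?addr0 ?add0r.
by rewrite {1}E !deriveE // !linearD !linearZ.
Qed.

(** Smoothness makes the differential linear in the tangent vector, so the three
    coordinate directions suffice. *)
Lemma q_system_integrates q : smooth_on C q -> q_system U w p q -> integrates_q_form q.
Proof.
move=> sq [qt qu qv] [z t] v [Uz _].
have dq : differentiable q (z, t) by case: (sq 1) => h _; exact: h.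
split; first exact: diff_derivable.
apply: etrans (derive_space v dq) _.
have et := etrans (qt z t Uz) (q_system_rhs_t w p (q (z, t)) z).
have eu := etrans (qu z t Uz) (q_system_rhs_u w p (q (z, t)) z).
have ev := etrans (qv z t Uz) (q_system_rhs_v w p (q (z, t)) z).
by rewrite et eu ev /q_form -!qmulZr -!qmulDr.
Qed.

Lemma integrates_ratio q q' : integrates_q_form q -> integrates_q_form q' ->
  forall x, C x -> \forall y \near x, C y /\
    qmul (q' y) (qconj (q y)) = qmul (q' x) (qconj (q x)).
Proof.
move=> hq hq' x Cx.
have nC : \forall y \near x, C y.
  by apply: open_nbhs_nbhs; split => //; exact: open_cylinder.
have n0 : \forall y \near x, qmul (q' y) (qconj (q y)) = qmul (q' x) (qconj (q x)).
  apply: derive0_locally_constant; apply: filterS nC => y Cy v.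
  apply: (is_derive_eq (is_derive_qmul (hq' y v Cy) (is_derive_qconj (hq y v Cy)))).
  apply: ratio_derivative_algebra.
  by apply: (q_form_im U_open p_surface); case: Cy.
by apply: filterS2 nC n0.
Qed.

Lemma integrates_unique q q' : connected U ->
  (forall x, C x -> sphere3 (q x)) -> (forall x, C x -> sphere3 (q' x)) ->
  integrates_q_form q -> integrates_q_form q' ->
  exists2 c, sphere3 c & forall x, C x -> q' x = qmul c (q x).
Proof.
move=> U_connected q1 q'1 hq hq'.
have [[z0 Uz0]|nU] := pselect (exists z, U z); last first.
  exists quat1; first exact: qdot11.
  by move=> x [Ux _]; exfalso; apply: nU; exists x.1.
pose F x := qmul (q' x) (qconj (q x)).
have loc := integrates_ratio hq hq'.
have Ft z t : U z -> F (z, t) = F (z, 0).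
  move=> Uz.
  apply: (@locally_constant_connected _ _ [set: R] (fun t => F (z, t)) 0 t) => //.
    by apply/connected_intervalP => x y _ _ u _.
  move=> s _; have /nbhs_ballP[r r0 h] := loc (z, s) (conj Uz I).
  apply/nbhs_ballP; exists r => // s' ss'; split => //.
  have [|_ E] := h (z, s'); last exact: E.
  by split => //=; exact: ballxx.
have Fz z : U z -> F (z, 0) = F (z0, 0).
  move=> Uz; apply: (@locally_constant_connected _ _ U (fun z => F (z, 0)) z0 z) => // y Uy.
  have /nbhs_ballP[r r0 h] := loc (y, 0) (conj Uy I).
  apply/nbhs_ballP; exists r => // y' yy'.
  have [|[Uy' _] E] := h (y', 0); last by split; [exact: Uy'|exact: E].
  by split => //=; exact: ballxx.
exists (F (z0, 0)).
  have C0 : C (z0, 0) by split.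
  by rewrite /sphere3 /= qdotM qdot_conj (q1 _ C0) (q'1 _ C0) mulr1.
move=> [z t] [Uz _]; rewrite -(Fz z Uz) -(Ft z t Uz).
by rewrite /F -qmulA qmulVq (q1 (z, t) (conj Uz I)) scale1r qmul1r.
Qed.

Section Lagrangian.
Context (q : R * R * R -> quat R) (q_smooth : smooth_on C q).
Context (q_unit : forall x, C x -> qdot (q x) (q x) = 1) (hq : integrates_q_form q).
Let f (x : R * R * R) := (p x.1, q x).

Lemma diff_f x v : C x -> 'd f x v =
  (qmul (p x.1) (v.1.1 *: a x.1 + v.1.2 *: b x.1), qmul (q x) (q_form w p x.1 v)).
Proof.
move=> Cx; have [Uz _] := Cx.
have dq : differentiable q x by case: (q_smooth 1) => h _; exact: h.
have dp : differentiable p x.1 by case: (smooth_p p_surface 1) => h _; exact: h.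
have dpf := differentiable_fst_comp dp.
rewrite /f diff_pair //; congr pair; rewrite -deriveE //.
  apply: etrans (@derive_val _ _ _ _ _ _ _ (is_derive_fst (differentiable_is_derive v.1 dp))) _.
  apply: etrans (derive_plane v.1 dp) _.
  by rewrite (p_u p_surface Uz) (p_v p_surface Uz) -!qmulZr -qmulDr.
exact: (@derive_val _ _ _ _ _ _ _ (hq v Cx)).
Qed.

Lemma q_form_dot z (v v' : R * R * R) : U z ->
  qdot (v.1.1 *: a z + v.1.2 *: b z) (q_form w p z v') =
  qdot (q_form w p z v) (v'.1.1 *: a z + v'.1.2 *: b z).
Proof.
move=> Uz; apply: form_dot_algebra.
- exact: etrans (alpha2_norm p_surface Uz) (esym (alpha3_norm p_surface Uz)).
- exact: (alpha23_orthogonal p_surface Uz).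
- exact: (frame_an0 (alpha2_im U_open p_surface Uz) (alpha3_im U_open p_surface Uz) erefl).
- exact: (frame_bn0 (alpha2_im U_open p_surface Uz) (alpha3_im U_open p_surface Uz) erefl).
Qed.

(** For injectivity, the component in the first factor kills the u and v components
    of a vector in the kernel, as alpha2 and alpha3 are independent; the second
    component then kills the t component, n being a unit vector. *)
Lemma lagrangian_of_integral : lagrangian_immersion C f.
Proof.
split.
- by move=> x Cx; split; [case: Cx => Uz _; exact: (p_unit p_surface Uz)|exact: q_unit].
- split.
    move=> k; apply: class_C_pair; first exact: open_cylinder.
      by apply: class_C_fst => //; exact: (smooth_p p_surface).
    exact: q_smooth.
  move=> x Cx; have [Uz _] := Cx; apply: raddf_inj => v.
  move=> E; have := etrans (esym (diff_f v Cx)) E.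
  move=> -[/(congr1 (qmul (qconj (p x.1)))) E1 /(congr1 (qmul (qconj (q x)))) E2].
  rewrite !unit_conjK ?(p_unit p_surface Uz) ?q_unit // !qmul0r in E1 E2.
  have [v1 v2] := independent_algebra (metric_neq0 w x.1) (alpha2_norm p_surface Uz)
    (alpha3_norm p_surface Uz) (alpha23_orthogonal p_surface Uz) E1.
  rewrite /q_form v1 v2 !scale0r !add0r scalerA in E2.
  have v3 : v.2 * - (Num.sqrt 3 / 2) = 0.
    have := congr1 (fun y => qdot y y) E2.
    rewrite qdotZl qdotZr (frame_normal_unit U_open p_surface Uz) mulr1 qdotE !qcoord0 !mulr0 !addr0.
    by move/eqP; rewrite mulf_eq0 orbb => /eqP.
  move/eqP: v3; rewrite mulf_eq0 oppr_eq0 mulf_eq0 invr_eq0 pnatr_eq0 orbF sqrtr_eq0.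
  rewrite leNgt ltr0n orbF => /eqP v3.
  by move: v1 v2 v3; case: (v) => [[x1 x2] x3] /= -> -> ->.
- move=> x Cx X Y; rewrite (diff_f X Cx) (diff_f Y Cx); have [Uz _] := Cx.
  apply: nk_g_JZ; [exact: (p_unit p_surface Uz)|exact: q_unit|exact: q_form_dot].
Qed.

End Lagrangian.

End Conclusion.

Theorem theorem6 (R : realType) (U : set (R * R)) (w : R * R -> R)
    (p : R * R -> 'rV[R]_4)
    (U_open : open U) (U_connected : connected U)
    (U_simply_connected : simply_connected (R := R) U)
    (w_sinh_gordon : sinh_gordon U w)
    (p_surface : associated_minimal_surface U w p) :
  exists q : R * R * R -> 'rV[R]_4,
    [/\ lagrangian_immersion (U `*` [set: R]) (fun x => (p x.1, q x)),
        q_system U w p q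
      & forall q' : R * R * R -> 'rV[R]_4,
          smooth_on (U `*` [set: R]) q' ->
          (forall x, (U `*` [set: R]) x -> sphere3 (q' x)) ->
          q_system U w p q' ->
          exists2 c : 'rV[R]_4, sphere3 c &
            forall x, (U `*` [set: R]) x -> q' x = qmul c (q x)].
Proof.
have [Q hQ] := connection_solution U_open w_sinh_gordon p_surface U_connected U_simply_connected.
pose q := twisted w p Q.
have q_smooth : smooth_on (U `*` [set: R]) q.
  exact: (smooth_twisted U_open w_sinh_gordon p_surface hQ).
have q_unit x : (U `*` [set: R]) x -> qdot (q x) (q x) = 1.
  exact: (twisted_unit U_open p_surface hQ).
have hq : integrates_q_form U w p q.
  exact: (is_derive_twisted U_open w_sinh_gordon p_surface hQ).
exists q; split.
- exact: (lagrangian_of_integral U_open p_surface q_smooth q_unit hq).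
- exact: integrates_q_system hq.
- move=> q' sq' q'1 hq'.
  exact: (integrates_unique U_open p_surface U_connected q_unit q'1 hq (q_system_integrates sq' hq')).
Qed.
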